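(* Let $X\in\mathcal{W}_1$ be an $n$-dimensional toric Fano manifold which does not admit K\''ahler-Einstein metrics and for which $\mathfrak{Im}(v_{KRS})$ generates a one-parameter subgroup of $G$, with Fano polytope $P\subset N_{\mathbb{R}}$ and dual polytope $P^*\subset M_{\mathbb{R}}$, and let $\{\psi_t\}_t$, $\psi_\infty$, $\mu$, $\{p^{\max(k)}\}_k$ and $p^{(\delta^* )}$ be as defined in the context. Let $\delta^*$ be an $(n-l-1)$-dimensional face of $P^*$ and let $\delta$ be the $l$-dimensional face of $P$ associated with $\delta^*$ by duality. Then we have the following two possibilities. (i) If for any $x\in\delta$ there is an integral point $p^{\max(k)}_x$ among the $p^{\max(k)}$ (possibly depending on $x$) such that $\langle p^{\max(k)}_x,x\rangle\ge 0$, then $c_{\{p^{(\delta^* )}\}}(\psi_\infty)\ge 1$. In particular $\mu^{-1}(\delta^* )$ is not contained in the support of the $G^{\mathbb{C}}$-invariant MIS of exponent $\gamma$ obtained from $\{\psi_t\}_t$ for any $\gamma<1$. (ii) Suppose that there is a point $x\in\delta$ such that \[ \langle p^{\max(k)},x\rangle<0\quad\text{for any }k. \qquad ( * ) \] Let $p^{\max(k_0)}$ be a vertex of $P^*$ (one of the $p^{\max(k)}$) and $x^{(0)}$ a point in $\delta$ such that \[ \langle p^{\max(k_0)},x^{(0)}\rangle=\min_x\max_k\langle p^{\max(k)},x\rangle , \] where $x$ runs over $\{x\in\delta\mid x\text{ satisfies }( * )\}$, the minimum over $x$ being attained at $x^{(0)}$ and the maximum over $k$ at $x^{(0)}$ being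 attained at $k_0$. Then \[ c_{\{p^{(\delta^* )}\}}(\psi_\infty)=\frac{1}{1-\langle p^{\max(k_0)},x^{(0)}\rangle}<1 . \] In particular $\mu^{-1}(\delta^* )$ is contained in the support of the $G^{\mathbb{C}}$-invariant MIS of exponent $\gamma$ obtained from $\{\psi_t\}_t$ for any $\gamma\in(c_{\{p^{(\delta^* )}\}}(\psi_\infty),1)$.
   Context: Toric notation. $X$ carries an effective action of $T_{\mathbb{C}}=(\mathbb{C}^* )^n$ with real torus $T_{\mathbb{R}}=(S^1)^n$; $N_{\mathbb{R}}=J\mathfrak{t}_{\mathbb{R}}\simeq\mathbb{R}^n$ ($\mathfrak{t}_{\mathbb{R}}=\mathrm{Lie}(T_{\mathbb{R}})$, $J$ the complex structure), $M_{\mathbb{R}}$ is its dual, with lattices $N$, $M$, and $T_{\mathbb{C}}=T_{\mathbb{R}}\times N_{\mathbb{R}}$ via $t_i=\exp(\frac12x_i+\sqrt{-1}\theta_i)$; $T_{\mathbb{R}}$-invariant functions on the dense orbit are regarded as functions of $x\in N_{\mathbb{R}}$. The Fano polytope $P\subset N_{\mathbb{R}}$ is the convex hull of the primitive generators of the rays of the fan of $X$; its faces are simplices. $P^*=\{y\in M_{\mathbb{R}}\mid\langle y,q\rangle\le1\text{ for all vertices }q\text{ of }P\}$. An $(n-l-1)$-dimensional face $\delta^*$ of $P^*$ and an $l$-dimensional face $\delta$ of $P$ are associated if $\delta^*=P^*\cap\bigcap_i\{y\mid\langle y,q^{(i)}\rangle=1\}$, $q^{(i)}$ running over the vertices of $\delta$.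 $\mathcal{W}(X)=\mathcal{N}(T_{\mathbb{C}})/T_{\mathbb{C}}$ ($\mathcal{N}(T_{\mathbb{C}})$ the normalizer in $\mathrm{Aut}(X)$) is the finite group of elements of $\mathrm{GL}(N,\mathbb{Z})$ preserving $P$; $\mathcal{W}_1$ is the class of toric Fano manifolds for which the fixed subspace $N_{\mathbb{R}}^{\mathcal{W}(X)}$ has dimension $1$. $G\subset\mathcal{N}(T_{\mathbb{C}})$ is the maximal compact subgroup generated by $T_{\mathbb{R}}$ and $\mathcal{W}(X)$, and $G^{\mathbb{C}}$ is its complexification. Standard metric. Let $p^{(1)},\dots,p^{(m)}$ be all lattice points of $P^*$, $u_0(x)=\log\sum_{i=1}^me^{\langle p^{(i)},x\rangle}$ on $N_{\mathbb{R}}$. The K\''ahler form $\omega_0\in c_1(X)$ is the extension to $X$ of $\frac{\sqrt{-1}}{2\pi}\partial\bar\partial u_0$. $\mu:X\to M_{\mathbb{R}}$ is the moment map for $\omega_0$, with image $P^*$, given on the dense orbit by $\nabla u_0$. For a face $\delta^*$ of $P^*$, $p^{(\delta^* )}$ is the average of all lattice points of $P^*$ lying on $\delta^*$; it lies in the relative interior of $\delta^*$. Soliton. A K\''ahler-Ricci soliton is a pair $(v_{KRS},\omega_{KRS})$ of a holomorphic vector field and a K\''ahler form in $c_1(X)$ with $\mathrm{Ric}(\omega_{KRS})-\omega_{KRS}=\mathcal{L}_{v_{KRS}}\omega_{KRS}$ (it exists on $X$, uniquely up to the identity component of $\mathrm{Aut}(X)$). $\beta_{KRS}\in N_{\mathbb{R}}$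 is the vector with $v_{KRS}=\frac12(v^\sharp-\sqrt{-1}Jv^\sharp)$, $v^\sharp$ the real vector field induced by $\beta_{KRS}$; it is $\mathcal{W}(X)$-invariant. The family $\rho_t$. Let $\phi_t$ solve the potential form of the normalized K\''ahler-Ricci flow, $\frac{\partial\phi_t}{\partial t}=\log\frac{\det(g_{i\bar j}+\phi_{i\bar j})}{\det(g_{i\bar j})}+\phi_t-h_0$, $\phi_0\equiv0$, where $(g_{i\bar j})$ is the metric of $\omega_0$ and $\mathrm{Ric}(\omega_0)-\omega_0=\frac{\sqrt{-1}}{2\pi}\partial\bar\partial h_0$, $\int_Xe^{h_0}\omega_0^n=\int_X\omega_0^n$. The convex function $u_t=u_0+\phi_t$ on $N_{\mathbb{R}}$ has a minimal point $x_t$, which lies on the line $\mathbb{R}\beta_{KRS}$. One replaces $\{x_t\}$ by a regularized family $x'_t=s_t\beta_{KRS}$, $s_t\in\mathbb{R}$, with $|x_t-x'_t|\le C$ and $|ds_t/dt|\le C$ for all $t$, chosen as in Tian-Zhu so that $\rho_t^*(\omega_0+\frac{\sqrt{-1}}{2\pi}\partial\bar\partial\phi_t)$ converges smoothly to a K\''ahler-Ricci soliton associated to $v_{KRS}$ and $ds_t/dt\to1$ as $t\to\infty$, where $\rho_t\in T_{\mathbb{C}}$ is the automorphism inducing the translation $x\mapsto x+s_t\beta_{KRS}$ on $N_{\mathbb{R}}$. The functions $\psi_t$. $\psi_t$ is defined by $(\rho_t^{-1})^*\omega_0=\omega_0+\frac{\sqrt{-1}}{2\pi}\partial\bar\partial\psi_t$,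 $\sup_X\psi_t=0$, and $\psi_\infty$ is the limit of $\psi_t$ in $L^1$ as $t\to\infty$, an almost plurisubharmonic function (locally plurisubharmonic plus smooth). The points $p^{\max(k)}$. $\{p^{\max(k)}\}_k$ is the set of all lattice points $p$ of $P^*$ with $\langle p,-\beta_{KRS}\rangle=\max_{i=1,\dots,m}\langle p^{(i)},-\beta_{KRS}\rangle$. Singularity exponents. For compact $K\subset X$, $c_K(\varphi)=\sup\{c\ge0\mid e^{-c\varphi}\text{ is }L^1\text{ on a neighborhood of }K\}$. For $y\in P^*$, $c_{\{y\}}(\psi_\infty):=c_{\mu^{-1}(y)}(\psi_\infty)$. The MIS of exponent $\gamma$ obtained from $\{\psi_t\}_t$ is the subscheme cut out by $\mathcal{I}(\gamma\psi_\infty)$, where $\Gamma(U,\mathcal{I}(\psi))=\{f\in\mathcal{O}_X(U)\mid\int_U|f|^2e^{-\psi}d\nu<\infty\}$ (integrability understood locally, $d\nu$ a fixed volume form); its support is $\{p\in X\mid c_{\{p\}}(\psi_\infty)<\gamma\}$. *)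

(* Defs.v *)
From HB Require Import structures.
From mathcomp Require Import all_boot all_order all_algebra.
From mathcomp Require Import all_classical all_reals all_analysis.
From mathcomp.real_closed Require Export complex.
Import Order.TTheory GRing.Theory Num.Theory.
Import numFieldNormedType.Exports.

Set Implicit Arguments.
Unset Strict Implicit.
Unset Printing Implicit Defensive.

Local Open Scope classical_set_scope.
Local Open Scope ring_scope.
Local Open Scope complex_scope.

(* N, M are Z^n, and N_R, M_R are R^n, all written as row vectors. *)

Definition pairing (A : comPzRingType) n (y x : 'rV[A]_n) : A :=
  \sum_j y 0 j * x 0 j.

Definition realv (R : realType) n (p : 'rV[int]_n) : 'rV[R]_n :=
  map_mx (fun k : int => k%:~R) p.

Section Polytopes.
Context {R : realType} {n : nat}.
Implicit Types (Q F : set 'rV[R]_n).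

Definition hull r (q : 'I_r -> 'rV[int]_n) : set 'rV[R]_n :=
  [set x | exists c : 'I_r -> R,
    [/\ forall i, 0 <= c i, \sum_i c i = 1 & x = \sum_i c i *: realv R (q i)]].

Definition is_face Q F :=
  F !=set0 /\ exists (u : 'rV[R]_n) (c : R),
    (forall x, Q x -> pairing u x <= c) /\
    F = [set x | Q x /\ pairing u x = c].

(* U is the direction of the affine hull of F *)
Definition has_dim F (d : nat) :=
  exists (a : 'rV[R]_n) (U : {vspace 'rV[R]_n}),
    [/\ F a, \dim U = d, forall x, F x -> x - a \in U &
        forall U' : {vspace 'rV[R]_n},
          (forall x, F x -> x - a \in U') -> (U <= U')%VS].

Definition is_vertex Q (x : 'rV[R]_n) := is_face Q [set x].

Definition is_facet Q F := is_face Q F /\ has_dim F n.-1.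

End Polytopes.

Definition frame_mx n r (q : 'I_r -> 'rV[int]_n) (s : 'I_n -> 'I_r) :
  'M[int]_n := \matrix_(i, j) q (s i) 0 j.

(* s lists a Z-basis of N made of all the vertices of the facet F. *)
Definition frame_of (R : realType) n r (q : 'I_r -> 'rV[int]_n)
    (F : set 'rV[R]_n) (s : 'I_n -> 'I_r) :=
  frame_mx q s \in unitmx /\
  forall i, F (realv R (q i)) <-> exists j, i = s j.

(* A smooth Fano polytope P, given by its vertices: the cones over its proper
   faces form the fan of an n-dimensional toric Fano manifold, and every toric
   Fano manifold arises in this way.  The last field holds for every polytope;
   it is only there to provide a maximal cone. *)
Record fano_polytope (R : realType) (n : nat) := FanoPolytope {
  nvert : nat;
  vert : 'I_nvert -> 'rV[int]_n;
  vert_inj : injective vert;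
  vert_vertex : forall i, is_vertex (hull (R := R) vert) (realv R (vert i));
  fano_interior : (hull (R := R) vert)° 0;
  fano_smooth : forall F : set 'rV[R]_n, is_facet (hull vert) F ->
    exists s, frame_of vert F s;
  fano_facet : exists F : set 'rV[R]_n, is_facet (hull vert) F }.

Section Combinatorics.
Context {R : realType} {n : nat} (P : fano_polytope R n).

Definition polytope : set 'rV[R]_n := hull (@vert R n P).

Definition dual_polytope : set 'rV[R]_n :=
  [set y | forall i, pairing y (realv R (@vert R n P i)) <= 1].

Definition lattice_pts : set 'rV[int]_n := [set p | dual_polytope (realv R p)].

Definition dual_face (d : set 'rV[R]_n) : set 'rV[R]_n :=
  [set y | dual_polytope y /\
    forall q, is_vertex polytope q -> d q -> pairing y q = 1].

(* p^(delta^* ) *)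
Definition lattice_mean (d : set 'rV[R]_n) : 'rV[R]_n :=
  let S := [set p | lattice_pts p /\ d (realv R p)] in
  (\sum_(p \in S) (1 : R))^-1 *: \sum_(p \in S) realv R p.

(* the p^max(k), for the soliton direction b *)
Definition max_pts (b : 'rV[R]_n) : set 'rV[int]_n :=
  [set p | lattice_pts p /\ forall p', lattice_pts p' ->
    pairing (realv R p') (- b) <= pairing (realv R p) (- b)].

Definition intmx (A : 'M[int]_n) : 'M[R]_n := map_mx (fun k : int => k%:~R) A.

Definition weyl (A : 'M[int]_n) :=
  A \in unitmx /\ forall x, polytope x <-> polytope (x *m intmx A).

Definition class_W1 := exists U : {vspace 'rV[R]_n},
  (forall x, x \in U <-> forall A, weyl A -> x *m intmx A = x) /\ \dim U = 1%N.

Definition is_frame (s : 'I_n -> 'I_(nvert P)) :=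
  exists F : set 'rV[R]_n, is_facet polytope F /\ frame_of (@vert R n P) F s.

(* A maximal cone of the fan, with an ordering of its rays. *)
Record chart := Chart {
  frame :> 'I_n -> 'I_(nvert P);
  frameP : is_frame frame }.

(* coordinates a of x = \sum_j a_j q_(s j) *)
Definition cone_coord (s : chart) (x : 'rV[R]_n) : 'rV[R]_n :=
  x *m invmx (intmx (frame_mx (@vert R n P) s)).

Lemma chart_ex : exists s : chart, True.
Proof.
have [F FF] := fano_facet P; have [s Fs] := fano_smooth FF.
by exists (@Chart s (ex_intro _ F (conj FF Fs))).
Qed.

Definition some_chart : chart := projT1 (cid chart_ex).

End Combinatorics.

(* C^n is identified with R^(n + n): real parts, then imaginary parts. *)
Section ComplexCalculus.
Context {R : realType} {n : nat}.
Notation Cn := 'rV[R]_(n + n).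

Definition toC (z : Cn) : 'rV[R[i]]_n :=
  \row_j (z 0 (lshift n j) +i* z 0 (rshift n j)).

Definition ofC (w : 'rV[R[i]]_n) : Cn :=
  row_mx (\row_j complex.Re (w 0 j)) (\row_j complex.Im (w 0 j)).

Definition cis (t : R) : R[i] := cos t +i* sin t.

Definition abs2 (c : R[i]) : R := complex.Re c ^+ 2 + complex.Im c ^+ 2.

Definition pderiv m (s : seq 'I_m) (f : 'rV[R]_m -> R) : 'rV[R]_m -> R :=
  foldr (fun i g z => 'D_(delta_mx 0 i) g z) f s.

Definition smooth_on m (A : set 'rV[R]_m) (f : 'rV[R]_m -> R) :=
  forall s z, A z -> {for z, continuous (pderiv s f)} /\
    forall i, derivable (pderiv s f) z (delta_mx 0 i).

Definition csmooth_on (A : set Cn) (f : Cn -> R[i]) :=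
  smooth_on A (fun z => complex.Re (f z)) /\
  smooth_on A (fun z => complex.Im (f z)).

Definition cderiv (v : Cn) (f : Cn -> R[i]) (z : Cn) : R[i] :=
  ('D_v (fun y => complex.Re (f y)) z) +i* ('D_v (fun y => complex.Im (f y)) z).

(* Wirtinger derivatives d/dz_j and d/d(conj z_j) *)
Definition dz (j : 'I_n) (f : Cn -> R[i]) (z : Cn) : R[i] :=
  (cderiv (delta_mx 0 (lshift n j)) f z
   - 'i * cderiv (delta_mx 0 (rshift n j)) f z) / 2%:R.

Definition dzb (j : 'I_n) (f : Cn -> R[i]) (z : Cn) : R[i] :=
  (cderiv (delta_mx 0 (lshift n j)) f z
   + 'i * cderiv (delta_mx 0 (rshift n j)) f z) / 2%:R.

(* In a chart, a (1,1)-form (sqrt(-1) / 2 pi) \sum g_ij dz_i /\ d(conj z_j) is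
   represented by the matrix (g_ij). *)
Definition ddbar (Phi : Cn -> R) (z : Cn) : 'M[R[i]]_n :=
  \matrix_(i, j) dz i (dzb j (fun y => (Phi y)%:C)) z.

Definition posdef (g : 'M[R[i]]_n) :=
  forall v : 'rV[R[i]]_n, v != 0 ->
    0 < \sum_i \sum_j v 0 i * g i j * conjc (v 0 j).

(* the Ricci form of the Kaehler form with local potential Phi *)
Definition ricci (Phi : Cn -> R) (z : Cn) : 'M[R[i]]_n :=
  - ddbar (fun y => ln (complex.Re (\det (ddbar Phi y)))) z.

(* Lie derivative of a (1,1)-form g along a holomorphic field \sum v_k d/dz_k;
   the terms with d v_k / d(conj z_j) vanish. *)
Definition lie (v : Cn -> 'rV[R[i]]_n) (g : Cn -> 'M[R[i]]_n) (z : Cn) :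
    'M[R[i]]_n :=
  \matrix_(i, j) \sum_k (v z 0 k * dz k (fun y => g y i j) z
                         + dz i (fun y => v y 0 k) z * g z k j).

(* plurisubharmonic functions, with values in [-oo, +oo) *)
Definition psh_on (A : set Cn) (w : Cn -> \bar R) :=
  [/\ forall z, A z -> (w z < +oo)%E,
      forall z (a : R), A z -> (w z < a%:E)%E -> \forall y \near z, (w y < a%:E)%E
    & forall z v : Cn,
        (forall c : R[i], abs2 c <= 1 -> A (ofC (toC z + c *: toC v))) ->
        ((2 * pi)%:E * w z <=
          \int[lebesgue_measure]_(t in `[0%R, (2 * pi)%R])
             w (ofC (toC z + cis t *: toC v)))%E].

End ComplexCalculus.

(* Iterated Lebesgue integral over A^m; it is used only for nonnegative Borel
   functions, for which it is the integral for the product measure. *)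
Fixpoint iint (R : realType) (A : set R) (m : nat) :
    ('rV[R]_m -> \bar R) -> \bar R :=
  match m return ('rV[R]_m -> \bar R) -> \bar R with
  | 0%N => fun f => f 0
  | m'.+1 => fun f => (\int[lebesgue_measure]_(x in A)
      iint A (fun v : 'rV[R]_m' => f (row_mx (const_mx x : 'rV[R]_1) v)))%E
  end.

Section ToricManifold.
Context {R : realType} {n : nat} (P : fano_polytope R n).
Notation Cn := 'rV[R]_(n + n).
Notation Cox := 'rV[R[i]]_(nvert P).

(* X as Cox's quotient: the vectors z of C^(rays) whose zero coordinates belong
   to a common cone, modulo the group of the g in (C^* )^(rays) with
   \prod_i g_i^<m, q_i> = 1 for all m in M.  A point of X is an orbit.
   Convention: the point of T_C with coordinates t has Cox coordinates z such
   that t^m = \prod_i z_i^(- <m, q_i>).  The sign is the one for which, as for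
   u_0 and {<y, q> <= 1}, the divisor of the ray q is approached as
   x -> +oo . q. *)
Definition cox_admissible (z : Cox) :=
  exists s : chart P, forall i, z 0 i = 0 -> exists j, i = s j.

Definition cox_group (g : Cox) :=
  (forall i, g 0 i != 0) /\
  forall m : 'rV[int]_n, \prod_i g 0 i ^ pairing m (@vert R n P i) = 1.

Definition cox_orbit (z : Cox) : set Cox :=
  [set z' | exists g, cox_group g /\ z' = \row_i (g 0 i * z 0 i)].

Record toric := ToricPt {
  coords : set Cox;
  coordsP : exists z, cox_admissible z /\ coords = cox_orbit z }.

Definition chart_lift (s : chart P) (w : 'rV[R[i]]_n) : Cox :=
  \row_i (if [pick j | s j == i] is Some j then w 0 j else 1).

Lemma chart_lift_admissible s w : cox_admissible (chart_lift s w).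
Proof.
exists s => i; rewrite mxE; case: pickP => [j /eqP <- _|_ /eqP].
  by exists j.
by rewrite oner_eq0.
Qed.

(* the affine chart C^n -> X of a maximal cone *)
Definition chart_pt (s : chart P) (z : Cn) : toric :=
  ToricPt (ex_intro _ (chart_lift s (toC z))
    (conj (chart_lift_admissible s (toC z)) erefl)).

Definition xopen (U : set toric) := forall s, open (chart_pt s @^-1` U).

(* The point exp (x / 2 + sqrt(-1) th) of T_C; it does not depend on the chart
   used to define it. *)
Definition torus_pt (x th : 'rV[R]_n) : toric :=
  let s := some_chart P in
  chart_pt s (ofC (\row_j ((expR (- cone_coord s x 0 j / 2))%:C
                           * cis (- cone_coord s th 0 j)))).

(* in a chart, the element of T_C inducing the translation x |-> x + y *)
Definition chart_transl (s : chart P) (y : 'rV[R]_n) (z : Cn) : Cn :=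
  ofC (\row_j ((expR (- cone_coord s y 0 j / 2))%:C * toC z 0 j)).

Definition xsmooth (f : toric -> R) :=
  forall s, smooth_on setT (fun z => f (chart_pt s z)).

Definition xholomorphic (U : set toric) (f : toric -> R[i]) :=
  forall s, csmooth_on (chart_pt s @^-1` U) (fun z => f (chart_pt s z)) /\
    forall j z, U (chart_pt s z) -> dzb j (fun y => f (chart_pt s y)) z = 0.

Definition u0 (x : 'rV[R]_n) : R :=
  ln (\sum_(p \in lattice_pts P) expR (pairing (realv R p) x)).

Definition grad0 (x : 'rV[R]_n) : 'rV[R]_n := \row_j 'D_(delta_mx 0 j) u0 x.

Definition hess0 (x : 'rV[R]_n) : 'M[R]_n :=
  \matrix_(i, j) pderiv [:: i; j] u0 x.

(* Local potential of omega_0 in a chart.  On T_C it is u_0 - <p_s, x>, with p_s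
   the vertex of P^* dual to the facet of s, because |z_j|^2 = e^(- a_j) when
   x = \sum_j a_j q_(s j). *)
Definition pot0 (s : chart P) (z : Cn) : R :=
  ln (\sum_(p \in lattice_pts P)
        \prod_j abs2 (toC z 0 j) ^ (1 - pairing p (@vert R n P (s j)))).

(* local potential of omega_0 + (sqrt(-1) / 2 pi) d dbar phi; the forms of this
   kind are the closed real (1,1)-forms in c_1(X) *)
Definition pot (phi : toric -> R) (s : chart P) (z : Cn) : R :=
  pot0 s z + phi (chart_pt s z).

Definition kaehler (phi : toric -> R) :=
  xsmooth phi /\ forall s z, posdef (ddbar (pot phi s) z).

Definition kaehler_einstein (phi : toric -> R) :=
  kaehler phi /\ forall s z, ricci (pot phi s) z = ddbar (pot phi s) z.

(* Integral over X for the volume form d nu = omega_0^n (up to a constant),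
   computed on T_C, whose complement has measure zero. *)
Definition xint (f : toric -> \bar R) : \bar R :=
  iint setT (fun x : 'rV[R]_n =>
    (iint `[0%R, (2 * pi)%R] (fun th : 'rV[R]_n => f (torus_pt x th))
     * (\det (hess0 x))%:E)%E).

Definition ricci_potential (h : toric -> R) :=
  [/\ xsmooth h,
      forall s z, ricci (pot0 s) z - ddbar (pot0 s) z
                  = ddbar (fun y => h (chart_pt s y)) z
    & xint (fun p => (expR (h p))%:E) = xint (fun=> 1%E)].

(* phi is a smooth solution on X x [0, +oo); joint regularity in t follows from
   the equation. *)
Definition kr_flow (h : toric -> R) (phi : R -> toric -> R) :=
  [/\ forall p, phi 0 p = 0,
      forall t, 0 <= t -> kaehler (phi t),
      forall s l, {within [set tz : R * Cn | 0 <= tz.1],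
        continuous (fun tz => pderiv l (fun y => phi tz.1 (chart_pt s y)) tz.2)}
    & forall t, 0 <= t -> forall s z,
        (fun e => e^-1 * (phi (t + e) (chart_pt s z) - phi t (chart_pt s z)))
          @ within [set e | 0 <= t + e] 0^'
        --> ln (complex.Re (\det (ddbar (pot (phi t) s) z)
                            / \det (ddbar (pot0 s) z)))
            + phi t (chart_pt s z) - h (chart_pt s z)].

(* Holomorphic vector fields, by their components in the charts; vf_app is the
   derivation of functions they define. *)
Definition vf_app (v : chart P -> Cn -> 'rV[R[i]]_n) (s : chart P)
    (f : toric -> R) (z : Cn) : R[i] :=
  \sum_k v s z 0 k * dz k (fun y => (f (chart_pt s y))%:C) z.

Definition holomorphic_vf (v : chart P -> Cn -> 'rV[R[i]]_n) :=
  (forall s k, csmooth_on setT (fun z => v s z 0 k) /\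
     forall j z, dzb j (fun y => v s y 0 k) z = 0) /\
  (forall f, xsmooth f -> forall s s' z z', chart_pt s z = chart_pt s' z' ->
     vf_app v s f z = vf_app v s' f z').

Definition kr_soliton (v : chart P -> Cn -> 'rV[R[i]]_n) (phi : toric -> R) :=
  [/\ holomorphic_vf v, kaehler phi &
      forall s z, ricci (pot phi s) z - ddbar (pot phi s) z
                  = lie (v s) (ddbar (pot phi s)) z].

(* v = (v# - sqrt(-1) J v#) / 2, where v# is induced by b in N_R = J t_R, i.e. by
   exp (e b) in T_C: v = \sum_i b_i t_i d/dt_i, written in the coordinates of
   the chart.  So v acts on functions of x as the derivative along b. *)
Definition vf_of (b : 'rV[R]_n) (s : chart P) (z : Cn) : 'rV[R[i]]_n :=
  \row_j ((- cone_coord s b 0 j)%:C * toC z 0 j).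

(* G, as transformations of X: in Cox coordinates, T_R acts through
   (S^1)^(rays) and an element of W(X) by permuting the rays. *)
Definition in_G (g : toric -> toric) :=
  exists (A : 'M[int]_n) (f : 'I_(nvert P) -> 'I_(nvert P)) (c : Cox),
    [/\ weyl P A, forall i, @vert R n P (f i) = @vert R n P i *m A,
        forall i, abs2 (c 0 i) = 1 &
        forall p z, coords p z -> coords (g p) (\row_i (c 0 i * z 0 (f i)))].

Definition im_generates_in_G (v : chart P -> Cn -> 'rV[R[i]]_n) :=
  exists lam : R -> toric -> toric,
    [/\ forall a, in_G (lam a), forall p, lam 0 p = p,
        forall a b p, lam (a + b) p = lam a (lam b p) &
        forall f, xsmooth f -> forall s z,
          is_derive (0 : R) (1 : R) (fun a => f (lam a (chart_pt s z)))
            (complex.Im (vf_app v s f z))].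

(* C^oo convergence of (1,1)-forms given in the charts: uniform convergence on
   compact sets of all derivatives of all coefficients *)
Definition form_cvg (g : R -> chart P -> Cn -> 'M[R[i]]_n)
    (h : chart P -> Cn -> 'M[R[i]]_n) :=
  forall s i j l (K : set Cn), compact K -> forall e : R, 0 < e ->
    \forall t \near +oo, forall z, K z ->
      `|pderiv l (fun y => complex.Re (g t s y i j)) z
        - pderiv l (fun y => complex.Re (h s y i j)) z| < e /\
      `|pderiv l (fun y => complex.Im (g t s y i j)) z
        - pderiv l (fun y => complex.Im (h s y i j)) z| < e.

(* The regularization x'_t = s_t b of the minimal points, with rho_t the
   translation by s_t b. *)
Definition tian_zhu (v : chart P -> Cn -> 'rV[R[i]]_n) (b : 'rV[R]_n)
    (phi : R -> toric -> R) (x : R -> 'rV[R]_n) (s : R -> R) :=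
  [/\ exists C : R, (forall t, 0 <= t -> `|x t - s t *: b| <= C) /\
                    (forall t, 0 < t -> derivable s t 1 /\ `|derive1 s t| <= C),
      derive1 s @ +oo --> (1 : R)
    & exists phiK, kr_soliton v phiK /\
        form_cvg
          (fun t c => ddbar (fun z => pot (phi t) c (chart_transl c (s t *: b) z)))
          (fun c => ddbar (pot phiK c))].

Definition minimal_points (b : 'rV[R]_n) (phi : R -> toric -> R)
    (x : R -> 'rV[R]_n) :=
  forall t, 0 <= t ->
    (forall y, u0 (x t) + phi t (torus_pt (x t) 0) <= u0 y + phi t (torus_pt y 0))
    /\ exists c : R, x t = c *: b.

(* (rho_t^-1)^* omega_0 = omega_0 + (sqrt(-1) / 2 pi) d dbar psi_t, sup psi_t = 0 *)
Definition pulled_potentials (b : 'rV[R]_n) (s : R -> R)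
    (psi : R -> toric -> R) :=
  forall t, 0 <= t ->
    [/\ xsmooth (psi t),
        forall c z, ddbar (fun y => pot0 c (chart_transl c (- (s t *: b)) y)) z
                    = ddbar (pot (psi t) c) z
      & ereal_sup [set (psi t p)%:E | p in setT] = 0%E].

Definition L1_limit (psi : R -> toric -> R) (psioo : toric -> \bar R) :=
  xint (fun p => `|(psi t p)%:E - psioo p|%E) @[t --> +oo] --> 0%E.

Definition almost_psh (psi : toric -> \bar R) :=
  forall s z, exists (A : set Cn) (f : Cn -> R),
    [/\ open A, A z, smooth_on A f &
        psh_on A (fun y => psi (chart_pt s y) - (f y)%:E)%E].

(* mu is continuous on X and is the gradient of u_0 on the dense orbit. *)
Definition moment_map (mu : toric -> 'rV[R]_n) :=
  (forall s, continuous (fun z => mu (chart_pt s z))) /\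
  forall x th, mu (torus_pt x th) = grad0 x.

(* g (nonnegative) is L^1 on U *)
Definition integrable_on (U : set toric) (g : toric -> \bar R) :=
  (xint (fun p => (\1_U p)%:E * g p) < +oo)%E.

(* c_K(psi) *)
Definition sing_exponent (K : set toric) (psi : toric -> \bar R) : \bar R :=
  ereal_sup [set c%:E | c in [set c : R | 0 <= c /\
    exists U, [/\ xopen U, K `<=` U &
      integrable_on U (fun p => expeR (- (c%:E * psi p)%E))]]].

(* f is a section over U of the multiplier ideal sheaf I(psi) *)
Definition mis_section (psi : toric -> \bar R) (U : set toric)
    (f : toric -> R[i]) :=
  xholomorphic U f /\ forall p, U p -> exists V,
    [/\ xopen V, V p, V `<=` U &
      integrable_on V (fun q => (abs2 (f q))%:E * expeR (- psi q))%E].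

(* support of O_X / I(psi): the points at which the stalks of I(psi) and of O_X
   differ *)
Definition mis_support (psi : toric -> \bar R) : set toric :=
  [set p | ~ forall U f, xopen U -> U p -> xholomorphic U f ->
    exists V, [/\ xopen V, V p, V `<=` U & mis_section psi V f]].

End ToricManifold.

(* Main.v *)
Require Import Defs.
From mathcomp Require Import all_boot all_order all_algebra.
From mathcomp Require Import fingroup perm finmap.
From mathcomp Require Import all_classical all_reals all_analysis.
From mathcomp Require Import measurable_realfun measurable_fun_approximation.
From mathcomp Require Import ring lra zify.
Import Order.TTheory GRing.Theory Num.Theory.
Import numFieldNormedType.Exports.

Set Implicit Arguments.
Unset Strict Implicit.
Unset Printing Implicit Defensive.

Local Open Scope classical_set_scope.
Local Open Scope ring_scope.

(** Let [Z x] be the sum of [exp <p, x>] over the lattice points [p] of P^*, so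
    that [u0 = ln Z] on the dense torus.  The normalized potentials [psi t] can be
    computed.  In a chart C^n the form obtained from omega_0 by the translation
    [y = - s_t beta] has the potential [u0 (x + y)], so that [psi t] and
    [u0 (x + y) - u0 x] differ by a pluriharmonic function bounded above on C^n,
    hence by a constant
    ([plane_liouville], [ddbar_liouville]), and [sup (psi t) = 0] gives this
    constant ([pulled_potential_torus]).  Since s_t tends to +oo
    ([regularization_cvg]), only the p^max(k) survive in the limit:
      [Psi x = ln (sum_k exp <p^max(k), x> / Z x)].
    The convergence is exponential in s_t, up to a factor exponential in [x]
    ([Psi_close]); so [psioo = Psi] almost everywhere, and the integrals of
    [exp (- c psioo)] are those of [exp (- c Psi)] against the density
    [det (Hess u0)] ([xint_limit]).

    This density is a combination, with nonnegative coefficients, of products of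
    n + 1 of the weights [exp <p, x> / Z x], by the Cauchy-Binet formula ([det_cov], [det_hess0E]).
    Let [a] be the coordinates of [x] in a maximal cone of the fan.  Where they are
    bounded below, the density is comparable to [exp (- sum_j a_j)]
    ([det_hess0_upper], [det_hess0_lower]); the lower bound uses that the vertex of
    P^* dual to the cone has a lattice point at distance one on each of its edges,
    which holds because omega_0 is nondegenerate at the fixed point of the chart
    ([adjacent_lattice_point]).

    Near the fibre of the moment map over p^(delta^* ), the coordinates [a_j] of
    the rays outside of delta are bounded, and those of the rays of delta are
    bounded below ([moment_region]).  If [x = tau x0 + O(1)] with [x0] in delta,
    then [sum_j a_j = tau + O(1)], [ln (Z x) = tau + O(1)] and
      [- Psi x = tau (1 - max_k <p^max(k), x0>) + O(1)].
    Let [m] be the minimum over [x0] of these maxima.  If [m <= 0], then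
    [exp (- c Psi)] is integrable near the fibre when [c (1 - m) < 1]
    ([converges]), and its integral over any neighbourhood is infinite when
    [1 < c (1 - m)], as one sees on boxes of fixed size moved along the ray of a
    minimizing [x0] ([diverges]).  So the exponent is [1 / (1 - m)] in case (ii),
    and at least 1 in case (i), where the convergence argument applies with 0 in
    place of [m].

    For the multiplier ideals: the divergence is seen near every point over
    delta^*, since each neighbourhood of it meets the stratum of delta
    ([fibre_chart], [perturb], [fibre_in_mis]); and in the convergent case the
    ideal is trivial at a point over p^(delta^* ), because holomorphic functions
    are locally bounded ([fibre_not_in_mis]). *)

(** * Iterated Lebesgue integrals *)

Section IteratedIntegral.
Context {R : realType}.
Notation leb := (@lebesgue_measure R).

(** Measurability of a function of a vector, tested on measurable families of
    coordinates: this is what an iterated integral consumes, and it is visibly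
    stable under fixing the first coordinate. *)
Definition cmeas m (f : 'rV[R]_m -> \bar R) :=
  forall d (T : measurableType d) (g : 'I_m -> T -> R),
    (forall i, measurable_fun setT (g i)) ->
    measurable_fun setT (fun t : T => f (\row_i g i t) : \bar R).

(** The same with a parameter in a measurable space. *)
Definition jmeas m d (T : measurableType d) (F : T -> 'rV[R]_m -> \bar R) :=
  forall d' (T' : measurableType d') (h : T' -> T) (g : 'I_m -> T' -> R),
    measurable_fun setT h -> (forall i, measurable_fun setT (g i)) ->
    measurable_fun setT (fun t : T' => F (h t) (\row_i g i t) : \bar R).

Lemma row_mx_rowE m (x : R) (g : 'I_m -> R) :
  row_mx (const_mx x : 'rV[R]_1) (\row_i g i) =
  \row_(i < 1 + m) match fintype.split i with inl _ => x | inr j => g j end.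
Proof. by apply/rowP => i; rewrite !mxE; case: fintype.split => j; rewrite mxE. Qed.

Lemma row_const_inE (Q : R -> Prop) m (x : R) (v : 'rV[R]_m) :
  Q x -> (forall i, Q (v 0 i)) -> forall i, Q (row_mx (const_mx x : 'rV[R]_1) v 0 i).
Proof. by move=> Qx Qv i; rewrite mxE; case: fintype.split => j; rewrite ?mxE. Qed.

Lemma cmeas_section m (f : 'rV[R]_m.+1 -> \bar R) (x : R) : cmeas f ->
  cmeas (fun v : 'rV[R]_m => f (row_mx (const_mx x : 'rV[R]_1) v)).
Proof.
move=> mf d T g mg.
rewrite (_ : (fun t => _) = (fun t => f (\row_(i < 1 + m)
  (match fintype.split i with inl _ => (cst x : T -> R) | inr j => g j end) t))).
  by apply: mf => i; case: fintype.split => j //; exact: measurable_cst.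
by apply/funext => t; rewrite row_mx_rowE; congr f; apply/rowP => i;
  rewrite !mxE; case: fintype.split.
Qed.

Lemma iint_ge0 (A : set R) m (f : 'rV[R]_m -> \bar R) :
  (forall v, (0 <= f v)%E) -> (0 <= iint A f)%E.
Proof.
elim: m f => [|m IHm] f f0 //=; apply: integral_ge0 => x _.
by apply: IHm.
Qed.

(** By Tonelli, one coordinate at a time: the coordinate that is integrated first
    joins the parameters. *)
Lemma measurable_iint (A : set R) m d (T : measurableType d)
    (F : T -> 'rV[R]_m -> \bar R) : measurable A ->
  jmeas F -> (forall t v, (0 <= F t v)%E) ->
  measurable_fun setT (fun t => iint A (F t)).
Proof.
move=> mA; elim: m d T F => [|m IHm] d T F mF F0 /=.
  have := mF _ _ idfun (fun i => (cst 0 : T -> R)) (@measurable_id _ _ _)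
    (fun=> @measurable_cst _ _ _ _ _ _).
  congr (measurable_fun _ _); apply/funext => t; congr F.
  by apply/rowP => -[].
pose H (u : T * R) : \bar R :=
  iint A (fun v : 'rV[R]_m => F u.1 (row_mx (const_mx u.2 : 'rV[R]_1) v)).
have mH : measurable_fun setT H.
  apply: IHm => [d' T' h g mh mg|t v]; last exact: F0.
  rewrite (_ : (fun t => _) = (fun t => F (h t).1 (\row_(i < 1 + m)
    (match fintype.split i with inl _ => (fun t => (h t).2) | inr j => g j end) t))).
    apply: mF => [|i]; first exact: (measurableT_comp (@measurable_fst _ _ _ _)).
    case: fintype.split => j //; exact: (measurableT_comp (@measurable_snd _ _ _ _)).
  apply/funext => t; rewrite row_mx_rowE; congr (F _ _); apply/rowP => i.
  by rewrite !mxE; case: fintype.split.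
have mB : measurable ([set: T] `*` A) by exact: measurableX.
have mK : measurable_fun setT (H \_ (setT `*` A)).
  exact: (measurable_restrictT H mB).1 (measurable_funTS mH).
have K0 u : (0 <= (H \_ (setT `*` A)) u)%E.
  by rewrite patchE; case: ifP => // _; apply: iint_ge0 => v; exact: F0.
have : measurable_fun setT (fubini_F leb (H \_ (setT `*` A))).
  by apply: measurable_fun_fubini_tonelli_F.
congr (measurable_fun _ _); apply/funext => t.
rewrite /fubini_F /= [RHS]integral_mkcond; apply: eq_integral => x _.
rewrite !patchE /H /=.
case: (boolP (x \in A)) => xA.
  by rewrite ifT// inE /=; split => //; rewrite inE in xA.
by rewrite ifF//; apply/negbTE; apply: contra xA; rewrite !inE => -[].
Qed.

Lemma measurable_iint_section (A : set R) m (f : 'rV[R]_m.+1 -> \bar R) :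
  measurable A -> cmeas f -> (forall v, (0 <= f v)%E) ->
  measurable_fun setT (fun x : R =>
    iint A (fun v : 'rV[R]_m => f (row_mx (const_mx x : 'rV[R]_1) v))).
Proof.
move=> mA mf f0.
have mF : jmeas (fun (x : R) (v : 'rV[R]_m) => f (row_mx (const_mx x : 'rV[R]_1) v)).
  move=> d' T' h g mh mg.
  rewrite (_ : (fun t => _) = (fun t => f (\row_(i < 1 + m)
    (match fintype.split i with inl _ => h | inr j => g j end) t))).
    by apply: mf => i; case: fintype.split.
  apply/funext => t; rewrite row_mx_rowE; congr (f _); apply/rowP => i.
  by rewrite !mxE; case: fintype.split.
exact: (measurable_iint mA mF).
Qed.

Lemma iintD (A : set R) m (f g : 'rV[R]_m -> \bar R) : measurable A ->
  cmeas f -> cmeas g -> (forall v, (0 <= f v)%E) -> (forall v, (0 <= g v)%E) ->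
  iint A (fun v => f v + g v)%E = (iint A f + iint A g)%E.
Proof.
move=> mA; elim: m f g => [|m IHm] f g mf mg f0 g0 //=.
rewrite -ge0_integralD//.
- by apply: eq_integral => x _; apply: IHm => //; exact: cmeas_section.
- by move=> x _; exact: iint_ge0.
- by apply: measurable_funTS; exact: measurable_iint_section.
- by move=> x _; exact: iint_ge0.
- by apply: measurable_funTS; exact: measurable_iint_section.
Qed.

Lemma iintZl (A : set R) m (k : R) (f : 'rV[R]_m -> \bar R) : measurable A ->
  cmeas f -> (forall v, (0 <= f v)%E) -> 0 <= k ->
  iint A (fun v => k%:E * f v)%E = (k%:E * iint A f)%E.
Proof.
move=> mA mf f0 k0; elim: m f mf f0 => [|m IHm] f mf f0 //=.
rewrite -ge0_integralZl//.
- by apply: eq_integral => x _; apply: IHm => //; exact: cmeas_section.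
- by apply: measurable_funTS; exact: measurable_iint_section.
- by move=> x _; exact: iint_ge0.
Qed.

(** The iterated integral only sees functions up to null sets: [e] plays the
    part of the distance between [f] and [g]. *)
Lemma iint_ae_eq (A : set R) m (e f g : 'rV[R]_m -> \bar R) : measurable A ->
  cmeas e -> cmeas f -> cmeas g ->
  (forall v, (0 <= e v)%E) -> (forall v, (0 <= f v)%E) -> (forall v, (0 <= g v)%E) ->
  (forall v, e v = 0%E -> f v = g v) -> iint A e = 0%E -> iint A f = iint A g.
Proof.
move=> mA; elim: m e f g => [|m IHm] e f g me mf mg e0 f0 g0 efg /=; first exact: efg.
pose E x := iint A (fun v : 'rV[R]_m => e (row_mx (const_mx x : 'rV[R]_1) v)).
have mE : measurable_fun setT E by exact: measurable_iint_section.
have E0 x : (0 <= E x)%E by exact: iint_ge0.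
move=> iE.
have /(ae_eq_integral_abs leb mA (measurable_funTS mE)) aeE :
    (\int[leb]_(x in A) `|E x| = 0)%E.
  by rewrite -iE; apply: eq_integral => x _; rewrite gee0_abs.
apply: ge0_ae_eq_integral => //.
- by apply: measurable_funTS; exact: measurable_iint_section.
- by apply: measurable_funTS; exact: measurable_iint_section.
- by move=> x _; exact: iint_ge0.
- by move=> x _; exact: iint_ge0.
- apply: filterS aeE => x /= Ex0 Ax.
  apply: IHm (Ex0 Ax) => //; try exact: cmeas_section.
  by move=> v; exact: efg.
Qed.

Lemma iint_box (A : set R) m (f : 'rV[R]_m -> \bar R) (b : 'rV[R]_m) (a eta : R) :
  measurable A -> cmeas f -> (forall v, (0 <= f v)%E) -> 0 <= a -> 0 <= eta ->
  (forall i, `[b 0 i, b 0 i + eta] `<=` A) ->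
  (forall v : 'rV[R]_m, (forall i, b 0 i <= v 0 i <= b 0 i + eta) -> (a%:E <= f v)%E) ->
  ((a * eta ^+ m)%:E <= iint A f)%E.
Proof.
move=> mA; elim: m f b => [|m IHm] f b mf f0 a0 eta0 bA fb /=.
  by rewrite expr0 mulr1; apply: fb => -[].
pose D := `[b 0 0, b 0 0 + eta]%classic.
have DA : D `<=` A by exact: bA.
have mD : measurable D by exact: measurable_itv.
have fI (x : R) : D x -> ((a * eta ^+ m)%:E <=
    iint A (fun v : 'rV[R]_m => f (row_mx (const_mx x : 'rV[R]_1) v)))%E.
  move=> Dx; apply: (IHm _ (\row_i b 0 (rshift 1 i))) => //.
  - exact: cmeas_section.
  - by move=> i; rewrite mxE; exact: bA.
  move=> v bv; apply: fb => i.
  rewrite mxE; case: fintype.splitP => j ij; rewrite ?mxE.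
    have -> : i = 0 by apply: val_inj => /=; rewrite ij (ord1 j).
    by move: Dx; rewrite /D /= in_itv.
  have -> : i = rshift 1 j by apply/val_inj.
  by have := bv j; rewrite mxE.
apply: (@le_trans _ _ (\int[leb]_(x in D) (a * eta ^+ m)%:E)%E).
  rewrite integral_cst//.
  suff : ((a * eta ^+ m.+1)%:E <= (a * eta ^+ m)%:E * leb D)%E by exact.
  rewrite /D lebesgue_measure_itv/= lte_fin.
  case: ltP => [_|be].
    by rewrite -EFinB -EFinM lee_fin exprSr mulrA addrAC subrr add0r.
  have -> : eta = 0 by apply/eqP; rewrite eq_le eta0 andbT; move: be; rewrite gerDl.
  by rewrite expr0n mulr0 mule0.
apply: (@le_trans _ _ (\int[leb]_(x in D)
    iint A (fun v : 'rV[R]_m => f (row_mx (const_mx x : 'rV[R]_1) v)))%E).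
  apply: ge0_le_integral => //.
  - by move=> x _; rewrite lee_fin mulr_ge0// exprn_ge0.
  - by apply: measurable_funTS; exact: measurable_iint_section.
apply: ge0_subset_integral => //.
- by apply: measurable_funTS; exact: measurable_iint_section.
- by move=> x _; exact: iint_ge0.
Qed.

Lemma measurable_expR_abs (e : R) d (T : measurableType d) (g : T -> R) :
  measurable_fun setT g -> measurable_fun setT (fun t => (expR (- e * `|g t|))%:E).
Proof.
move=> mg; apply/measurable_EFinP; apply: measurableT_comp => //.
by apply: measurable_funM => //; exact: measurableT_comp.
Qed.

Lemma integral_expR_abs_lty (e : R) : 0 < e ->
  (\int[leb]_x (expR (- e * `|x|))%:E < +oo)%E.
Proof.
move=> e0; rewrite ge0_symfun_integralT.
- rewrite lte_mul_pinfty//.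
  have <- : (\int[leb]_(x in [set x | 0 <= x]%R) (e^-1 * exponential_pdf e x)%:E =
            \int[leb]_(x in [set x | 0 <= x]%R) (expR (- e * `|x|))%:E)%E.
    apply: eq_integral => x; rewrite inE /= => x0.
    rewrite /exponential_pdf patchE ifT; last by rewrite inE /= in_itv /= x0.
    by rewrite mulrA mulVf ?gt_eqF// mul1r ger0_norm.
  have mp : measurable_fun setT (fun x : R => (e^-1 * exponential_pdf e x)%:E).
    by apply/measurable_EFinP; apply: measurable_funM => //; exact: measurable_exponential_pdf.
  have p0 x : (0 <= (e^-1 * exponential_pdf e x)%:E)%E.
    by rewrite lee_fin mulr_ge0 ?exponential_pdf_ge0 ?invr_ge0 ?ltW.
  apply: (@le_lt_trans _ _ (\int[leb]_x (e^-1 * exponential_pdf e x)%:E)%E).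
    apply: ge0_subset_integral => //.
    by rewrite -set_itvcy; exact: measurable_itv.
  under eq_integral do rewrite EFinM.
  rewrite ge0_integralZl//.
  + by rewrite integral_exponential_pdf// mule1 ltry.
  + by apply/measurable_EFinP; exact: measurable_exponential_pdf.
  + by move=> x _; rewrite lee_fin exponential_pdf_ge0 ?ltW.
  + by rewrite lee_fin invr_ge0 ltW.
- by move=> x; exact: expR_ge0.
- move=> x; apply: continuous_comp; last exact: continuous_expR.
  by apply: cvgM; [exact: cvg_cst|exact: norm_continuous].
- by move=> x /=; rewrite normrN.
Qed.

Lemma cmeas_expR (e : R) m : cmeas (fun v : 'rV[R]_m => (expR (- e * \sum_i `|v 0 i|))%:E).
Proof.
move=> d T g mg; apply/measurable_EFinP; apply: measurableT_comp => //.
apply: measurable_funM => //; apply: measurable_sum => i.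
apply: measurableT_comp => //.
by rewrite (_ : (fun t => _) = g i)//; apply/funext => t; rewrite mxE.
Qed.

(** The comparison function of all the convergence statements: the integral is a
    power of the one-dimensional one, which the exponential law evaluates. *)
Lemma iint_expR_lty (e : R) m : 0 < e ->
  (iint setT (fun v : 'rV[R]_m => (expR (- e * \sum_i `|v 0 i|))%:E) < +oo)%E.
Proof.
move=> e0; have := integral_expR_abs_lty e0.
set J := (\int[leb]_x _)%E => Joo.
have J0 : (0 <= J)%E by apply: integral_ge0 => x _; rewrite lee_fin expR_ge0.
have [c Jc] : exists c, J = c%:E.
  by exists (fine J); rewrite fineK// ge0_fin_numE.
suff -> : iint setT (fun v : 'rV[R]_m => (expR (- e * \sum_i `|v 0 i|))%:E) = (c ^+ m)%:E.
  exact: ltry.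
have c0 : 0 <= c by rewrite -lee_fin -Jc.
elim: m => [|m IHm] /=; first by rewrite big_ord0 mulr0 expR0 expr0.
transitivity (\int[leb]_x ((expR (- e * `|x|))%:E * (c ^+ m)%:E))%E.
  apply: eq_integral => x _; rewrite -IHm -iintZl ?expR_ge0//.
  - congr iint; apply/funext => v; rewrite -EFinM -expRD -mulrDr; congr (expR (_ * _))%:E.
    have splitw (w : 'rV[R]_(1 + m)) : \sum_i `|w 0 i| =
        `|w 0 (lshift m 0)| + \sum_i `|w 0 (rshift 1 i)|.
      by rewrite big_split_ord big_ord1.
    rewrite [LHS](splitw (row_mx (const_mx x) v)) row_mxEl mxE; congr (_ + _).
    by apply: eq_bigr => i _; rewrite row_mxEr.
  - exact: cmeas_expR.
rewrite ge0_integralZr//.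
- by rewrite -/J Jc -EFinM exprS.
- by apply: measurable_expR_abs.
- by rewrite lee_fin exprn_ge0.
Qed.

(** Rational boxes generate the topology of R^m, so open sets are measurable in
    the coordinates. *)
Lemma measurable_open_row m (U : set 'rV[R]_m) d (T : measurableType d)
    (g : 'I_m -> T -> R) : open U -> (forall i, measurable_fun setT (g i)) ->
  measurable [set t | U (\row_i g i t)].
Proof.
move=> oU mg.
pose box (q : 'rV[rat]_m * rat) : set 'rV[R]_m :=
  [set v | forall i, `|v 0 i - ratr (q.1 0 i)| < ratr q.2].
pose B (k : nat) : set T := if @choice.unpickle ('rV[rat]_m * rat)%type k is Some q then
  (if `[< box q `<=` U >] then [set t | box q (\row_i g i t)] else set0) else set0.
suff -> : [set t | U (\row_i g i t)] = \bigcup_k B k.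
  apply: bigcup_measurable => k _; rewrite /B; case: choice.unpickle => [q|//].
  case: asboolP => // _.
  rewrite (_ : [set t | _] = \bigcap_(i in [set: 'I_m]) [set t | `|g i t - ratr (q.1 0 i)| < ratr q.2]).
    apply: fin_bigcap_measurable => // i _.
    rewrite -[X in measurable X]setTI.
    have mf : measurable_fun setT (fun t => `|g i t - ratr (q.1 0 i)|).
      by apply: measurableT_comp => //; apply: measurable_funB.
    have := mf measurableT _ (measurable_itv `]-oo, (ratr q.2)[); congr measurable.
  by apply/seteqP; split => t /= h i; [move=> _|]; have := h i; rewrite mxE //; exact.
apply/seteqP; split => [t /= Ut|t [k _]]; last first.
  rewrite /B; case: choice.unpickle => [q|//]; case: asboolP => // qU /qU //.
have /nbhs_ballP [e /= e0 eU] := oU _ Ut.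
have [r /= rin] : exists r : rat, ratr r \in `]0, e / 2[%R by apply: rat_in_itvoo; lra.
have [r0 re] : 0 < ratr r :> R /\ ratr r < e / 2 by move: rin; rewrite in_itv /= => /andP[].
have /choice [q qP] i : exists q : rat, ratr q \in `]g i t - ratr r, g i t + ratr r[%R.
  by apply: rat_in_itvoo; lra.
exists (choice.pickle (\row_i q i, r)) => //.
rewrite /B choice.pickleK /=; case: asboolP => [_ i|[]].
  by rewrite !mxE /= ltr_distlC ?mxE; have := qP i; rewrite in_itv.
move=> v bv; apply: eU; split => // i j; rewrite !mxE /ball /=.
have := qP j; rewrite in_itv /= => /andP[q1 q2].
have := bv j; rewrite /= mxE ltr_distl => /andP[v1 v2].
by rewrite ord1 ltr_distl; apply/andP; split; lra.
Qed.

Lemma cmeas_usc m (f : 'rV[R]_m -> \bar R) :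
  (forall a : R, open [set v | (f v < a%:E)%E]) -> cmeas f.
Proof.
move=> uf d T g mg mD; apply: (measurability _ (ErealGenInftyO.measurableE R)) => //.
move=> _ [_ [a ->] <-]; rewrite setTI.
have := measurable_open_row (uf a) mg; congr measurable.
Qed.

Lemma cmeas_continuous m (f : 'rV[R]_m -> R) : continuous f -> cmeas (fun v => (f v)%:E).
Proof.
move=> cf; apply: cmeas_usc => a; rewrite (_ : [set _ | _] = f @^-1` [set r | r < a]).
  by move/continuousP : cf; apply; exact: open_lt.
by apply/seteqP; split => v /=; rewrite lte_fin.
Qed.

Lemma cmeas_indic m (U : set 'rV[R]_m) : open U -> cmeas (fun v => (\1_U v : R)%:E).
Proof.
move=> oU d T g mg; apply/measurable_EFinP.
rewrite (_ : (fun t => _) = \1_[set t | U (\row_i g i t)]).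
  by apply: measurable_indic; exact: measurable_open_row.
by apply/funext => t; rewrite !indicE; congr (_%:R); apply/idP/idP; rewrite !inE.
Qed.

Lemma cmeasM m (f g : 'rV[R]_m -> \bar R) : cmeas f -> cmeas g ->
  cmeas (fun v => f v * g v)%E.
Proof. by move=> mf mg d T h mh; apply: emeasurable_funM; [exact: mf|exact: mg]. Qed.


(** The integral of a nonnegative function is the supremum over the simple
    functions below it, so that it is monotone for arbitrary functions; the
    integrands with a holomorphic factor defined on an open subset are bounded in
    this way. *)
Lemma le_iint (A : set R) m (f g : 'rV[R]_m -> \bar R) :
  (forall v, (0 <= f v)%E) -> (forall v, (0 <= g v)%E) ->
  (forall v : 'rV[R]_m, (forall i, A (v 0 i)) -> (f v <= g v)%E) ->
  (iint A f <= iint A g)%E.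
Proof.
elim: m f g => [|m IHm] f g f0 g0 fg /=; first by apply: fg => -[].
rewrite !ge0_integralE; try by move=> x _; exact: iint_ge0.
apply: ereal_sup_le => _ [h hf <-]; exists h => //= x; apply: le_trans (hf x) _.
rewrite !patchE; case: ifPn => // /set_mem Ax; apply: IHm => // v Av.
by apply: fg; exact: row_const_inE.
Qed.

Lemma cmeas_cst m (k : \bar R) : cmeas (fun _ : 'rV[R]_m => k).
Proof. by move=> d T g mg; exact: measurable_cst. Qed.

Lemma iint_itv_cst (a b : R) m (k : R) : a <= b -> 0 <= k ->
  iint `[a, b] (fun _ : 'rV[R]_m => k%:E) = (k * (b - a) ^+ m)%:E.
Proof.
move=> ab k0; elim: m => [|m IHm] /=; first by rewrite expr0 mulr1.
rewrite (eq_integral (cst (k * (b - a) ^+ m)%:E)); last by move=> x _; exact: IHm.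
rewrite integral_cst//= lebesgue_measure_itv/= lte_fin.
move: ab; rewrite le_eqVlt => /predU1P[->|ab]; last by rewrite ab -EFinB -EFinM exprSr mulrA.
by rewrite ltxx mule0 subrr expr0n mulr0.
Qed.

Lemma measurable_expeR d (T : measurableType d) (f : T -> \bar R) :
  measurable_fun setT f -> measurable_fun setT (fun t => expeR (f t)).
Proof.
move=> mf; rewrite (_ : (fun t => _) = (fun t => maxe (er_map expR (f t)) 0%E)).
  apply: measurable_maxe => //; apply: measurableT_comp => //.
  by apply: measurable_er_map.
apply/funext => t; case: (f t) => [r| |] //=.
  by rewrite /maxe ltNge lee_fin expR_ge0.
by rewrite /maxe ltNye.
Qed.

End IteratedIntegral.

(** * Bounded harmonic functions in the plane *)

Section Liouville.
Context {R : realType}.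

Lemma is_derive_congr (f g : R -> R) (x a b : R) :
  is_derive x 1 f a -> f =1 g -> a = b -> is_derive x 1 g b.
Proof. by move=> df /funext <- <-. Qed.

Lemma second_derive_le0_at_max (g g' : R -> R) (x e g2 : R) : 0 < e ->
  (forall t, `|t - x| < e -> is_derive t 1 g (g' t)) -> is_derive x 1 g' g2 ->
  (forall t, `|t - x| < e -> g t <= g x) -> g2 <= 0.
Proof.
move=> e0 dg dg' gmax; rewrite leNgt; apply/negP => g20.
have near_x t : t \in `]x - e, x + e[%R -> `|t - x| < e.
  by rewrite in_itv /= ltr_distl.
have g'x : g' x = 0.
  have xx : `|x - x| < e by rewrite subrr normr0.
  have [_ <-] := dg x xx.
  have [_ ->//] : is_derive x 1 g 0.
  apply: (@derive1_at_max _ g (x - e) (x + e)).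
  - lra.
  - by move=> t /near_x te; have [] := dg t te.
  - by rewrite in_itv /=; apply/andP; split; lra.
  - by move=> t /near_x te; exact: gmax.
have cvg' : (fun h => h^-1 *: (g' (h *: 1 + x) - g' x)) @ 0^' --> g2.
  by have [dx <-] := dg'.
have /cvgr_gt/(_ _ g20) := cvg'.
rewrite near_withinE => /nbhs_ballP [d /= d0 dP].
pose h0 := Num.min e d / 2.
have m0 : 0 < Num.min e d by rewrite lt_min e0.
have mle : Num.min e d <= e /\ Num.min e d <= d by rewrite !ge_min !lexx orbT.
have h00 : 0 < h0 by rewrite /h0; lra.
have h0e : h0 < e /\ h0 < d by rewrite /h0; lra.
have pos t : 0 < t -> t <= h0 -> 0 < g' (x + t).
  move=> t0 th; have := dP t; rewrite /ball /= sub0r normrN gtr0_norm//.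
  move=> /(_ ltac:(lra) ltac:(exact: lt0r_neq0)).
  by rewrite g'x subr0 /GRing.scale /= mulr1 pmulr_rgt0 ?invr_gt0// addrC.
have [c] := @MVT R g g' x (x + h0) ltac:(lra)
  (fun t (th : t \in `]x, x + h0[%R) => dg t ltac:(move: th; rewrite in_itv /= ltr_distl; lra))
  ltac:(by apply: derivable_within_continuous => t; rewrite in_itv /= => th;
        have [] := dg t ltac:(rewrite ltr_distl; lra)).
rewrite in_itv /= => cx gE.
have gc := pos (c - x) ltac:(lra) ltac:(lra); rewrite addrC subrK in gc.
have := gmax (x + h0) ltac:(rewrite ltr_distl; lra).
have : 0 < g' c * (x + h0 - x) by apply: mulr_gt0 => //; lra.
lra.
Qed.

Let rho (a1 a2 x y : R) := (x - a1) ^+ 2 + (y - a2) ^+ 2.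

(** [ln rho - 1 / rho], with Laplacian [- 4 / rho ^ 2]: a strictly superharmonic
    function tending to infinity.  The harmonic function [ln rho] alone would
    not exclude an interior maximum. *)
Let barrier (r : R) := ln r - r^-1.

Lemma is_derive_sqr_dist (a c t : R) :
  is_derive t 1 (fun t => (t - a) ^+ 2 + c) (2 * (t - a)).
Proof.
have h : is_derive t (1:R) (horner (('X - a%:P) ^+ 2 + c%:P)) (2 * (t - a)).
  apply: is_derive_eq; rewrite derivD derivC addr0 deriv_exp derivXsubC mul1r.
  by rewrite !hornerE /=; ring.
by move: h; congr is_derive; apply/funext => s; rewrite !hornerE.
Qed.

Lemma is_derive_barrier (a c t : R) : 0 < (t - a) ^+ 2 + c ->
  is_derive t 1 (fun t => barrier ((t - a) ^+ 2 + c))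
    (2 * (t - a) / ((t - a) ^+ 2 + c) + 2 * (t - a) / ((t - a) ^+ 2 + c) ^+ 2).
Proof.
move=> r0; have hq := is_derive_sqr_dist a c t.
have h1 := is_derive1_comp (g := fun t => (t - a) ^+ 2 + c) (is_derive1_ln r0) hq.
have h2 := is_deriveV (lt0r_neq0 r0 : (fun t => (t - a) ^+ 2 + c) t != 0) hq.
apply: (is_derive_congr (is_deriveB h1 h2)) => //.
have : (t - a) ^+ 2 + c != 0 by exact: lt0r_neq0.
rewrite /GRing.scale /=.
move: ((t - a) ^+ 2 + c) => q q0; by field.
Qed.

Lemma is_derive2_barrier (a c t : R) : 0 < (t - a) ^+ 2 + c ->
  is_derive t 1 (fun t => 2 * (t - a) / ((t - a) ^+ 2 + c)
                          + 2 * (t - a) / ((t - a) ^+ 2 + c) ^+ 2)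
    (2 / ((t - a) ^+ 2 + c) + 2 / ((t - a) ^+ 2 + c) ^+ 2
     - 4 * (t - a) ^+ 2 / ((t - a) ^+ 2 + c) ^+ 2
     - 8 * (t - a) ^+ 2 / ((t - a) ^+ 2 + c) ^+ 3).
Proof.
move=> r0; have hq := is_derive_sqr_dist a c t.
have h2 := is_deriveV (lt0r_neq0 r0 : (fun t => (t - a) ^+ 2 + c) t != 0) hq.
have h3 := is_deriveM h2 h2.
have hl : is_derive t (1:R) (fun t => 2 * (t - a)) 2.
  have h : is_derive t (1:R) (horner (2%:R *: ('X - a%:P))) 2.
    by apply: is_derive_eq; rewrite derivZ derivXsubC !hornerE.
  by move: h; congr is_derive; apply/funext => s; rewrite !hornerE.
apply: (is_derive_congr (is_deriveD (is_deriveM hl h2) (is_deriveM hl h3))).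
  by move=> s /=; rewrite -exprVn expr2.
have : (t - a) ^+ 2 + c != 0 by exact: lt0r_neq0.
rewrite /GRing.scale /= !fctE.
move: ((t - a) ^+ 2 + c) => q q0; by field.
Qed.

(** If [F] exceeded [F a] at a point, subtracting from [F] a small multiple of the
    barrier centred at [a] would give a function that is smaller near [a] and,
    [F] being bounded above, far from [a], hence has a maximum in between; but its
    Laplacian is positive there. *)
Lemma plane_liouville (F Fx Fxx Fy Fyy : R -> R -> R) (M : R) :
  continuous (fun u : R * R => F u.1 u.2) ->
  (forall x y : R, is_derive x 1 (F ^~ y) (Fx x y)) ->
  (forall x y : R, is_derive x 1 (Fx ^~ y) (Fxx x y)) ->
  (forall x y : R, is_derive y 1 (F x) (Fy x y)) ->
  (forall x y : R, is_derive y 1 (Fy x) (Fyy x y)) ->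
  (forall x y, Fxx x y + Fyy x y = 0) ->
  (forall x y, F x y <= M) ->
  forall x y x' y', F x y = F x' y'.
Proof.
move=> cF dFx dFxx dFy dFyy lap FM.
suff le x1 y1 a1 a2 : F x1 y1 <= F a1 a2.
  by move=> *; apply/eqP; rewrite eq_le !le.
rewrite leNgt; apply/negP => lt1.
set eta := F x1 y1 - F a1 a2.
have eta0 : 0 < eta by rewrite subr_gt0.
have [r r0 rP] : exists2 r, 0 < r & forall x y, rho a1 a2 x y <= r ^+ 2 ->
    F x y < F a1 a2 + eta / 2.
  have /cvgr_lt/(_ (F a1 a2 + eta / 2) ltac:(rewrite /=; lra)) := cF (a1, a2).
  move=> /nbhs_ballP [r /= r0 rP]; exists (r / 2); first lra.
  move=> x y xy; apply: (rP (x, y)); split; rewrite /ball /=.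
    rewrite -(ltr_pXn2r (n := 2)) ?nnegrE ?normr_ge0 ?ltW// real_normK ?num_real//.
    have := sqr_ge0 (y - a2); rewrite /rho in xy; nra.
  rewrite -(ltr_pXn2r (n := 2)) ?nnegrE ?normr_ge0 ?ltW// real_normK ?num_real//.
  have := sqr_ge0 (x - a1); rewrite /rho in xy; nra.
have rho0 x y : 0 <= rho a1 a2 x y by rewrite addr_ge0 ?sqr_ge0.
have r1 : r ^+ 2 < rho a1 a2 x1 y1.
  rewrite ltNge; apply/negP => /rP; rewrite /eta; lra.
have r20 : 0 < r ^+ 2 by rewrite exprn_gt0.
pose W x y := barrier (rho a1 a2 x y).
pose w1 := W x1 y1 - barrier (r ^+ 2).
have incr (s t : R) : 0 < s -> s <= t -> barrier s <= barrier t.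
  move=> s0 st; have t0 : 0 < t by exact: lt_le_trans st.
  by apply: lerB; [rewrite ler_ln ?posrE|rewrite lef_pV2 ?posrE].
have w10 : 0 <= w1 by rewrite subr_ge0; apply: incr => //; exact: ltW.
pose e := eta / (4 * (w1 + 1)).
have e0 : 0 < e by rewrite divr_gt0// mulr_gt0//; lra.
have ew : e * w1 < eta / 2.
  have : e * (w1 + 1) = eta / 4 by rewrite /e; field; lra.
  nra.
pose G x y := F x y - e * (W x y - barrier (r ^+ 2)).
have [B [B0 Bx1 BP]] : exists B, [/\ 0 < B, `|x1 - a1| <= B /\ `|y1 - a2| <= B &
    forall x y, B ^+ 2 <= rho a1 a2 x y -> G x y < F a1 a2 + eta / 2].
  pose L := expR ((M - F a1 a2) / e + barrier (r ^+ 2) + 1) + 1 + `|x1 - a1| + `|y1 - a2|.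
  have L1 : 1 <= L /\ expR ((M - F a1 a2) / e + barrier (r ^+ 2) + 1) <= L.
    by rewrite /L; have := expR_gt0 ((M - F a1 a2) / e + barrier (r ^+ 2) + 1);
       have := normr_ge0 (x1 - a1); have := normr_ge0 (y1 - a2); lra.
  exists L; split; first lra.
    by rewrite /L; have := expR_gt0 ((M - F a1 a2) / e + barrier (r ^+ 2) + 1);
       have := normr_ge0 (x1 - a1); have := normr_ge0 (y1 - a2); lra.
  move=> x y Lxy; rewrite /G.
  have LL : L <= rho a1 a2 x y by apply: le_trans Lxy; rewrite expr2; nra.
  have : barrier L <= W x y by apply: incr => //; lra.
  have : (M - F a1 a2) / e + barrier (r ^+ 2) + 1 <= ln L.
    by rewrite -[leLHS]expRK ler_ln ?posrE ?expR_gt0//; lra.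
  have : L^-1 <= 1 by rewrite invf_le1; lra.
  rewrite /barrier -/(barrier _) => LV lnL WL.
  have : (M - F a1 a2) / e <= W x y - barrier (r ^+ 2) by lra.
  rewrite ler_pdivrMr// => h; have := FM x y; lra.
pose K := (`[a1 - B, a1 + B] `*` `[a2 - B, a2 + B]) `&`
          [set u : R * R | r ^+ 2 <= rho a1 a2 u.1 u.2].
have crho : continuous (fun u : R * R => rho a1 a2 u.1 u.2).
  move=> u; rewrite /rho; apply: cvgD.
    by apply: (@cvg_comp _ _ _ (fun u : R * R => u.1 - a1) (fun s => s ^+ 2));
      [apply: cvgB; [exact: cvg_fst|exact: cvg_cst]|exact: exprn_continuous].
  by apply: (@cvg_comp _ _ _ (fun u : R * R => u.2 - a2) (fun s => s ^+ 2));
      [apply: cvgB; [exact: cvg_snd|exact: cvg_cst]|exact: exprn_continuous].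
have cK : compact K.
  apply: compact_closedI; first by apply: compact_setX; exact: segment_compact.
  by apply: (@closed_comp _ _ (fun u : R * R => rho a1 a2 u.1 u.2) [set s | r ^+ 2 <= s]);
    [move=> u _; exact: crho|exact: closed_ge].
have K1 : K (x1, y1).
  split; last exact: ltW.
  by move: Bx1; rewrite !ler_distl /K /= !in_itv /=; split; lra.
have [|u] := compact_EVT_max (ex_intro _ _ K1) cK (f := fun u => G u.1 u.2).
  apply: continuous_in_subspaceT => u; rewrite inE => -[_ /= ru].
  have rp : 0 < rho a1 a2 u.1 u.2 by exact: lt_le_trans ru.
  apply: cvgB; first exact: cF.
  apply: cvgM; first exact: cvg_cst.
  apply: cvgB; last exact: cvg_cst.
  apply: (@cvg_comp _ _ _ (fun u : R * R => rho a1 a2 u.1 u.2) barrier); first exact: crho.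
  by apply: cvgB; [exact: continuous_ln|apply: cvgV; [exact: lt0r_neq0|exact: cvg_id]].
case: u => x2 y2; rewrite inE => -[/= [xB yB] r2] Gmax.
have G1 : G x1 y1 <= G x2 y2 by apply: (Gmax (x1, y1)); rewrite inE.
have G12 : F a1 a2 + eta / 2 < G x1 y1.
  by rewrite /G -/w1 /eta in ew *; lra.
have r2lt : r ^+ 2 < rho a1 a2 x2 y2.
  rewrite lt_neqAle r2 andbT; apply/negP => /eqP r2E.
  have : F x2 y2 < F a1 a2 + eta / 2 by apply: rP; rewrite -r2E.
  by move: G1; rewrite {2}/G /W -r2E subrr mulr0 subr0; lra.
have r2B : rho a1 a2 x2 y2 < B ^+ 2.
  by rewrite ltNge; apply/negP => /BP; lra.
have xlt : `|x2 - a1| < B.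
  rewrite -(ltr_pXn2r (n := 2)) ?nnegrE ?normr_ge0 ?ltW// real_normK ?num_real//.
  by have := sqr_ge0 (y2 - a2); rewrite /rho in r2B; lra.
have ylt : `|y2 - a2| < B.
  rewrite -(ltr_pXn2r (n := 2)) ?nnegrE ?normr_ge0 ?ltW// real_normK ?num_real//.
  by have := sqr_ge0 (x2 - a1); rewrite /rho in r2B; lra.
have [d d0 dP] : exists2 d, 0 < d & forall x y, `|x - x2| < d -> `|y - y2| < d ->
    r ^+ 2 < rho a1 a2 x y /\ G x y <= G x2 y2.
  have /nbhs_ballP [d /= d0 dP] : \forall u \near (x2, y2), r ^+ 2 < rho a1 a2 u.1 u.2.
    by have /cvgr_gt := crho (x2, y2); apply.
  pose d' := Num.min d (Num.min (B - `|x2 - a1|) (B - `|y2 - a2|)).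
  exists d'; first by rewrite !lt_min d0 !subr_gt0 xlt ylt.
  move=> x y; rewrite !lt_min => /andP[xd /andP[x3 x4]] /andP[yd /andP[y3 y4]].
  have rxy : r ^+ 2 < rho a1 a2 x y.
    by apply: (dP (x, y)); split; rewrite /ball /= distrC.
  split=> //; apply: (Gmax (x, y)); rewrite inE; split; last exact: ltW.
  have := ler_distD x2 x a1; have := ler_distD y2 y a2.
  rewrite /= !in_itv /= -!ler_distl; split; lra.
have dGx t : `|t - x2| < d -> is_derive t 1 (G ^~ y2)
    (Fx t y2 - e * (2 * (t - a1) / rho a1 a2 t y2 + 2 * (t - a1) / rho a1 a2 t y2 ^+ 2)).
  move=> td; have [rt _] := dP t y2 td ltac:(by rewrite subrr normr0).
  have h := is_derive_barrier (a := a1) (c := (y2 - a2) ^+ 2) (lt_trans r20 rt).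
  have := is_deriveB (dFx t y2) (is_deriveZ e (is_deriveB h (is_derive_cst (barrier (r ^+ 2)) t 1))).
  rewrite subr0 => hh; exact: hh.
have [gxx gxxE dGxx] : exists2 g, g = Fxx x2 y2 - e * (2 / rho a1 a2 x2 y2 + 2 / rho a1 a2 x2 y2 ^+ 2
     - 4 * (x2 - a1) ^+ 2 / rho a1 a2 x2 y2 ^+ 2 - 8 * (x2 - a1) ^+ 2 / rho a1 a2 x2 y2 ^+ 3) &
    is_derive x2 1 (fun t => Fx t y2 - e * (2 * (t - a1) / rho a1 a2 t y2
      + 2 * (t - a1) / rho a1 a2 t y2 ^+ 2)) g.
  eexists; first exact: erefl.
  have h := is_derive2_barrier (a := a1) (c := (y2 - a2) ^+ 2) (lt_trans r20 r2lt).
  exact: is_deriveB (dFxx x2 y2) (is_deriveZ e h).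
have dGy t : `|t - y2| < d -> is_derive t 1 (G x2)
    (Fy x2 t - e * (2 * (t - a2) / rho a1 a2 x2 t + 2 * (t - a2) / rho a1 a2 x2 t ^+ 2)).
  move=> td; have [rt _] := dP x2 t ltac:(by rewrite subrr normr0) td.
  rewrite /rho addrC in rt.
  have h := is_derive_barrier (a := a2) (c := (x2 - a1) ^+ 2) (lt_trans r20 rt).
  have := is_deriveB (dFy x2 t) (is_deriveZ e (is_deriveB h (is_derive_cst (barrier (r ^+ 2)) t 1))).
  rewrite subr0 /G /W /rho [_ + (t - a2) ^+ 2]addrC.
  by congr is_derive; apply/funext => s /=; rewrite [_ + (s - a2) ^+ 2]addrC.
have [gyy gyyE dGyy] : exists2 g, g = Fyy x2 y2 - e * (2 / rho a1 a2 x2 y2 + 2 / rho a1 a2 x2 y2 ^+ 2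
     - 4 * (y2 - a2) ^+ 2 / rho a1 a2 x2 y2 ^+ 2 - 8 * (y2 - a2) ^+ 2 / rho a1 a2 x2 y2 ^+ 3) &
    is_derive y2 1 (fun t => Fy x2 t - e * (2 * (t - a2) / rho a1 a2 x2 t
      + 2 * (t - a2) / rho a1 a2 x2 t ^+ 2)) g.
  eexists; first exact: erefl.
  have rt := r2lt; rewrite /rho addrC in rt.
  have h := is_derive2_barrier (a := a2) (c := (x2 - a1) ^+ 2) (lt_trans r20 rt).
  by apply: (is_derive_congr (is_deriveB (dFyy x2 y2) (is_deriveZ e h))) => [s|];
    rewrite /rho [(x2 - a1) ^+ 2 + _]addrC.
have hx := second_derive_le0_at_max d0 dGx dGxx
  (fun t td => (dP t y2 td ltac:(by rewrite subrr normr0)).2).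
have hy := second_derive_le0_at_max d0 dGy dGyy
  (fun t td => (dP x2 t ltac:(by rewrite subrr normr0) td).2).
have := lap x2 y2.
have : 0 < e * (4 / rho a1 a2 x2 y2 ^+ 2).
  by rewrite mulr_gt0// divr_gt0// exprn_gt0// (lt_trans r20).
have q0 : rho a1 a2 x2 y2 != 0 by rewrite gt_eqF// (lt_trans r20 r2lt).
move=> pos lap2; have := lerD hx hy; rewrite gxxE gyyE addr0.
suff -> : Fxx x2 y2 - e * (2 / rho a1 a2 x2 y2 + 2 / rho a1 a2 x2 y2 ^+ 2
     - 4 * (x2 - a1) ^+ 2 / rho a1 a2 x2 y2 ^+ 2 - 8 * (x2 - a1) ^+ 2 / rho a1 a2 x2 y2 ^+ 3)
   + (Fyy x2 y2 - e * (2 / rho a1 a2 x2 y2 + 2 / rho a1 a2 x2 y2 ^+ 2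
     - 4 * (y2 - a2) ^+ 2 / rho a1 a2 x2 y2 ^+ 2 - 8 * (y2 - a2) ^+ 2 / rho a1 a2 x2 y2 ^+ 3))
   = Fxx x2 y2 + Fyy x2 y2 + e * (4 / rho a1 a2 x2 y2 ^+ 2) by lra.
by move: q0; rewrite /rho => q0; field.
Qed.

End Liouville.

(** * Fano polytopes and their duals *)

Section Pairing.
Context {A : comPzRingType} {n : nat}.
Implicit Types x y : 'rV[A]_n.

Lemma pairingC x y : pairing x y = pairing y x.
Proof. by apply: eq_bigr => j _; rewrite mulrC. Qed.

Lemma pairingDr y x x' : pairing y (x + x') = pairing y x + pairing y x'.
Proof. by rewrite /pairing -big_split; apply: eq_bigr => j _; rewrite mxE mulrDr. Qed.

Lemma pairingZr y x t : pairing y (t *: x) = t * pairing y x.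
Proof. by rewrite /pairing mulr_sumr; apply: eq_bigr => j _; rewrite mxE mulrCA. Qed.

Lemma pairingDl y y' x : pairing (y + y') x = pairing y x + pairing y' x.
Proof. by rewrite ![pairing _ x]pairingC pairingDr. Qed.

Lemma pairingZl y x t : pairing (t *: y) x = t * pairing y x.
Proof. by rewrite ![pairing _ x]pairingC pairingZr. Qed.

Lemma pairing0r y : pairing y 0 = 0.
Proof. by rewrite /pairing big1// => j _; rewrite mxE mulr0. Qed.

Lemma pairing0l x : pairing 0 x = 0.
Proof. by rewrite pairingC pairing0r. Qed.

Lemma pairing_sumr (I : Type) (r : seq I) (Q : pred I) (F : I -> 'rV[A]_n) y :
  pairing y (\sum_(i <- r | Q i) F i) = \sum_(i <- r | Q i) pairing y (F i).
Proof. by elim/big_rec2 : _ => [|i a b _ <-]; rewrite ?pairing0r// pairingDr. Qed.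

Lemma pairing_suml (I : Type) (r : seq I) (Q : pred I) (F : I -> 'rV[A]_n) x :
  pairing (\sum_(i <- r | Q i) F i) x = \sum_(i <- r | Q i) pairing (F i) x.
Proof. by rewrite pairingC pairing_sumr; apply: eq_bigr => i _; rewrite pairingC. Qed.

Lemma pairing_delta y j : pairing y (delta_mx 0 j) = y 0 j.
Proof.
rewrite /pairing (bigD1 j) //= mxE !eqxx mulr1 big1 ?addr0// => i ij.
by rewrite mxE eqxx (negPf ij) mulr0.
Qed.

End Pairing.

Section RealPairing.
Context {R : realType} {n : nat}.

Lemma pairingNr (y x : 'rV[R]_n) : pairing y (- x) = - pairing y x.
Proof. by rewrite -scaleN1r pairingZr mulN1r. Qed.

Lemma pairingNl (y x : 'rV[R]_n) : pairing (- y) x = - pairing y x.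
Proof. by rewrite -scaleN1r pairingZl mulN1r. Qed.

Lemma pairing_realv (p q : 'rV[int]_n) :
  pairing (realv R p) (realv R q) = (pairing p q)%:~R.
Proof.
by rewrite /pairing rmorph_sum; apply: eq_bigr => j _; rewrite !mxE rmorphM.
Qed.

Lemma pairing_gt0 (v : 'rV[R]_n) : v != 0 -> 0 < pairing v v.
Proof.
move=> v0; have [j vj] : exists j, v 0 j != 0.
  apply/existsP; apply: contraNT v0 => /existsPn h; apply/eqP/rowP => j.
  by rewrite mxE; apply/eqP; have := h j; rewrite negbK.
rewrite /pairing (bigD1 j) //=; apply: ltr_pwDl.
  by rewrite -expr2 lt_def sqrf_eq0 vj sqr_ge0.
by apply: sumr_ge0 => i _; rewrite -expr2 sqr_ge0.
Qed.

End RealPairing.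

Section FanoPolytope.
Context {R : realType} {n : nat} (P : fano_polytope R n).
Notation q i := (realv R (@vert R n P i)).
Implicit Types (y x v : 'rV[R]_n) (s : chart P).

Lemma polytope_nbhs0 : exists2 r : R, 0 < r &
  forall x, (forall j, `|x 0 j| < r) -> polytope P x.
Proof.
have := fano_interior P; rewrite /interior => /nbhs_ballP [r /= r0 rP].
exists r => // x xr; apply: rP; split => // i j.
by rewrite /ball /= mxE sub0r normrN ord1.
Qed.

Lemma polytope_vert i : polytope P (q i).
Proof.
exists (fun k => (k == i)%:R); split => [k||]; first exact: ler0n.
  by rewrite (bigD1 i) //= eqxx big1 ?addr0// => k /negPf ->.
by rewrite (bigD1 i) //= eqxx scale1r big1 ?addr0// => k /negPf ->; rewrite scale0r.
Qed.

Lemma dual_polytope_le1 y x : dual_polytope P y -> polytope P x -> pairing y x <= 1.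
Proof.
move=> Py [c [c0 c1 ->]]; rewrite pairing_sumr -c1; apply: ler_sum => i _.
by rewrite pairingZr ler_piMr.
Qed.

Lemma polytope_scale v : exists2 e : R, 0 < e & polytope P (e *: v).
Proof.
have [r r0 rP] := polytope_nbhs0.
have S0 : 0 <= \sum_j `|v 0 j| by exact: sumr_ge0.
exists (r / (1 + \sum_j `|v 0 j|)); first by rewrite divr_gt0//; lra.
apply: rP => j; rewrite mxE normrM gtr0_norm; last by rewrite divr_gt0//; lra.
rewrite mulrAC ltr_pdivrMr; last lra.
rewrite ltr_pM2l// (bigD1 j) //= in S0 *.
have : 0 <= \sum_(i < n | i != j) `|v 0 i| by exact: sumr_ge0.
lra.
Qed.

(** 0 is interior to P, so every direction is positive on some vertex. *)
Lemma vert_pairing_gt0 v : v != 0 -> exists i, 0 < pairing v (q i).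
Proof.
move=> v0; have [e e0 [c [c0 c1 vE]]] := polytope_scale v.
apply: contrapT => /forallNP h.
have : 0 < pairing v (e *: v) by rewrite pairingZr mulr_gt0// pairing_gt0.
rewrite vE pairing_sumr ltNge => /negP; apply.
apply: sumr_le0 => i _; rewrite pairingZr mulr_ge0_le0//.
by rewrite leNgt; apply/negP; exact: h.
Qed.

Lemma dual_polytope_bounded : exists B : R, forall y, dual_polytope P y ->
  forall j, `|y 0 j| <= B.
Proof.
have [r r0 rP] := polytope_nbhs0.
exists (2 / r) => y Py j.
have h (e : R) : `|e| = 1 -> e * y 0 j <= 2 / r.
  move=> e1; have xP : polytope P ((e * r / 2) *: delta_mx 0 j).
    apply: rP => k; rewrite !mxE eqxx /=.
    have rr : `|r| = r by rewrite gtr0_norm.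
    have nn : `|e * r / 2| < r.
      by rewrite !normrM e1 rr normfV (ger0_norm (x := 2))//; lra.
    by case: (k == j); rewrite ?mulr1// mulr0 normr0.
  have := dual_polytope_le1 Py xP; rewrite pairingZr pairing_delta => h1.
  by rewrite ler_pdivlMr//; lra.
by rewrite ler_norml; have := h 1 (normr1 _); have := h (-1) (normrN1 _); lra.
Qed.

(** P^* is bounded, because 0 is interior to P. *)
Lemma finite_lattice_pts : finite_set (lattice_pts P).
Proof.
have [B BP] := dual_polytope_bounded.
pose K := Num.truncn B.
have pK (p : 'rV[int]_n) : lattice_pts P p -> forall j, (absz (p ord0 j) <= K)%N.
  move=> /BP h j; have := h j; rewrite mxE -intr_norm => hB.
  have B0 : 0 <= B by apply: le_trans hB; rewrite ler0z normr_ge0.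
  by rewrite /K truncn_ge_nat.
pose g (f : {ffun 'I_n -> 'I_(K + K).+1}) : 'rV[int]_n := \row_j ((f j)%:Z - K%:Z).
apply: (@sub_finite_set _ _ (g @` [set: {ffun 'I_n -> 'I_(K + K).+1}])).
  move=> p /pK pp; have h j : (absz (p ord0 j + K%:Z)%R < (K + K).+1)%N.
    rewrite ltnS -lez_nat abszE PoszD; apply: le_trans (ler_normD _ _) _.
    by rewrite lerD// -?abszE ?lez_nat.
  exists [ffun j => Ordinal (h j)] => //; apply/rowP => j; rewrite mxE ffunE /=.
  rewrite gez0_abs ?addrK//.
  have : `|p ord0 j| <= K%:Z by rewrite -abszE lez_nat.
  by rewrite ler_norml => /andP[hK _]; rewrite -lerBlDr sub0r.
exact/finite_image/finite_finset.
Qed.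

Definition tight y : {set 'I_(nvert P)} := [set i | pairing y (q i) == 1].

Lemma tightP y i : reflect (pairing y (q i) = 1) (i \in tight y).
Proof. by rewrite inE; exact: eqP. Qed.

Lemma tight_support y (c : 'I_(nvert P) -> R) : dual_polytope P y ->
  (forall i, 0 <= c i) -> \sum_i c i = 1 -> pairing y (\sum_i c i *: q i) = 1 ->
  forall i, i \notin tight y -> c i = 0.
Proof.
move=> Py c0 c1 yx i it; apply/eqP; apply: contraT => ci.
have : \sum_k c k * (1 - pairing y (q k)) = 0.
  under eq_bigr do rewrite mulrBr mulr1.
  rewrite big_split /= c1 sumrN -yx pairing_sumr.
  by under [X in X - _]eq_bigr do rewrite pairingZr; rewrite subrr.
move=> /eqP; rewrite psumr_eq0; last by move=> k _; rewrite mulr_ge0// subr_ge0.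
move=> /allP/(_ i (mem_index_enum _)) /=; rewrite mulf_eq0 (negPf ci) /= subr_eq0 eq_sym.
by move=> h; rewrite inE h in it.
Qed.

Lemma tight_spanning y : (forall v, (forall i, i \in tight y -> pairing v (q i) = 0) -> v = 0) ->
  forall x, exists c : 'I_(nvert P) -> R, x = \sum_(i in tight y) c i *: q i.
Proof.
move=> ker0 x.
pose A : 'M[R]_(nvert P, n) := \matrix_(i, j) ((i \in tight y)%:R * q i 0 j).
have fullA : row_full A.
  rewrite /row_full -mxrank_tr -/(row_free A^T) -kermx_eq0.
  apply/eqP/row_matrixP => i; rewrite row0; apply: ker0 => k kt.
  have : (row i (kermx A^T) *m A^T) 0 k = 0.
    by rewrite -row_mul mulmx_ker row0 mxE.
  by rewrite mxE => <-; apply: eq_bigr => j _; rewrite !mxE kt mul1r.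
have /submxP [c xE] : (x <= A)%MS by rewrite submx_full.
exists (fun i => c 0 i); rewrite {1}xE; apply/rowP => j; rewrite !mxE summxE.
rewrite [RHS]big_mkcond /=; apply: eq_bigr => i _; rewrite !mxE.
by case: ifP => _; rewrite ?mul1r// mul0r mulr0.
Qed.

(** The differences of the tight vertices span a complement of the line through
    one of them, on which [y] vanishes: this gives the dimension of the facet. *)
Lemma facet_of_spanning y : (0 < n)%N -> dual_polytope P y ->
  (forall v, (forall i, i \in tight y -> pairing v (q i) = 0) -> v = 0) ->
  exists s, forall i, i \in tight y -> exists j, i = s j.
Proof.
move=> n0 Py /tight_spanning spany.
pose F := [set x | polytope P x /\ pairing y x = 1].
have [i0 i0t] : exists i, i \in tight y.
  apply/existsP; apply: contraT => /existsPn h.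
  have [c] := spany (delta_mx 0 (Ordinal n0)).
  rewrite big1; last by move=> i; rewrite (negPf (h i)).
  move=> /rowP/(_ (Ordinal n0)); rewrite !mxE !eqxx => /eqP.
  by rewrite oner_eq0.
have Fv i : i \in tight y -> F (q i).
  by move=> /tightP; split => //; exact: polytope_vert.
have facetF : is_facet (polytope P) F.
  split.
    split; first by exists (q i0); exact: Fv.
    by exists y, 1; split => // x; exact: dual_polytope_le1.
  pose a := q i0.
  pose X : seq 'rV[R]_n := [seq q i - a | i <- enum (tight y)].
  have XU i : i \in tight y -> q i - a \in <<X>>%VS.
    by move=> it; apply: memv_span; apply/mapP; exists i; rewrite ?mem_enum.
  have yX u : u \in <<X>>%VS -> pairing y u = 0.
    move=> /(coord_span (X := in_tuple X)) ->; rewrite pairing_sumr big1// => k _.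
    rewrite pairingZr.
    have kX : (in_tuple X)`_k \in X by apply: mem_nth; case: k => k /=.
    have [ i] := mapP kX; rewrite mem_enum => /tightP it ->.
    by rewrite pairingDr pairingNr it (tightP _ _ i0t) subrr mulr0.
  exists a, <<X>>%VS; split.
  - exact: Fv.
  - have a0 : a != 0.
      apply/eqP => a0; have /tightP := i0t; rewrite -/a a0 pairing0r => /eqP.
      by rewrite eq_sym oner_eq0.
    have dis : (<<X>> :&: <[a]> = 0)%VS.
      apply/eqP; rewrite -subv0; apply/subvP => u /memv_capP [uX /vlineP [k uE]].
      have := yX _ uX; rewrite uE pairingZr (tightP _ _ i0t) mulr1 => ->.
      by rewrite scale0r mem0v.
    have full : (<<X>> + <[a]> = fullv)%VS.
      apply/eqP; rewrite eqEsubv subvf /=; apply/subvP => x _.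
      have [c ->] := spany x.
      rewrite (eq_bigr (fun i => c i *: (q i - a) + c i *: a)); last first.
        by move=> i _; rewrite -scalerDr subrK.
      rewrite big_split /= memv_add//.
        by apply: memv_suml => i it; apply: memvZ; exact: XU.
      by rewrite -scaler_suml memvZ// memv_line.
    have := dimv_disjoint_sum dis; rewrite full dimvf dim_vline a0 addn1.
    by move=> /(congr1 predn) /= <-; rewrite /dim /= mul1n.
  - move=> x [[c [c0 c1 xE]] yx].
    have ct : forall i, i \notin tight y -> c i = 0 by apply: tight_support => //; rewrite -xE.
    have -> : x - a = \sum_i c i *: (q i - a).
      under eq_bigr do rewrite scalerBr.
      by rewrite big_split /= sumrN -scaler_suml c1 scale1r -xE.
    apply: memv_suml => i _; have [it|it] := boolP (i \in tight y).
      by apply: memvZ; exact: XU.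
    by rewrite ct// scale0r mem0v.
  - move=> U' U'P; apply/span_subvP => u /mapP [ i]; rewrite mem_enum => it ->.
    by apply: U'P; exact: Fv.
have [s Fs] := fano_smooth facetF.
exists (Chart (ex_intro _ F (conj facetF Fs))) => i it.
by have [_ h] := Fs; apply/h; exact: Fv.
Qed.

(** Every face of P lies in a facet: as long as the vertices on which [y] takes
    the value 1 do not span, [y] can be moved in the dual polytope, keeping these
    values, until it takes the value 1 on a further vertex. *)
Lemma tight_sub_chart y : (0 < n)%N -> dual_polytope P y ->
  exists s, forall i, i \in tight y -> exists j, i = s j.
Proof.
move=> n0; have [m] := ubnP (#|~: tight y|); elim: m y => // m IHm y ym Py.
have [|/existsNP [v /not_implyP [vt /eqP v0]]] :=
  pselect (forall v, (forall i, i \in tight y -> pairing v (q i) = 0) -> v = 0).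
  exact: facet_of_spanning.
have [i0 i0v] := vert_pairing_gt0 v0.
pose ratio i := (1 - pairing y (q i)) / pairing v (q i).
case: (@arg_minP _ _ _ i0 (fun i => 0 < pairing v (q i)) ratio i0v) => i1 i1v i1min.
pose y' := y + ratio i1 *: v.
have t0 : 0 <= ratio i1 by rewrite divr_ge0 ?subr_ge0// ltW.
have y'E i : pairing y' (q i) = pairing y (q i) + ratio i1 * pairing v (q i).
  by rewrite pairingDl pairingZl.
have Py' : dual_polytope P y'.
  move=> i; rewrite y'E; have [iv|iv] := ltP 0 (pairing v (q i)).
    by have := i1min i iv; rewrite {2}/ratio ler_pdivlMr//; lra.
  by have := Py i; have : ratio i1 * pairing v (q i) <= 0 by [apply: mulr_ge0_le0]; lra.
have sub i : i \in tight y -> i \in tight y'.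
  by move=> it; apply/tightP; rewrite y'E vt// mulr0 addr0; exact/tightP.
have i1t : i1 \in tight y'.
  by apply/tightP; rewrite y'E /ratio divfK ?gt_eqF//; lra.
have i1N : i1 \notin tight y.
  by apply/negP => /vt i1v0; rewrite i1v0 ltxx in i1v.
have [|//|s sP] := IHm y' _; last by exists s => i /sub/sP.
rewrite -ltnS; apply: leq_trans ym; rewrite ltnS; apply: proper_card.
apply/fintype.properP; split; last by exists i1; rewrite finset.in_setC ?i1N ?i1t.
by rewrite finset.setCS; apply/fintype.subsetP.
Qed.

End FanoPolytope.

(** * Maximal cones, lattice points and faces *)

Section Charts.
Context {R : realType} {n : nat} {P : fano_polytope R n}.
Variable s : chart P.
Notation vt i := (@vert R n P i).
Notation q i := (realv R (@vert R n P i)).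

Lemma frame_unit : frame_mx (@vert R n P) s \in unitmx.
Proof. by have [F [_ []]] := frameP s. Qed.

Lemma intmx_unit (A : 'M[int]_n) : A \in unitmx -> intmx (R := R) A \in unitmx.
Proof. by rewrite !unitmxE det_map_mx => h; exact: rmorph_unit. Qed.

Lemma cone_coordK x : x = \sum_j cone_coord s x 0 j *: q (s j).
Proof.
have := mulmxKV (intmx_unit frame_unit) x => {1}<-; apply/rowP => j.
by rewrite mxE summxE; apply: eq_bigr => i _; rewrite !mxE.
Qed.

Lemma cone_coord_sum (a : 'I_n -> R) : cone_coord s (\sum_j a j *: q (s j)) = \row_j a j.
Proof.
rewrite /cone_coord; have -> : \sum_j a j *: q (s j) = (\row_j a j) *m intmx (frame_mx (@vert R n P) s).
  by apply/rowP => j; rewrite mxE summxE; apply: eq_bigr => i _; rewrite !mxE.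
by rewrite mulmxK// intmx_unit// frame_unit.
Qed.

Lemma cone_coordD x y : cone_coord s (x + y) = cone_coord s x + cone_coord s y.
Proof. exact: mulmxDl. Qed.

Lemma cone_coordZ c x : cone_coord s (c *: x) = c *: cone_coord s x.
Proof. by rewrite /cone_coord scalemxAl. Qed.

Lemma pairing_cone y x : pairing y x = \sum_j cone_coord s x 0 j * pairing y (q (s j)).
Proof. by rewrite {1}[x]cone_coordK pairing_sumr; apply: eq_bigr => j _; rewrite pairingZr. Qed.

Lemma pairing_frame_inj y y' :
  (forall j, pairing y (q (s j)) = pairing y' (q (s j))) -> y = y'.
Proof.
move=> h; apply/eqP; rewrite -subr_eq0; apply: contraT => /pairing_gt0.
rewrite {2}[y - y']cone_coordK pairing_sumr big1 ?ltxx// => j _.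
by rewrite pairingZr pairingDl pairingNl h subrr mulr0.
Qed.

(** The vertex of the dual polytope dual to the facet spanned by [s]. *)
Definition pvert : 'rV[int]_n := (invmx (frame_mx (@vert R n P) s) *m const_mx 1)^T.

Lemma pvertE j : pairing pvert (vt (s j)) = 1.
Proof.
have := mulKVmx frame_unit (const_mx 1 : 'cV[int]_n) => /matrixP /(_ j 0).
rewrite [RHS]mxE => <-; rewrite mxE; apply: eq_bigr => i _.
by rewrite mxE mulrC; congr (_ * _); rewrite mxE.
Qed.

(** The affine function cutting out the facet is proportional to [pvert], since a
    frame determines a linear form. *)
Lemma pvert_facet i :
  pairing (realv R pvert) (q i) <= 1 /\
  (pairing (realv R pvert) (q i) = 1 <-> exists j, i = s j).
Proof.
have [F [[[F0 [u [c [uc FE]]]] _] [_ Fs]]] := frameP s.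
have pv j : pairing (realv R pvert) (q (s j)) = 1 by rewrite pairing_realv pvertE.
have us j : pairing u (q (s j)) = c.
  have : F (q (s j)) by apply/Fs; exists j.
  by rewrite FE => -[].
have P0 : polytope P 0.
  by have [r r0] := polytope_nbhs0 P; apply => j; rewrite mxE normr0.
have c0 : 0 < c.
  rewrite lt_neqAle -{2}(pairing0r u) uc// andbT; apply/negP => /eqP c0.
  have u0 : u = 0 by apply: pairing_frame_inj => j; rewrite us pairing0l.
  have alls k : exists j, k = s j.
    by apply: (Fs k).1; rewrite FE u0; split; [exact: polytope_vert|rewrite pairing0l].
  have [d [d0 d1 dE]] := P0.
  have : pairing (realv R pvert) 0 = 1.
    rewrite {1}dE pairing_sumr -d1; apply: eq_bigr => k _.
    by have [j ->] := alls k; rewrite pairingZr pv mulr1.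
  by rewrite pairing0r => /eqP; rewrite eq_sym oner_eq0.
have uE : u = c *: realv R pvert.
  by apply: pairing_frame_inj => j; rewrite us pairingZl pv mulr1.
have uq k : pairing u (q k) = c * pairing (realv R pvert) (q k).
  by rewrite uE pairingZl.
have Pq := polytope_vert i.
split; first by have := uc _ Pq; rewrite uq ger_pMr.
split=> [h|[j ->]//]; apply: (Fs i).1; rewrite FE; split => //.
by rewrite uq h mulr1.
Qed.

Lemma pvert_lattice : lattice_pts P pvert.
Proof. by move=> i; have [] := pvert_facet i. Qed.

(** The order of vanishing, along the divisor of the j-th ray of the chart, of the
    section of the anticanonical bundle attached to [p]. *)
Definition kz (p : 'rV[int]_n) j : int := 1 - pairing p (vt (s j)).

Lemma kzE p j : (kz p j)%:~R = 1 - pairing (realv R p) (q (s j)) :> R.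
Proof. by rewrite pairing_realv rmorphB. Qed.

Lemma kz_ge0 p j : lattice_pts P p -> 0 <= kz p j.
Proof. by move=> /(_ (s j)); rewrite -(ler0z R) kzE subr_ge0. Qed.

Lemma kz_pvert j : kz pvert j = 0.
Proof. by rewrite /kz pvertE subrr. Qed.

(** In the chart the section of [p] is a monomial with exponents [kz], up to the
    common factor given by the section of the vertex. *)
Lemma pairing_kz p x : pairing (realv R p) x =
  \sum_j cone_coord s x 0 j - \sum_j (kz p j)%:~R * cone_coord s x 0 j.
Proof.
rewrite (pairing_cone (realv R p) x) -sumrB; apply: eq_bigr => j _.
by rewrite kzE; ring.
Qed.

End Charts.

Section Lattice.
Context {R : realType} {n : nat} (P : fano_polytope R n).

Definition lat_fset : {fset 'rV[int]_n} := fset_set (lattice_pts P).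

(** A finite type, so that sums over the lattice points are plain big operators. *)
Definition Lat : finType := lat_fset.

Definition lpt (i : Lat) : 'rV[int]_n := val i.

Lemma lpt_lattice i : lattice_pts P (lpt i).
Proof. have := valP i; rewrite /lat_fset (in_fset_set (finite_lattice_pts P)).
exact: set_mem.
Qed.

Lemma lptP p : lattice_pts P p -> exists i, lpt i = p.
Proof.
move=> Pp; have pl : p \in lat_fset.
  by rewrite /lat_fset (in_fset_set (finite_lattice_pts P)); exact: mem_set.
by exists [` pl]%fset.
Qed.

Lemma sum_lattice (V : nmodType) (F : 'rV[int]_n -> V) :
  \sum_(p \in lattice_pts P) F p = \sum_(i : Lat) F (lpt i).
Proof. by rewrite fsbig_finite ?big_seq_fsetE//; exact: finite_lattice_pts. Qed.

Lemma sum_lattice_cond (V : nmodType) (D : set 'rV[int]_n) (F : 'rV[int]_n -> V) :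
  \sum_(p \in [set p | lattice_pts P p /\ D p]) F p = \sum_(i : Lat | `[< D (lpt i) >]) F (lpt i).
Proof.
transitivity (\sum_(p \in lattice_pts P) (if `[< D p >] then F p else 0)).
  rewrite [RHS]fsbig_mkcond [LHS]fsbig_mkcond; apply: eq_fsbigr => p _.
  rewrite /patch; case: (boolP (p \in lattice_pts P)) => pP.
    case: asboolP => Dp.
      by rewrite (_ : _ \in _ = true)//; apply: mem_set; split => //; exact: set_mem.
    by rewrite (_ : _ \in _ = false)//; apply/negP => /set_mem [].
  rewrite (_ : _ \in _ = false)//; apply/negP => /set_mem [/mem_set pP' _].
  by rewrite pP' in pP.
by rewrite sum_lattice [RHS]big_mkcond.
Qed.

End Lattice.

Section Faces.
Context {R : realType} {n : nat} (P : fano_polytope R n).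
Notation q i := (realv R (@vert R n P i)).

(** Since 0 is interior to P, a proper face is cut out by the value 1 of a point
    of the dual polytope. *)
Lemma face_dual_point (delta : set 'rV[R]_n) l : (l < n)%N ->
  is_face (polytope P) delta -> has_dim delta l ->
  exists2 y, dual_polytope P y & delta = [set x | polytope P x /\ pairing y x = 1].
Proof.
move=> ln [_ [u [c [uc dE]]]] ddim.
have P0 : polytope P 0.
  by have [r r0] := polytope_nbhs0 P; apply => j; rewrite mxE normr0.
have c0 : 0 < c.
  rewrite lt_neqAle -{2}(pairing0r u) uc// andbT; apply/negP => /eqP c0.
  have u0 : u = 0.
    apply/eqP; apply: contraT => /(vert_pairing_gt0 P) [ i].
    by rewrite ltNge c0 uc//; exact: polytope_vert.
  have dP : delta = polytope P.
    by rewrite dE u0 -c0; apply/seteqP; split => x /=; rewrite ?pairing0l; tauto.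
  have [a [U [_ dU xU _]]] := ddim; rewrite dP in xU.
  have [r r0 rP] := polytope_nbhs0 P.
  have aU : a \in U by rewrite -[a]opprK memvN -[- a]add0r; exact: xU.
  have fullU : U = fullv.
    apply/eqP; rewrite eqEsubv subvf /=; apply/subvP => x _.
    have [e e0 Px] := polytope_scale P x.
    have : e *: x \in U by rewrite -[e *: x](subrK a) memvD//; exact: xU.
    by move=> /(memvZ e^-1); rewrite scalerA mulVf ?gt_eqF// scale1r.
  have dn : dim 'rV[R]_n = n by rewrite /dim /= mul1n.
  by move: ln; rewrite -dU fullU dimvf dn ltnn.
exists (c^-1 *: u).
  by move=> i; rewrite pairingZl ler_pdivrMl// mulr1; apply: uc; exact: polytope_vert.
rewrite dE; apply/seteqP; split => x /= [Px ux]; split => //.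
  by rewrite pairingZl ux mulVf// gt_eqF.
by move: ux; rewrite pairingZl => /(congr1 ( *%R c)); rewrite mulVKf ?mulr1// gt_eqF.
Qed.

Variables (y : 'rV[R]_n) (s : chart P).
Hypothesis Py : dual_polytope P y.
Hypothesis ys : forall i, i \in tight P y -> exists j, i = s j.
Let delta := [set x | polytope P x /\ pairing y x = 1].
Let D j := s j \in tight P y.

Lemma chart_inj : injective s.
Proof.
move=> i j ij; have := cone_coord_sum s (fun k => (k == i)%:R).
rewrite (bigD1 i) //= eqxx scale1r big1 ?addr0; last first.
  by move=> k /negPf ->; rewrite scale0r.
have := cone_coord_sum s (fun k => (k == j)%:R).
rewrite (bigD1 j) //= eqxx scale1r big1 ?addr0; last first.
  by move=> k /negPf ->; rewrite scale0r.
rewrite ij => -> /rowP /(_ j); rewrite !mxE eqxx.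
by case: eqP => // _ /eqP; rewrite oner_eq0.
Qed.

Lemma face_coordP x : delta x <->
  [/\ forall j, 0 <= cone_coord s x 0 j, forall j, ~~ D j -> cone_coord s x 0 j = 0 &
      \sum_j cone_coord s x 0 j = 1].
Proof.
split=> [[[c [c0 c1 xE]] yx]|[a0 aD a1]].
  have ct : forall i, i \notin tight P y -> c i = 0 by apply: tight_support => //; rewrite -xE.
  have xa : x = \sum_j (c (s j)) *: q (s j).
    rewrite {1}xE -(big_imset (h := s) (A := 'I_n) (fun i => c i *: q i)) /=; last first.
      by move=> i j _ _; exact: chart_inj.
    rewrite [RHS]big_mkcond /=; apply: eq_bigr => i _; case: ifPn => // h.
    have [it|it] := boolP (i \in tight P y); last by rewrite ct// scale0r.
    by have [j ij] := ys it; case/negP: h; rewrite ij; apply: imset_f.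
  have aE j : cone_coord s x 0 j = c (s j) by rewrite xa cone_coord_sum mxE.
  split=> [j|j jD|]; rewrite ?aE//; first exact: ct.
  rewrite -yx [RHS](pairing_cone s); apply: eq_bigr => j _; rewrite aE.
  have [/tightP ->|jt] := boolP (s j \in tight P y); first by rewrite mulr1.
  by rewrite ct// mul0r.
split.
  exists (fun i => \sum_(j | s j == i) cone_coord s x 0 j); split.
  - by move=> i; apply: sumr_ge0.
  - by rewrite -a1 [RHS](partition_big s xpredT).
  - rewrite {1}(cone_coordK s x) (partition_big s xpredT) //=; apply: eq_bigr => i _.
    by rewrite scaler_suml; apply: eq_bigr => j /eqP ->.
rewrite (pairing_cone s) -a1; apply: eq_bigr => j _.
have [/tightP ->|jD] := boolP (D j); first by rewrite mulr1.
by rewrite aD// mul0r.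
Qed.

Lemma dual_faceE z : dual_face P delta z <->
  dual_polytope P z /\ forall j, D j -> pairing z (q (s j)) = 1.
Proof.
split=> [[Pz zd]|[Pz zD]]; split => //.
  move=> j /tightP jD; apply: zd; first exact: vert_vertex.
  by split => //; exact: polytope_vert.
move=> x _ /face_coordP [a0 aD a1]; rewrite (pairing_cone s) -a1; apply: eq_bigr => j _.
have [jD|jD] := boolP (D j); first by rewrite zD// mulr1.
by rewrite aD// mul0r.
Qed.

End Faces.

(** * The Hessian of a log-sum-exp function *)

Section GramDeterminant.
Context {R : comNzRingType} {N : nat} {I : finType}.
Variables (w : I -> R) (v : I -> 'rV[R]_N).

Definition pick_mx (f : {ffun 'I_N -> I}) : 'M[R]_N := \matrix_(i, j) v (f i) 0 j.

Lemma det_gram_expand :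
  \det (\sum_k w k *: ((v k)^T *m v k)) =
  \sum_(f : {ffun 'I_N -> I}) (\prod_i (w (f i) * v (f i) 0 i)) * \det (pick_mx f).
Proof.
transitivity (\sum_(s : {perm 'I_N}) (-1) ^+ s *
    \sum_(f : {ffun 'I_N -> I}) \prod_i (w (f i) * (v (f i) 0 i * v (f i) 0 (s i)))).
  apply: eq_bigr => s _; congr (_ * _).
  rewrite -(bigA_distr_bigA (fun i k => w k * (v k 0 i * v k 0 (s i)))).
  apply: eq_bigr => i _; rewrite summxE; apply: eq_bigr => k _.
  by rewrite !mxE big_ord1 !mxE.
under eq_bigr do rewrite mulr_sumr.
rewrite exchange_big /=; apply: eq_bigr => f _; rewrite mulr_sumr.
apply: eq_bigr => s _; rewrite mulrCA; congr (_ * _).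
rewrite -big_split /=; apply: eq_bigr => i _.
by rewrite mxE mulrA.
Qed.

(** Cauchy-Binet, with the sum over all families of indices instead of the
    subsets: reindexing by the permutations of the family and averaging turns
    the product of diagonal entries into a second determinant. *)
Lemma det_gram :
  N`!%:R * \det (\sum_k w k *: ((v k)^T *m v k)) =
  \sum_(f : {ffun 'I_N -> I}) (\prod_i w (f i)) * \det (pick_mx f) ^+ 2.
Proof.
pose G (f : {ffun 'I_N -> I}) := (\prod_i (w (f i) * v (f i) 0 i)) * \det (pick_mx f).
pose pc (s : {perm 'I_N}) (f : {ffun 'I_N -> I}) : {ffun 'I_N -> I} := [ffun i => f (s i)].
have GE (s : {perm 'I_N}) : \sum_f G f = \sum_(f : {ffun 'I_N -> I}) (\prod_i w (f i)) * \det (pick_mx f) *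
    ((-1) ^+ s * \prod_i pick_mx f (s i) i).
  rewrite (reindex_inj (h := pc s)) /=; last first.
    move=> f g /ffunP fg; apply/ffunP => i.
    by have := fg (s^-1 i)%g; rewrite !ffunE permKV.
  apply: eq_bigr => f _; rewrite /G.
  have -> : pick_mx (pc s f) = row_perm s (pick_mx f).
    by apply/matrixP => i j; rewrite !mxE ffunE.
  rewrite row_permE det_mulmx det_perm big_split /=.
  have -> : \prod_i w (pc s f i) = \prod_i w (f i).
    rewrite [RHS](reindex_inj (h := s)) /=; last exact: perm_inj.
    by apply: eq_bigr => i _; rewrite ffunE.
  have -> : \prod_(i < N) v (pc s f i) 0 i = \prod_i pick_mx f (s i) i.
    by apply: eq_bigr => i _; rewrite ffunE mxE.
  by rewrite -!mulrA; congr (_ * _); rewrite mulrCA [RHS]mulrCA; congr (_ * _); rewrite mulrC.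
rewrite det_gram_expand -/(\sum_f G f).
have <- : #|{: {perm 'I_N}}| = N`! by rewrite card_Sn.
rewrite -sum1_card natr_sum mulr_suml.
under eq_bigr => s _ do rewrite mul1r (GE s).
rewrite exchange_big /=; apply: eq_bigr => f _; rewrite -mulr_sumr expr2 mulrA.
congr (_ * _); rewrite -[RHS]det_tr; apply: eq_bigr => s _; congr (_ * _).
by apply: eq_bigr => i _; rewrite !mxE.
Qed.

End GramDeterminant.

Section Covariance.
Context {R : realFieldType} {n : nat} {I : finType}.
Variables (w : I -> R) (p : I -> 'rV[R]_n).

Definition aff (k : I) : 'rV[R]_(1 + n) := row_mx 1%:M (p k).

Definition cov_mx : 'M[R]_n := \matrix_(i, j)
  (\sum_k w k * (p k 0 i * p k 0 j) - (\sum_k w k * p k 0 i) * (\sum_k w k * p k 0 j)).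

(** Adding the constant function 1 makes the covariance matrix of [p] the Schur
    complement of a Gram matrix. *)
Lemma det_cov : \sum_k w k = 1 ->
  (1 + n)`!%:R * \det cov_mx =
  \sum_(f : {ffun 'I_(1 + n) -> I}) (\prod_i w (f i)) * \det (pick_mx aff f) ^+ 2.
Proof.
move=> w1; rewrite -det_gram; congr (_ * _).
pose m : 'rV[R]_n := \row_j \sum_k w k * p k 0 j.
pose S : 'M[R]_n := \matrix_(i, j) \sum_k w k * (p k 0 i * p k 0 j).
have -> : \sum_k w k *: ((aff k)^T *m aff k) = block_mx 1%:M m m^T S.
  apply/matrixP => i j; rewrite summxE.
  transitivity (\sum_k w k * (aff k 0 i * aff k 0 j)).
    by apply: eq_bigr => k _; rewrite [LHS]mxE [in LHS]mxE big_ord1 [X in _ * (X * _)]mxE.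
  rewrite -(splitK i) -(splitK j).
  case: (fintype.split i) => a; case: (fintype.split j) => b /=.
  - rewrite block_mxEul !ord1 mxE /= -w1; apply: eq_bigr => k _.
    by rewrite /aff row_mxEl mxE /= !mulr1.
  - rewrite block_mxEur !mxE; apply: eq_bigr => k _.
    by rewrite /aff row_mxEl row_mxEr !ord1 mxE /= mul1r.
  - rewrite block_mxEdl !mxE; apply: eq_bigr => k _.
    by rewrite /aff row_mxEl row_mxEr !ord1 mxE /= mulr1.
  - by rewrite block_mxEdr !mxE; apply: eq_bigr => k _; rewrite /aff !row_mxEr.
have <- : block_mx 1%:M 0 m^T 1%:M *m block_mx 1%:M m 0 cov_mx = block_mx 1%:M m m^T S.
  rewrite mulmx_block !mul1mx !mul0mx !mulmx1 !addr0; congr block_mx.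
  by apply/matrixP => i j; rewrite !mxE big_ord1 !mxE addrC subrK.
by rewrite det_mulmx det_lblock det_ublock !det1 !mul1r.
Qed.

End Covariance.

Section Derivatives.
Context {R : realType}.

Lemma is_derive_line (V : normedModType R) (f : V -> R) (x v : V) (t a : R) :
  is_derive t (1 : R) (fun t => f (x + t *: v)) a <-> is_derive (x + t *: v) v f a.
Proof.
have E : (fun h : R => h^-1 *: (f (x + (h *: (1 : R) + t) *: v) - f (x + t *: v))) =
    (fun h : R => h^-1 *: (f (h *: v + (x + t *: v)) - f (x + t *: v))).
  apply/funext => h; congr (_ *: (f _ - _)); rewrite scalerDl addrCA.
  by congr (_ *: _ + _); rewrite /GRing.scale /= mulr1.
split=> -[]; rewrite /derivable /derive /shift /=.
  by rewrite E => dv <-; split.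
by rewrite -E => dv <-; split.
Qed.

Lemma is_derive_line0 (V : normedModType R) (f : V -> R) (x v : V) (a : R) :
  is_derive (0 : R) (1 : R) (fun t => f (x + t *: v)) a <-> is_derive x v f a.
Proof. by rewrite is_derive_line scale0r addr0. Qed.

End Derivatives.

Section LogSumExp.
Context {R : realType} {n : nat} {I : finType}.
Variable p : I -> 'rV[R]_n.

Lemma is_derive_sum_expR (c : I -> R) (x : 'rV[R]_n) j :
  is_derive x (delta_mx 0 j) (fun x => \sum_k c k * expR (pairing (p k) x))
    (\sum_k c k * p k 0 j * expR (pairing (p k) x)).
Proof.
rewrite (_ : (fun x => _) = \sum_(k in I) (fun x => c k * expR (pairing (p k) x))); last first.
  by apply/funext => y; rewrite fct_sumE.
rewrite -big_enum /= -[X in is_derive _ _ _ X]big_enum /=.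
elim: (enum I) => [|k s IHs]; first by rewrite !big_nil; exact: is_derive_cst.
rewrite !big_cons; apply: is_deriveD => //; apply/is_derive_line0.
have h1 : is_derive (0 : R) (1 : R) (horner (pairing (p k) x)%:P + horner ((p k 0 j) *: 'X)) (p k 0 j).
  have := is_deriveD (is_derive_poly (pairing (p k) x)%:P 0) (is_derive_poly ((p k 0 j) *: 'X) 0).
  by rewrite derivC derivZ derivX !hornerE.
have := is_deriveZ (c k) (is_derive1_comp (f := expR) (is_derive_expR _) h1).
rewrite (_ : _ \*: _ = fun t => c k * expR (pairing (p k) (x + t *: delta_mx 0 j))); last first.
  apply/funext => t /=; rewrite !fctE /= pairingDr pairingZr pairing_delta.
  by rewrite !hornerE [t * _]mulrC.
move=> h; refine (_ : is_derive _ _ _ _).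
suff -> : c k * p k 0 j * expR (pairing (p k) x) =
  c k *: (expR ((horner (pairing (p k) x)%:P + horner ((p k 0 j) *: 'X)) 0) * p k 0 j) by [].
by rewrite !fctE !hornerE /GRing.scale /=; ring.
Qed.

(** The partition function and the Gibbs weights of the exponents [p]. *)
Definition Zexp (x : 'rV[R]_n) := \sum_k expR (pairing (p k) x).

Definition wexp (x : 'rV[R]_n) k := expR (pairing (p k) x) / Zexp x.

Lemma Zexp_gt0 (k : I) x : 0 < Zexp x.
Proof.
rewrite /Zexp (bigD1 k) //=; apply: ltr_pwDl; first exact: expR_gt0.
by apply: sumr_ge0 => i _; exact: expR_ge0.
Qed.

Lemma sum_wexp (k : I) x : \sum_k wexp x k = 1.
Proof. by rewrite -mulr_suml mulfV// gt_eqF// Zexp_gt0. Qed.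

Lemma wexp_gt0 x k : 0 < wexp x k.
Proof. by rewrite divr_gt0 ?expR_gt0// Zexp_gt0. Qed.

Lemma is_derive_ln_Zexp (k0 : I) x j :
  is_derive x (delta_mx 0 j) (fun x => ln (Zexp x)) (\sum_k wexp x k * p k 0 j).
Proof.
have h := is_derive_sum_expR (fun=> 1) x j.
apply/is_derive_line0; move/is_derive_line0 in h.
have Z0 : 0 < \sum_k 1 * expR (pairing (p k) (x + 0 *: delta_mx 0 j)).
  by rewrite scale0r addr0; under eq_bigr do rewrite mul1r; exact: Zexp_gt0.
have := is_derive1_comp (is_derive1_ln Z0) h.
rewrite (_ : _ \o _ = fun t => ln (Zexp (x + t *: delta_mx 0 j))); last first.
  by apply/funext => t /=; congr ln; apply: eq_bigr => k _; rewrite mul1r.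
move=> h1; suff -> : \sum_k wexp x k * p k 0 j = (\sum_k 1 * expR (pairing (p k) (x + 0 *: delta_mx 0 j)))^-1 *
  (\sum_k 1 * p k 0 j * expR (pairing (p k) x)) by [].
rewrite scale0r addr0 mulr_sumr; apply: eq_bigr => k _.
by rewrite /wexp /Zexp; under [in RHS]eq_bigr do rewrite mul1r; rewrite mul1r; ring.
Qed.

Lemma derive_ln_Zexp (k0 : I) j :
  (fun x => 'D_(delta_mx 0 j) (fun x => ln (Zexp x)) x) = (fun x => \sum_k wexp x k * p k 0 j).
Proof.
by apply/funext => x; have := is_derive_ln_Zexp k0 x j => h; rewrite derive_val.
Qed.

Lemma hess_ln_Zexp (k0 : I) x :
  (\matrix_(i, j) pderiv [:: i; j] (fun x => ln (Zexp x)) x) = cov_mx (wexp x) p.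
Proof.
apply/matrixP => i j; rewrite !mxE /pderiv /= derive_ln_Zexp//.
have h1 := is_derive_sum_expR (fun k => p k 0 j) x i.
have h2 := is_derive_sum_expR (fun=> 1) x i.
move/is_derive_line0 in h1; move/is_derive_line0 in h2.
have Z0 : 0 < (fun t : R => \sum_k 1 * expR (pairing (p k) (x + t *: delta_mx 0 i))) 0.
  by rewrite scale0r addr0; under eq_bigr do rewrite mul1r; exact: Zexp_gt0.
have h3 := is_deriveM h1 (is_deriveV (lt0r_neq0 Z0) h2).
suff h : is_derive x (delta_mx 0 i) (fun x => \sum_k wexp x k * p k 0 j)
  (\sum_k wexp x k * (p k 0 i * p k 0 j) - (\sum_k wexp x k * p k 0 i) * (\sum_k wexp x k * p k 0 j)).
  by rewrite derive_val.
apply/is_derive_line0; apply: (is_derive_congr h3) => [t|].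
  rewrite !fctE mulr_suml; apply: eq_bigr => k _; rewrite /wexp /Zexp.
  by under [X in _ / X = _]eq_bigr do rewrite mul1r; ring.
have Z1 : Zexp x != 0 by rewrite gt_eqF// Zexp_gt0.
rewrite scale0r addr0 /GRing.scale /=.
under [X in (_ * (- X ^- 2 * _))]eq_bigr do rewrite mul1r.
under [X in (_ * (_ * X))]eq_bigr do rewrite mul1r.
under [X in (_ + X^-1 * _)]eq_bigr do rewrite mul1r.
rewrite -/(Zexp x).
have -> : \sum_k wexp x k * (p k 0 i * p k 0 j) =
    (Zexp x)^-1 * \sum_k p k 0 j * p k 0 i * expR (pairing (p k) x).
  by rewrite mulr_sumr; apply: eq_bigr => k _; rewrite /wexp; ring.
have -> : \sum_k wexp x k * p k 0 i = (Zexp x)^-1 * \sum_k p k 0 i * expR (pairing (p k) x).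
  by rewrite mulr_sumr; apply: eq_bigr => k _; rewrite /wexp; ring.
have -> : \sum_k wexp x k * p k 0 j = (Zexp x)^-1 * \sum_k p k 0 j * expR (pairing (p k) x).
  by rewrite mulr_sumr; apply: eq_bigr => k _; rewrite /wexp; ring.
by field.
Qed.

End LogSumExp.

(** * Points of the toric manifold *)

Section ComplexNumbers.
Context {R : realType}.
Local Open Scope complex_scope.
Implicit Types (a t : R) (c : R[i]).

Lemma abs2_ge0 c : 0 <= abs2 c.
Proof. by rewrite addr_ge0 ?sqr_ge0. Qed.

Lemma abs2M c c' : abs2 (c * c') = abs2 c * abs2 c'.
Proof. by case: c => a b; case: c' => a' b'; rewrite /abs2 /=; ring. Qed.

Lemma abs2_eq0 c : (abs2 c == 0) = (c == 0).
Proof.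
case: c => a b; rewrite /abs2 /= paddr_eq0 ?sqr_ge0// !sqrf_eq0.
by rewrite eq_complex /=.
Qed.

Lemma abs2_real a : abs2 a%:C = a ^+ 2.
Proof. by rewrite /abs2 /= expr0n addr0. Qed.

Lemma abs2_cis t : abs2 (cis t) = 1.
Proof. by rewrite /abs2 /= cos2Dsin2. Qed.

(** [exp (- (a / 2 + i t))]: the coordinate in a chart of the point with
    logarithmic coordinate [a] and angle [t] along the ray. *)
Definition cE a t : R[i] := (expR (- a / 2))%:C * cis (- t).

Lemma abs2_cE a t : abs2 (cE a t) = expR (- a).
Proof.
rewrite abs2M abs2_real abs2_cis mulr1 -expRM_natl; congr expR.
by rewrite mulrC divfK.
Qed.

Lemma cE_neq0 a t : cE a t != 0.
Proof. by rewrite -abs2_eq0 abs2_cE gt_eqF// expR_gt0. Qed.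

Lemma cED a b t u : cE (a + b) (t + u) = cE a t * cE b u.
Proof.
rewrite /cE !opprD mulrDl expRD /cis cosD sinD; apply/eqP; rewrite eq_complex /=.
by apply/andP; split; apply/eqP; ring.
Qed.

Lemma cE0 : cE 0 0 = 1.
Proof.
rewrite /cE /cis !oppr0 mul0r expR0 cos0 sin0; apply/eqP.
by rewrite eq_complex /= !(mulr1, mul0r, mulr0, subr0, addr0) !eqxx.
Qed.

Lemma cE_exprz a t (k : int) : cE a t ^ k = cE (k%:~R * a) (k%:~R * t).
Proof.
have nat m : cE a t ^+ m = cE (m%:R * a) (m%:R * t).
  elim: m => [|m IHm]; first by rewrite expr0 !mul0r cE0.
  by rewrite exprS IHm -cED -natr1 !mulrDl !mul1r ![_ + a]addrC ![_ + t]addrC.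
case: k => m; first by rewrite -exprnP nat.
rewrite NegzE -exprnN nat; apply: (mulIf (cE_neq0 (m.+1%:R * a) (m.+1%:R * t))).
rewrite mulVf ?cE_neq0// -cED -!mulrDl rmorphN /=.
by rewrite -pmulrn addNr !mul0r cE0.
Qed.

Lemma cE_sum (I : Type) (r : seq I) (a t : I -> R) :
  \prod_(i <- r) cE (a i) (t i) = cE (\sum_(i <- r) a i) (\sum_(i <- r) t i).
Proof.
by elim: r => [|i r IHr]; rewrite ?big_nil ?cE0// !big_cons IHr cED.
Qed.

Lemma cE_surj c : c != 0 -> exists a t, cE a t = c.
Proof.
move=> c0; have r0 : 0 < abs2 c by rewrite lt_def abs2_eq0 c0 abs2_ge0.
pose r := Num.sqrt (abs2 c).
have rp : 0 < r by rewrite sqrtr_gt0.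
have r2 : r ^+ 2 = abs2 c by rewrite sqr_sqrtr// ltW.
pose u := complex.Re c / r; pose v := complex.Im c / r.
have uv : u ^+ 2 + v ^+ 2 = 1.
  by rewrite /u /v !expr_div_n -mulrDl -/(abs2 c) r2 mulfV// gt_eqF.
have u1 : -1 <= u <= 1.
  have := sqr_ge0 v => v0; have : u ^+ 2 <= 1 by lra.
  by move=> h; apply/andP; split; nra.
have [t [ct st]] : exists t, cos t = u /\ sin t = v.
  have cu : cos (acos u) = u by apply: acosK; rewrite in_itv.
  have su : sin (acos u) = `|v|.
    by rewrite sin_acos// -sqrtr_sqr; congr Num.sqrt; lra.
  have [v0|v0] := leP 0 v.
    by exists (acos u); rewrite cu su ger0_norm.
  by exists (- acos u); rewrite cosN sinN cu su ltr0_norm// opprK.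
exists (- 2 * ln r), (- t); rewrite /cE.
have -> : - (- 2 * ln r) / 2 = ln r by field.
rewrite lnK ?posrE// opprK /cis ct st /u /v.
case: (c) => x y; apply/eqP; rewrite eq_complex /= !mul0r subr0 addr0.
by rewrite ![r * _]mulrC !divfK ?eqxx// gt_eqF.
Qed.

End ComplexNumbers.

Section Coordinates.
Context {R : realType} {n : nat}.
Local Open Scope complex_scope.

Lemma ofCK (w : 'rV[R[i]]_n) : toC (ofC w) = w.
Proof.
apply/rowP => j; rewrite mxE row_mxEl row_mxEr !mxE.
by case: (w 0 j).
Qed.

Lemma toCK (z : 'rV[R]_(n + n)) : ofC (toC z) = z.
Proof.
apply/rowP => j; rewrite mxE.
by case: splitP => k jk; rewrite !mxE /=; congr (z 0 _); apply: val_inj.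
Qed.

Lemma abs2_toC (z : 'rV[R]_(n + n)) j :
  abs2 (toC z 0 j) = z 0 (lshift n j) ^+ 2 + z 0 (rshift n j) ^+ 2.
Proof. by rewrite mxE. Qed.

Lemma continuous_abs2_toC j : continuous (fun z : 'rV[R]_(n + n) => abs2 (toC z 0 j)).
Proof.
have cX (i : 'I_(n + n)) : continuous (fun z : 'rV[R]_(n + n) => z 0 i ^+ 2).
  move=> z; apply: (@continuous_comp _ _ _ (fun z : 'rV[R]_(n + n) => z 0 i) (fun t => t ^+ 2)).
    exact: coord_continuous.
  exact: exprn_continuous.
move=> z; rewrite (_ : (fun z => _) = fun z : 'rV[R]_(n + n) => z 0 (lshift n j) ^+ 2 + z 0 (rshift n j) ^+ 2).
  exact: cvgD (cX _ z) (cX _ z).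
by apply/funext => w; rewrite abs2_toC.
Qed.

End Coordinates.

Section ToricPoints.
Context {R : realType} {n : nat} {P : fano_polytope R n}.
Local Open Scope complex_scope.
Notation vt i := (@vert R n P i).
Notation Cox := 'rV[R[i]]_(nvert P).
Implicit Types (s : chart P) (p : toric P) (x th : 'rV[R]_n).

Lemma toric_eq p p' : coords p = coords p' -> p = p'.
Proof.
case: p => c h; case: p' => c' h' /= cc; subst c'.
by congr ToricPt; exact: Prop_irrelevance.
Qed.

Lemma cox_orbit_mul (g z : Cox) : cox_group g ->
  cox_orbit (\row_i (g 0 i * z 0 i)) = cox_orbit z.
Proof.
move=> [g0 g1]; apply/seteqP; split => z' [h [[h0 h1] ->]].
  exists (\row_i (h 0 i * g 0 i)); split.
    split=> [i|m]; first by rewrite mxE mulf_neq0.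
    under eq_bigr do rewrite mxE expfzMl.
    by rewrite big_split /= h1 g1 mulr1.
  by apply/rowP => i; rewrite !mxE mulrA.
exists (\row_i (h 0 i / g 0 i)); split.
  split=> [i|m]; first by rewrite mxE mulf_neq0 ?invr_eq0.
  under eq_bigr do rewrite mxE expfzMl -expfV.
  by rewrite big_split /= h1 prodfV g1 invr1 mulr1.
by apply/rowP => i; rewrite !mxE -mulrA mulKf.
Qed.

Lemma chart_lift_frame s w j : chart_lift s w 0 (s j) = w 0 j.
Proof.
rewrite mxE; case: pickP => [k /eqP/chart_inj ->//|/(_ j)].
by rewrite eqxx.
Qed.

Lemma chart_lift_out s w i : (forall j, s j != i) -> chart_lift s w 0 i = 1.
Proof. by move=> h; rewrite mxE; case: pickP => // k; rewrite (negPf (h k)). Qed.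

Lemma chart_cases s i : (exists j, i = s j) \/ (forall j, s j != i).
Proof.
have [/existsP [j /eqP <-]|/existsPn h] := boolP [exists j, s j == i].
  by left; exists j.
by right.
Qed.

Lemma prod_chart s (F : 'I_(nvert P) -> R[i]) : (forall i, (forall j, s j != i) -> F i = 1) ->
  \prod_i F i = \prod_j F (s j).
Proof.
move=> h; rewrite (bigID (fun i => i \in [set s j | j in 'I_n])%SET) /=.
rewrite [X in _ * X]big1 ?mulr1.
  by rewrite big_imset //= => i j _ _; exact: chart_inj.
move=> i hi; apply: h => j; apply: contraNneq hi => <-.
exact: imset_f.
Qed.

Definition torus_exp s x th : 'rV[R]_(n + n) :=
  ofC (\row_j cE (cone_coord s x 0 j) (cone_coord s th 0 j)).

Lemma torus_expE s x th j : toC (torus_exp s x th) 0 j =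
  cE (cone_coord s x 0 j) (cone_coord s th 0 j).
Proof. by rewrite ofCK mxE. Qed.

(** The monomials of the point with logarithmic coordinates [x] and [th] do not
    depend on the chart. *)
Lemma torus_exp_monomial s x th (m : 'rV[int]_n) :
  \prod_i chart_lift s (toC (torus_exp s x th)) 0 i ^ pairing m (vt i) =
  cE (pairing (realv R m) x) (pairing (realv R m) th).
Proof.
rewrite (prod_chart (s := s)); last by move=> i h; rewrite chart_lift_out// exp1rz.
under eq_bigr do rewrite chart_lift_frame torus_expE cE_exprz.
rewrite cE_sum !(pairing_cone s (realv R m)); congr cE; apply: eq_bigr => j _;
  by rewrite pairing_realv mulrC.
Qed.

(** Two lifts of the same torus point have no zero coordinate and the same
    monomials, so their quotient lies in the Cox group. *)
Lemma torus_ptE s x th : torus_pt P x th = chart_pt s (torus_exp s x th).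
Proof.
rewrite /torus_pt -/(torus_exp (some_chart P) x th).
move: (some_chart P) => s0; apply: toric_eq => /=.
pose l s := chart_lift s (toC (torus_exp s x th)).
have l0 s' i : l s' 0 i != 0.
  have [[j ->]|h] := chart_cases s' i; last by rewrite /l chart_lift_out// oner_neq0.
  by rewrite /l chart_lift_frame torus_expE cE_neq0.
rewrite -[cox_orbit (chart_lift s0 _)](cox_orbit_mul (g := \row_i (l s 0 i / l s0 0 i))).
  congr cox_orbit; apply/rowP => i.
  by rewrite mxE mxE -/(l s0) divfK.
split=> [i|m]; first by rewrite mxE mulf_neq0 ?invr_eq0.
under eq_bigr do rewrite mxE expfzMl -expfV.
by rewrite big_split /= prodfV !torus_exp_monomial mulfV// cE_neq0.
Qed.

Lemma torus_pt_chart s z : (forall j, toC z 0 j != 0) ->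
  exists x th, z = torus_exp s x th.
Proof.
move=> z0; have /choice [a /choice [t atz]] : forall j, exists a, exists t, cE a t = toC z 0 j.
  by move=> j; exact: cE_surj.
exists (\sum_j a j *: realv R (vt (s j))), (\sum_j t j *: realv R (vt (s j))).
rewrite -[LHS]toCK; congr ofC; apply/rowP => j.
by rewrite [RHS]mxE !cone_coord_sum [X in cE X _]mxE [X in cE _ X]mxE atz.
Qed.

(** The charts cover X: the Cox group can normalize the coordinates outside of a
    maximal cone, because the rays of this cone form a basis of N. *)
Lemma chart_pt_surj p : exists s z, p = chart_pt s z.
Proof.
have [z [[s sz] pE]] := coordsP p.
pose A : 'I_(nvert P) -> 'I_n -> int := fun i j =>
  (vt i *m invmx (frame_mx (@vert R n P) s)) 0 j.
have AE i : vt i = \sum_j A i j *: vt (s j).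
  rewrite -[LHS](mulmxKV (frame_unit s)); apply/rowP => k.
  rewrite mxE summxE; apply: eq_bigr => j _; rewrite [RHS]mxE; congr (_ * _).
  by rewrite mxE.
pose out i := [forall j, s j != i].
have zout i : out i -> z 0 i != 0.
  move=> /forallP h; apply/eqP => /sz [j ij]; have := h j.
  by rewrite ij eqxx.
pose gj j := \prod_(i | out i) z 0 i ^ A i j.
have gj0 j : gj j != 0.
  by apply/prodf_neq0 => i oi; rewrite expfz_neq0// zout.
pose g : Cox := \row_i (if [pick j | s j == i] is Some j then gj j else (z 0 i)^-1).
have gs j : g 0 (s j) = gj j.
  rewrite mxE; case: pickP => [k /eqP/chart_inj ->//|/(_ j)].
  by rewrite eqxx.
have go i : out i -> g 0 i = (z 0 i)^-1.
  by move=> /forallP h; rewrite mxE; case: pickP => // k; rewrite (negPf (h k)).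
have cases i : (exists j, i = s j) \/ out i.
  have [|h] := chart_cases s i; [by left|by right; apply/forallP].
have gG : cox_group g.
  split=> [i|m].
    by have [[j ->]|oi] := cases i; rewrite ?gs// go// invr_eq0 zout.
  have notout j : out (s j) = false.
    by apply/negP => /forallP /(_ j); rewrite eqxx.
  rewrite (bigID out) /=.
  have -> : \prod_(i | ~~ out i) g 0 i ^ pairing m (vt i) =
      \prod_j g 0 (s j) ^ pairing m (vt (s j)).
    rewrite big_mkcond /= (prod_chart (s := s)).
      by apply: eq_bigr => j _; rewrite notout.
    by move=> i oi; rewrite (_ : out i)//; apply/forallP.
  under [X in _ * X]eq_bigr => j _ do rewrite gs.
  have -> : \prod_j gj j ^ pairing m (vt (s j)) = \prod_(i | out i) z 0 i ^ pairing m (vt i).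
    transitivity (\prod_j \prod_(i | out i) z 0 i ^ (A i j * pairing m (vt (s j)))).
      apply: eq_bigr => j _; rewrite /gj.
      rewrite (big_morph (fun c : R[i] => c ^ pairing m (vt (s j))) (fun c c' => expfzMl c c' _) (exp1rz _ _)).
      by apply: eq_bigr => i _; rewrite exprz_exp.
    rewrite exchange_big /=; apply: eq_bigr => i oi.
    rewrite (AE i) pairing_sumr.
    rewrite (big_morph (fun k => z 0 i ^ k) (fun k k' => expfzDr k k' (zout i oi)) (expr0z _)).
    by apply: eq_bigr => j _; rewrite pairingZr.
  rewrite -big_split /= big1// => i oi.
  by rewrite -expfzMl go// mulVf ?exp1rz// zout.
exists s, (ofC (\row_j (g 0 (s j) * z 0 (s j)))); apply: toric_eq; rewrite pE /=.
rewrite -(cox_orbit_mul _ gG); congr cox_orbit; apply/rowP => i; rewrite ofCK.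
have [[j ->]|oi] := cases i; first by rewrite chart_lift_frame !mxE.
rewrite chart_lift_out; last exact/forallP.
by rewrite mxE go// mulVf// zout.
Qed.

End ToricPoints.

(** * Local potentials *)

Section ContinuousBigop.
Context {R : realType} {T : topologicalType} {I : Type}.
Implicit Types (r : seq I) (F : I -> T -> R).

Lemma continuous_sumr r F : (forall i, continuous (F i)) ->
  continuous (fun z => \sum_(i <- r) F i z).
Proof.
move=> cF; elim: r => [|i r IHr] z.
  by rewrite (_ : (fun z => _) = cst 0); [exact: cvg_cst|apply/funext => y; rewrite big_nil].
rewrite (_ : (fun z => _) = fun z => F i z + \sum_(j <- r) F j z); first exact: cvgD (cF i z) (IHr z).
by apply/funext => y; rewrite big_cons.
Qed.

Lemma continuous_prodr r F : (forall i, continuous (F i)) ->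
  continuous (fun z => \prod_(i <- r) F i z).
Proof.
move=> cF; elim: r => [|i r IHr] z.
  by rewrite (_ : (fun z => _) = cst 1); [exact: cvg_cst|apply/funext => y; rewrite big_nil].
rewrite (_ : (fun z => _) = fun z => F i z * \prod_(j <- r) F j z); first exact: cvgM (cF i z) (IHr z).
by apply/funext => y; rewrite big_cons.
Qed.

End ContinuousBigop.

Section Weights.
Context {R : realType} {n : nat} {P : fano_polytope R n}.
Local Open Scope complex_scope.
Notation Cn := 'rV[R]_(n + n).
Implicit Types (s : chart P) (z v : Cn) (x y : 'rV[R]_n) (i : Lat P) (c : Lat P -> R).

Definition lptR i : 'rV[R]_n := realv R (lpt i).

Definition kn s i j : nat := absz (kz s (lpt i) j).

Lemma knE s i j : (kn s i j)%:R = 1 - pairing (lptR i) (realv R (@vert R n P (s j))) :> R.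
Proof.
by rewrite -kzE /kn pmulrn (gez0_abs (kz_ge0 s j (lpt_lattice i))).
Qed.

Lemma kn_kz s i j : (kn s i j)%:R = (kz s (lpt i) j)%:~R :> R.
Proof. by rewrite knE kzE. Qed.

(** The squared modulus of the section attached to the lattice point [i]. *)
Definition wt s i z : R := \prod_j abs2 (toC z 0 j) ^+ kn s i j.

Lemma wt_ge0 s i z : 0 <= wt s i z.
Proof. by apply: prodr_ge0 => j _; rewrite exprn_ge0// abs2_ge0. Qed.

Lemma wt_pvert s : exists2 i, lpt i = pvert s & forall z, wt s i z = 1.
Proof.
have [i ip] := lptP (pvert_lattice s); exists i => // z.
by rewrite /wt big1// => j _; rewrite /kn ip kz_pvert.
Qed.

Lemma continuous_wt s i : continuous (wt s i).
Proof.
apply: continuous_prodr => j z.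
apply: (@continuous_comp _ _ _ (fun z : Cn => abs2 (toC z 0 j)) (fun t => t ^+ kn s i j)).
  exact: continuous_abs2_toC.
exact: exprn_continuous.
Qed.

(** With positive coefficients [c]: the local potential of a translate of
    omega_0. *)
Definition wpot c s z : R := ln (\sum_i c i * wt s i z).

Lemma sum_wt_gt0 c s z : (forall i, 0 < c i) -> 0 < \sum_i c i * wt s i z.
Proof.
move=> c0; have [i0 _ w1] := wt_pvert s; rewrite (bigD1 i0) //= w1 mulr1.
apply: ltr_pwDl => //; apply: sumr_ge0 => i _.
by rewrite mulr_ge0 ?wt_ge0// ltW.
Qed.

Lemma pot0E s z : pot0 s z = wpot (fun=> 1) s z.
Proof.
rewrite /pot0 sum_lattice; congr ln; apply: eq_bigr => i _; rewrite mul1r.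
apply: eq_bigr => j _.
by rewrite exprnP /kn (gez0_abs (kz_ge0 s j (lpt_lattice i))).
Qed.

Lemma wt_torus s i x th : wt s i (torus_exp s x th) =
  expR (pairing (lptR i) x - \sum_j cone_coord s x 0 j).
Proof.
rewrite (pairing_kz s) addrAC subrr sub0r -sumrN expR_sum; apply: eq_bigr => j _.
by rewrite torus_expE abs2_cE -expRM_natl mulrN kn_kz.
Qed.

Definition transl_coef y i : R := expR (pairing (lptR i) y).

(** Translating multiplies the section of each lattice point by a constant. *)
Lemma pot0_transl s y z : pot0 s (chart_transl s y z) =
  wpot (transl_coef y) s z - \sum_j cone_coord s y 0 j.
Proof.
rewrite pot0E /wpot.
set b := \sum_j cone_coord s y 0 j.
have -> : \sum_i 1 * wt s i (chart_transl s y z) =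
    (\sum_i transl_coef y i * wt s i z) * expR (- b).
  rewrite mulr_suml; apply: eq_bigr => i _; rewrite mul1r mulrAC -expRD.
  rewrite (pairing_kz s) -/b addrAC subrr sub0r -sumrN expR_sum -big_split /=.
  apply: eq_bigr => j _; rewrite ofCK mxE abs2M abs2_real -expRM_natl exprMn.
  have -> : 2 * (- cone_coord s y 0 j / 2) = - cone_coord s y 0 j by field.
  by rewrite -expRM_natl mulrN kn_kz.
rewrite lnM ?posrE ?expR_gt0// ?expRK//.
by apply: sum_wt_gt0 => i; exact: expR_gt0.
Qed.

Lemma continuous_wpot c s : (forall i, 0 < c i) -> continuous (wpot c s).
Proof.
move=> c0 z.
have cF i : continuous (fun z => c i * wt s i z).
  by move=> z1; exact: cvgM (cvg_cst (c i)) (@continuous_wt s i z1).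
apply: (@continuous_comp _ _ _ (fun z => \sum_i c i * wt s i z) (@ln R)).
  by apply: continuous_sumr; exact: cF.
by apply: continuous_ln; exact: sum_wt_gt0.
Qed.

(** On a real line the potential is the logarithm of a positive polynomial. *)
Lemma wpot_line c s z v : (forall i, 0 < c i) -> exists2 Q : {poly R},
  (forall t, 0 < Q.[t]) & forall t, wpot c s (z + t *: v) = ln Q.[t].
Proof.
move=> c0.
pose l (k : 'I_(n + n)) : {poly R} := (z 0 k)%:P + v 0 k *: 'X.
pose Q : {poly R} := \sum_i c i *:
  \prod_j (l (lshift n j) ^+ 2 + l (rshift n j) ^+ 2) ^+ kn s i j.
have lE k t : (l k).[t] = (z + t *: v) 0 k.
  by rewrite !hornerE !mxE mulrC.
have QE t : Q.[t] = \sum_i c i * wt s i (z + t *: v).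
  rewrite horner_sum; apply: eq_bigr => i _; rewrite hornerZ; congr (_ * _).
  rewrite horner_prod; apply: eq_bigr => j _.
  by rewrite horner_exp hornerD !horner_exp !lE abs2_toC.
by exists Q => t; rewrite QE//; exact: sum_wt_gt0.
Qed.

End Weights.

Section TwiceDerivable.
Context {R : realType} {m : nat}.
Notation V := 'rV[R]_m.
Implicit Types (f g : V -> R) (v : V).

(** Liouville's theorem takes two derivatives along each coordinate line and no
    mixed ones. *)
Definition twice v f := (forall z, derivable f z v) /\
  (forall z, derivable (fun z => 'D_v f z) z v).

Definition D2 v f z := 'D_v (fun z => 'D_v f z) z.

Lemma twice_smooth f k : smooth_on setT f -> twice (delta_mx 0 k) f.
Proof.
move=> sf; split=> z.
  by have [_ ] := sf [::] z I; exact.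
by have [_ ] := sf [:: k] z I; exact.
Qed.

Lemma twiceB v f g : twice v f -> twice v g ->
  twice v (fun z => f z - g z) /\ D2 v (fun z => f z - g z) = fun z => D2 v f z - D2 v g z.
Proof.
move=> [df d2f] [dg d2g].
have E : (fun z => 'D_v (fun z => f z - g z) z) = (fun z => 'D_v f z) - (fun z => 'D_v g z).
  by apply/funext => z; rewrite (_ : (fun z => f z - g z) = f - g)// deriveB.
split; first split => z; rewrite ?E; first exact: derivableB.
  exact: derivableB.
by apply/funext => z; rewrite /D2 E deriveB.
Qed.

Lemma twiceD v f g : twice v f -> twice v g -> twice v (fun z => f z + g z).
Proof.
move=> [df d2f] [dg d2g].
have E : (fun z => 'D_v (fun z => f z + g z) z) = (fun z => 'D_v f z) + (fun z => 'D_v g z).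
  by apply/funext => z; rewrite (_ : (fun z => f z + g z) = f + g)// deriveD.
split=> z; rewrite ?E; first exact: derivableD.
exact: derivableD.
Qed.

Lemma is_derive_ln_poly (Q : {poly R}) t : 0 < Q.[t] ->
  is_derive t (1 : R) (fun t => ln Q.[t]) (Q^`().[t] / Q.[t]).
Proof.
move=> Q0; have := is_derive1_comp (g := horner Q) (is_derive1_ln Q0) (is_derive_poly Q t).
by rewrite mulrC.
Qed.

Lemma is_derive2_ln_poly (Q : {poly R}) t : 0 < Q.[t] ->
  is_derive t (1 : R) (fun t => Q^`().[t] / Q.[t])
    ((Q^`(2).[t] * Q.[t] - Q^`().[t] ^+ 2) / Q.[t] ^+ 2).
Proof.
move=> Q0; have Q0' : Q.[t] != 0 by rewrite gt_eqF.
have := is_deriveM (is_derive_poly Q^`() t) (is_deriveV (f := horner Q) Q0' (is_derive_poly Q t)).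
move=> h; apply: (is_derive_congr h) => [u //|]; rewrite /GRing.scale /=.
by change (Q^`(2)) with (Q^`()^`()); field.
Qed.

(** Derivatives along [v] of a function which is the logarithm of a polynomial on
    the line through [z]. *)
Lemma derive_ln_poly_line f z v (Q : {poly R}) : (forall t, 0 < Q.[t]) ->
  (forall t, f (z + t *: v) = ln Q.[t]) ->
  [/\ derivable f z v, derivable (fun z => 'D_v f z) z v &
      D2 v f z = (Q^`(2).[0] * Q.[0] - Q^`().[0] ^+ 2) / Q.[0] ^+ 2].
Proof.
move=> Q0 fQ.
have d1 t : is_derive (z + t *: v) v f (Q^`().[t] / Q.[t]).
  apply/is_derive_line; rewrite (_ : (fun t => _) = fun t => ln Q.[t]).
    exact: is_derive_ln_poly.
  by apply/funext.
have d2 : is_derive z v (fun z => 'D_v f z)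
    ((Q^`(2).[0] * Q.[0] - Q^`().[0] ^+ 2) / Q.[0] ^+ 2).
  apply/is_derive_line0; rewrite (_ : (fun t => _) = fun t => Q^`().[t] / Q.[t]).
    exact: is_derive2_ln_poly.
  by apply/funext => t; have [_ ->] := d1 t.
have := d1 0; rewrite scale0r addr0 => -[h1 _].
by have [h2 h3] := d2; split.
Qed.

End TwiceDerivable.

Section Laplacian.
Context {R : realType} {n : nat} {P : fano_polytope R n}.
Local Open Scope complex_scope.
Notation Cn := 'rV[R]_(n + n).
Notation dx j := (delta_mx 0 (lshift n j) : Cn).
Notation dy j := (delta_mx 0 (rshift n j) : Cn).

(** The diagonal coefficients of d dbar f are a quarter of the Laplacians along
    the coordinates. *)
Lemma Re_ddbar (f : Cn -> R) j z : twice (dx j) f -> twice (dy j) f ->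
  complex.Re (ddbar f z j j) = (D2 (dx j) f z + D2 (dy j) f z) / 4.
Proof.
move=> [fx fxx] [fy fyy].
have aux (a b u w : R) : (a / 2 - (0 * u - 1 * (b / 2))) *
    ((1 + 1) / ((1 + 1) ^+ 2 + (0 + 0) ^+ 2)) - (w - (0 * (b / 2) + 1 * u)) *
    - ((0 + 0) / ((1 + 1) ^+ 2 + (0 + 0) ^+ 2)) = (a + b) / 4.
  have -> : (1 + 1) ^+ 2 + (0 + 0) ^+ 2 = 4 :> R by ring.
  by field.
have half (a b : R) : (a +i* b) / 2%:R = (a / 2) +i* (b / 2).
  apply: (canLR (mulfK _)); first by rewrite pnatr_eq0.
  rewrite -[2%:R in RHS]/(1 + 1) mulrDr mulr1; apply/eqP; rewrite eq_complex /=.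
  by apply/andP; split; apply/eqP; field.
have c0 v (y : Cn) : 'D_v (fun=> 0 : R) y = 0 by exact: derive_cst.
have dzbE y : dzb j (fun y => (f y)%:C) y = ('D_(dx j) f y / 2) +i* ('D_(dy j) f y / 2).
  rewrite /dzb /cderiv /= !c0 -half; congr (_ / _); apply/eqP; rewrite eq_complex /=.
  by apply/andP; split; apply/eqP; ring.
rewrite mxE (_ : dzb j _ = fun y => ('D_(dx j) f y / 2) +i* ('D_(dy j) f y / 2)); last first.
  by apply/funext => y.
rewrite /dz /cderiv /=.
have D2E (v : Cn) : derivable (fun z => 'D_v f z) z v -> 'D_v (fun y => 'D_v f y / 2) z = D2 v f z / 2.
  move=> dv; rewrite (_ : (fun y => _) = (2^-1 : R) \*: (fun z => 'D_v f z)).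
    by rewrite deriveZ// /D2 /GRing.scale /= mulrC.
  by apply/funext => y /=; rewrite mulrC.
by rewrite !D2E//; exact: aux.
Qed.

Lemma twice_wpot c (s : chart P) v : (forall i, 0 < c i) -> twice v (wpot c s).
Proof.
by move=> c0; split=> z; have [Q Q0 QE] := wpot_line s z v c0;
  have [] := derive_ln_poly_line Q0 QE.
Qed.

Lemma const_coordinates (G : Cn -> R) :
  (forall j z a b, G (z + a *: dx j + b *: dy j) = G z) -> forall z z', G z = G z'.
Proof.
move=> Gj z z'.
suff h k : (k <= n)%N -> forall z : Cn, (forall j : 'I_n, (k <= j)%N ->
    z 0 (lshift n j) = z' 0 (lshift n j) /\ z 0 (rshift n j) = z' 0 (rshift n j)) -> G z = G z'.
  by apply: (h n) => // j; rewrite leqNgt ltn_ord.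
elim: k => [_ {}z hz|k IHk kn {}z hz].
  by congr G; apply/rowP => l; rewrite -(splitK l); case: (fintype.split l) => j;
    have [] := hz j (leq0n _).
pose j := Ordinal kn.
rewrite -(Gj j z (z' 0 (lshift n j) - z 0 (lshift n j)) (z' 0 (rshift n j) - z 0 (rshift n j))).
apply: IHk; first exact: ltnW.
move=> i; rewrite leq_eqVlt => /orP [/eqP ki|ki].
  have -> : i = j by apply: val_inj.
  by rewrite !mxE !eqxx eq_lrshift eq_rlshift /= !(mulr1, mulr0, addr0) addrC subrK addrC subrK.
have ij : i == j = false by apply/negbTE; rewrite -val_eqE /= gtn_eqF.
have [h1 h2] := hz i ki.
by rewrite !mxE !eqxx eq_lrshift eq_rlshift eq_lshift eq_rshift ij /= !(mulr0, addr0).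
Qed.

(** Two potentials of the same form differ by a constant, when the difference is
    bounded above: pluriharmonic functions on C^n satisfy Liouville's theorem. *)
Lemma ddbar_liouville (A B : Cn -> R) (M : R) :
  (forall k, twice (delta_mx 0 k) A) -> (forall k, twice (delta_mx 0 k) B) ->
  continuous A -> continuous B ->
  (forall z, ddbar A z = ddbar B z) -> (forall z, A z - B z <= M) ->
  forall z z', A z - B z = A z' - B z'.
Proof.
move=> tA tB cA cB AB ABM.
pose G z := A z - B z.
have tG k := (twiceB (tA k) (tB k)).1.
have lap j z : D2 (dx j) G z + D2 (dy j) G z = 0.
  rewrite (twiceB (tA _) (tB _)).2 (twiceB (tA _) (tB _)).2.
  have aux (a b c d : R) : (a + b) / 4 = (c + d) / 4 -> a - c + (b - d) = 0 by lra.
  have hA := Re_ddbar z (tA (lshift n j)) (tA (rshift n j)).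
  have hB := Re_ddbar z (tB (lshift n j)) (tB (rshift n j)).
  have AB' : complex.Re (ddbar A z j j) = complex.Re (ddbar B z j j) by rewrite AB.
  exact: (aux _ _ _ _ (etrans (esym hA) (etrans AB' hB))).
have cG : continuous G by move=> z; exact: cvgB (cA z) (cB z).
apply: (const_coordinates (G := G)) => j z a b.
pose e a b := z + a *: dx j + b *: dy j.
have eE x y : e x y = z + y *: dy j + x *: dx j by rewrite /e addrAC.
have ex x y : e x y = e 0 y + x *: dx j by rewrite !eE scale0r addr0.
have ey x y : e x y = e x 0 + y *: dy j by rewrite /e scale0r addr0.
have ce : continuous (fun u : R * R => G (e u.1 u.2)).
  move=> u; apply: (@continuous_comp _ _ _ (fun u : R * R => e u.1 u.2) G); last exact: cG.
  apply: cvgD; [apply: cvgD; [exact: cvg_cst|]|].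
    by apply: cvgZr_tmp; exact: cvg_fst.
  by apply: cvgZr_tmp; exact: cvg_snd.
have dline (f : Cn -> R) w v t : derivable f (w + t *: v) v ->
    is_derive t (1 : R) (fun t => f (w + t *: v)) ('D_v f (w + t *: v)).
  by move=> df; apply/is_derive_line; exact/derivableP.
have pl := @plane_liouville R (fun x y => G (e x y)) (fun x y => 'D_(dx j) G (e x y))
  (fun x y => D2 (dx j) G (e x y)) (fun x y => 'D_(dy j) G (e x y))
  (fun x y => D2 (dy j) G (e x y)) M ce.
have <- : G (e 0 0) = G z by rewrite /e !scale0r !addr0.
apply: (pl _ _ _ _ _ _ a b 0 0).
- move=> x y; apply: (is_derive_congr (dline G (e 0 y) (dx j) x ((tG _).1 _))) => [t|];
    by rewrite -ex.
- move=> x y.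
  apply: (is_derive_congr (dline (fun w => 'D_(dx j) G w) (e 0 y) (dx j) x ((tG _).2 _))) => [t|];
    by rewrite -ex.
- move=> x y; apply: (is_derive_congr (dline G (e x 0) (dy j) y ((tG _).1 _))) => [t|];
    by rewrite -ey.
- move=> x y.
  apply: (is_derive_congr (dline (fun w => 'D_(dy j) G w) (e x 0) (dy j) y ((tG _).2 _))) => [t|];
    by rewrite -ey.
- by move=> x y; exact: lap.
- by move=> x y; exact: ABM.
Qed.

End Laplacian.

(** * Moment map and normalized potentials *)

Section MomentMap.
Context {R : realType} {n : nat} {P : fano_polytope R n}.
Local Open Scope complex_scope.
Notation Cn := 'rV[R]_(n + n).
Notation p_ := (@lptR R n P).
Implicit Types (s : chart P) (z : Cn) (x y : 'rV[R]_n) (i : Lat P).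

Lemma some_lat : exists i : Lat P, True.
Proof. by have [i _] := wt_pvert (some_chart P); exists i. Qed.

Lemma u0E x : u0 P x = ln (Zexp p_ x).
Proof. by rewrite /u0 sum_lattice. Qed.

Lemma grad0E x j : grad0 P x 0 j = \sum_i wexp p_ x i * p_ i 0 j.
Proof.
have [i0 _] := some_lat; rewrite mxE (_ : u0 P = fun x => ln (Zexp p_ x)).
  by have h := is_derive_ln_Zexp p_ i0 x j; rewrite derive_val.
by apply/funext => w; exact: u0E.
Qed.

Lemma hess0E x : hess0 P x = cov_mx (wexp p_ x) p_.
Proof.
have [i0 _] := some_lat; rewrite -(hess_ln_Zexp p_ i0) /hess0.
by rewrite (_ : u0 P = fun x => ln (Zexp p_ x))//; apply/funext => w; exact: u0E.
Qed.

Lemma sum_wt_torus s x th (F : Lat P -> R) :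
  \sum_i F i * wt s i (torus_exp s x th) =
  expR (- \sum_j cone_coord s x 0 j) * \sum_i F i * expR (pairing (p_ i) x).
Proof.
rewrite mulr_sumr; apply: eq_bigr => i _.
by rewrite wt_torus expRD mulrA mulrC.
Qed.

(** The formula holds on the torus by the definition of the gradient, and torus
    points are dense in every chart. *)
Lemma moment_map_chart mu : moment_map mu -> forall s z j,
  mu (chart_pt s z) 0 j = (\sum_i wt s i z * p_ i 0 j) / \sum_i wt s i z.
Proof.
move=> [cmu mugrad] s z j.
pose g z := (\sum_i wt s i z * p_ i 0 j) / \sum_i wt s i z.
have Z0 w : 0 < \sum_i wt s i w.
  have := sum_wt_gt0 (c := fun=> 1) s w (fun=> ltr01).
  by under eq_bigr do rewrite mul1r.
have torusE w : (forall k, toC w 0 k != 0) -> mu (chart_pt s w) 0 j = g w.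
  move=> w0; have [x [th ->]] := torus_pt_chart s w0; rewrite -torus_ptE mugrad grad0E /g.
  have -> : \sum_i wt s i (torus_exp s x th) * p_ i 0 j =
      \sum_i p_ i 0 j * wt s i (torus_exp s x th).
    by apply: eq_bigr => i _; rewrite mulrC.
  have -> : \sum_i wt s i (torus_exp s x th) = \sum_i 1 * wt s i (torus_exp s x th).
    by apply: eq_bigr => i _; rewrite mul1r.
  rewrite !sum_wt_torus -mulf_div mulfV ?gt_eqF ?expR_gt0// mul1r mulr_suml.
  by apply: eq_bigr => i _; rewrite /wexp /Zexp; under [in RHS]eq_bigr do rewrite mul1r; ring.
have cg : continuous g.
  have cn : continuous (fun z : Cn => \sum_i wt s i z * p_ i 0 j).
    apply: continuous_sumr => i w.
    exact: cvgM (@continuous_wt R n P s i w) (cvg_cst _).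
  have cd : continuous (fun z : Cn => \sum_i wt s i z).
    by apply: continuous_sumr => i; exact: continuous_wt.
  move=> w; have Zw : \sum_i wt s i w != 0 by rewrite gt_eqF.
  exact: cvgM (cn w) (cvgV Zw (cd w)).
pose b : Cn := row_mx (\row_k (toC z 0 k == 0)%:R) 0.
pose l (e : R) := z + e *: b.
have cl : l e @[e --> 0^'+] --> z.
  rewrite -[X in _ --> X]addr0; apply: cvgD; first exact: cvg_cst.
  rewrite -[X in _ --> X](scale0r b); apply: cvgZr_tmp.
  exact: cvg_within.
have cm : mu (chart_pt s (l e)) 0 j @[e --> 0^'+] --> mu (chart_pt s z) 0 j.
  have cmj : continuous (fun z => mu (chart_pt s z) 0 j).
    move=> w; apply: (@continuous_comp _ _ _ (fun z => mu (chart_pt s z)) (fun M : 'rV[R]_n => M 0 j)).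
      exact: cmu.
    exact: coord_continuous.
  exact: cvg_comp cl (cmj z).
have cg' : g (l e) @[e --> 0^'+] --> g z by exact: cvg_comp cl (cg z).
apply: (cvg_unique (@Rhausdorff R) cm); apply: cvg_trans cg'.
apply: near_eq_cvg; near=> e; symmetry; apply: torusE => k.
have e0 : 0 < e by near: e; exact: nbhs_right_gt.
have bl : b 0 (lshift n k) = (toC z 0 k == 0)%:R by rewrite row_mxEl mxE.
have br : b 0 (rshift n k) = 0 by rewrite row_mxEr mxE.
have lE m : l e 0 m = z 0 m + e * b 0 m by rewrite /l mxE [X in _ + X]mxE.
rewrite -abs2_eq0 abs2_toC !lE bl br.
case: (eqVneq (toC z 0 k) 0) => zk.
  have : abs2 (toC z 0 k) = 0 by rewrite zk /abs2 /= expr0n addr0.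
  rewrite abs2_toC => h; have := sqr_ge0 (z 0 (lshift n k)); have := sqr_ge0 (z 0 (rshift n k)).
  move=> h1 h2; have h3 : z 0 (lshift n k) = 0 by apply/eqP; rewrite -sqrf_eq0; apply/eqP; lra.
  by rewrite h3 mulr1 add0r mulr0 addr0 paddr_eq0 ?sqr_ge0// !sqrf_eq0 (gt_eqF e0).
by rewrite !mulr0 !addr0 -abs2_toC abs2_eq0.
Unshelve. all: by end_near. Qed.

End MomentMap.

Section Adjacency.
Context {R : realType} {n : nat} {P : fano_polytope R n}.
Local Open Scope complex_scope.
Notation Cn := 'rV[R]_(n + n).
Implicit Types (s : chart P) (z v : Cn).

Lemma posdef_diag (g : 'M[R[i]]_n) j : posdef g -> 0 < complex.Re (g j j).
Proof.
move=> /(_ (delta_mx 0 j)); rewrite (_ : _ != 0); last first.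
  by apply/eqP => /rowP /(_ j) /eqP; rewrite !mxE !eqxx oner_eq0.
move=> /(_ isT); rewrite (bigD1 j) //= [X in _ + X]big1 ?addr0; last first.
  move=> k /negPf kj; rewrite big1// => l _.
  by rewrite mxE eqxx kj !mul0r.
rewrite (bigD1 j) //= big1 ?addr0; last first.
  move=> k /negPf kj; rewrite [X in _ * conjc X]mxE eqxx kj /=.
  by rewrite /conjc /= oppr0 mulr0.
rewrite !mxE !eqxx /= mul1r.
by case: (g j j) => a b; rewrite ltcE /= => /andP[_]; rewrite !mulr1 oppr0 mulr0 subr0.
Qed.

(** Along a coordinate axis through the origin the potential is the logarithm of
    a polynomial in t^2, whose coefficient of t^2 counts the sections that vanish
    to first order along this axis only. *)
Lemma D2_wpot_0 s j v : (forall l t, abs2 (toC (0 + t *: v) 0 l) = (l == j)%:R * t ^+ 2) ->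
  (forall i : Lat P, ~ forall k, kn s i k = (k == j)) ->
  D2 v (wpot (fun=> 1) s) 0 = 0.
Proof.
move=> vj nadj.
pose off (i : Lat P) := [forall l, (l != j) ==> (kn s i l == 0%N)].
pose Q : {poly R} := \sum_(i | off i) 'X^(2 * kn s i j).
have QE t : \sum_i 1 * wt s i (0 + t *: v) = Q.[t].
  rewrite horner_sum [RHS]big_mkcond; apply: eq_bigr => i _; rewrite mul1r /wt.
  case: ifPn => [/forallP oi|].
    rewrite (bigD1 j) //= big1 ?mulr1.
      by rewrite vj eqxx mul1r hornerXn exprM.
    by move=> l lj; have := oi l; rewrite lj => /eqP ->.
  rewrite negb_forall => /existsP [l]; rewrite negb_imply => /andP[lj kl].
  by rewrite (bigD1 l) //= vj (negPf lj) mul0r expr0n (negPf kl) mul0r.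
have Q0 t : 0 < Q.[t] by rewrite -QE; exact: sum_wt_gt0.
have [_ _ ->] := derive_ln_poly_line (f := wpot (fun=> 1) s) (z := 0) (v := v) Q0
  (fun t => congr1 (@ln R) (QE t)).
have -> : Q^`().[0] = 0.
  rewrite horner_coef0 coef_deriv coef_sum big1 ?mul0rn// => i _.
  by rewrite coefXn; case: eqP => // /(congr1 odd); rewrite oddM.
have -> : Q^`(2).[0] = 0.
  rewrite horner_coef0 coef_derivn coef_sum big1 ?mul0rn// => i /forallP oi.
  rewrite coefXn addn0; case: eqP => // h2; case: (nadj i) => k.
  have k1 : kn s i j = 1%N by lia.
  by case: (eqVneq k j) => [->//|kj]; have := oi k; rewrite kj => /eqP.
by rewrite !mul0r expr0n subr0 mul0r.
Qed.

(** At the fixed point of a chart, omega_0 is nondegenerate in the direction of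
    the j-th coordinate only if some section vanishes there to first order along
    this coordinate: the edge of P^* in this direction has a lattice point at
    distance one from the vertex. *)
Lemma adjacent_lattice_point s j : posdef (ddbar (pot0 s) 0) ->
  exists i : Lat P, forall k, kn s i k = (k == j).
Proof.
move=> /(posdef_diag j) pos; apply: contrapT => /forallNP nadj.
have E : pot0 s = wpot (fun=> 1) s by apply/funext => z; exact: pot0E.
have tw v : twice v (wpot (fun=> (1:R)) s) by apply: twice_wpot => i; exact: ltr01.
move: pos; rewrite E (Re_ddbar _ (tw _) (tw _)).
rewrite (D2_wpot_0 (j := j)) ?(D2_wpot_0 (j := j)) ?addr0 ?mul0r ?ltxx//.
- move=> l t; rewrite abs2_toC !mxE !eqxx eq_rshift eq_lrshift /=.
  by rewrite !add0r mulr0 expr0n add0r; case: (l == j); rewrite ?mulr1 ?mul1r ?mulr0 ?expr0n ?mul0r.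
- move=> l t; rewrite abs2_toC !mxE !eqxx eq_lshift eq_rlshift /=.
  by rewrite !add0r mulr0 expr0n addr0; case: (l == j); rewrite ?mulr1 ?mul1r ?mulr0 ?expr0n ?mul0r.
Qed.

End Adjacency.

(** * The potentials of the pulled back metrics *)

Section Gap.
Context {R : realType} {I : finType}.

Lemma finite_max_gap (a : I -> R) (k : I) : exists2 i0, forall i, a i <= a i0 &
  exists2 g : R, 0 < g & forall i, a i = a i0 \/ a i <= a i0 - g.
Proof.
case: (@arg_maxP _ _ _ k xpredT a isT) => i0 _ i0max'; have i0max i : a i <= a i0 := i0max' i isT.
exists i0 => //.
have [/existsP [i1 i1lt]|/existsPn h] := boolP [exists i, a i < a i0]; last first.
  by exists 1 => // i; left; apply/eqP; rewrite eq_le i0max//= leNgt h.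
case: (@arg_maxP _ _ _ i1 (fun i => a i < a i0) a i1lt) => i2 i2lt i2max.
exists (a i0 - a i2) => [|i]; first by rewrite subr_gt0.
have [lti|gei] := ltP (a i) (a i0); last by left; apply/eqP; rewrite eq_le gei i0max.
by right; have := i2max i lti; rewrite /= => h; lra.
Qed.

End Gap.

Lemma smooth_continuous (R : realType) m (f : 'rV[R]_m -> R) :
  smooth_on setT f -> continuous f.
Proof. by move=> sf z; have [] := sf [::] z I. Qed.

Lemma twice_cst (R : realType) m (v : 'rV[R]_m) (b : R) : twice v (fun=> b).
Proof.
have E : (fun z : 'rV[R]_m => 'D_v (fun=> b) z) = cst 0.
  by apply/funext => z; exact: derive_cst.
by split=> z; rewrite ?E; exact: derivable_cst.
Qed.

Section PulledPotential.
Context {R : realType} {n : nat} {P : fano_polytope R n}.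
Local Open Scope complex_scope.
Notation Cn := 'rV[R]_(n + n).
Notation p_ := (@lptR R n P).
Implicit Types (s : chart P) (z : Cn) (x y : 'rV[R]_n) (i : Lat P).
Variables (f : toric P -> R) (y : 'rV[R]_n).
Hypothesis sf : xsmooth f.
Hypothesis ddf : forall s z,
  ddbar (fun z => pot0 s (chart_transl s y z)) z = ddbar (pot f s) z.
Hypothesis supf : ereal_sup [set (f p)%:E | p in setT] = 0%E.

Lemma pulled_le0 p : f p <= 0.
Proof.
have : ((f p)%:E <= ereal_sup [set (f p)%:E | p in setT])%E.
  by apply: ereal_sup_ubound; exists p.
by rewrite supf lee_fin.
Qed.

Let one_gt0 (i : Lat P) : (0 : R) < (fun=> 1) i. Proof. exact: ltr01. Qed.
Let tc_gt0 (i : Lat P) : 0 < transl_coef y i. Proof. exact: expR_gt0. Qed.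

Lemma wpot_le (c c' : Lat P -> R) (K : R) s z : (forall i, 0 < c i) -> (forall i, 0 < c' i) ->
  (forall i, c i <= expR K * c' i) -> wpot c s z <= K + wpot c' s z.
Proof.
move=> c0 c'0 cc; rewrite -[X in _ <= X + _](expRK K) -lnM ?posrE ?expR_gt0 ?sum_wt_gt0//.
rewrite ler_ln ?posrE ?mulr_gt0 ?expR_gt0 ?sum_wt_gt0// mulr_sumr; apply: ler_sum => i _.
by rewrite mulrA ler_wpM2r ?wt_ge0.
Qed.

(** In every chart the potential is explicit up to a constant, because the
    difference is pluriharmonic and bounded above on C^n; the constant is the
    same in all the charts since they share the torus. *)
Lemma pulled_potential_chart : exists C : R, forall s z,
  f (chart_pt s z) = wpot (transl_coef y) s z - wpot (fun=> 1) s z + C.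
Proof.
have [i0 _] := some_lat (P := P).
pose K := \sum_i `|pairing (p_ i) y|.
have Ki i : - K <= pairing (p_ i) y.
  rewrite /K (bigD1 i) //= opprD; have := ler_normr (- pairing (p_ i) y) (pairing (p_ i) y).
  have := normr_ge0 (pairing (p_ i) y); have := ler_norm (- pairing (p_ i) y).
  have : 0 <= \sum_(j | j != i) `|pairing (p_ j) y| by exact: sumr_ge0.
  by rewrite normrN; lra.
have const s z z' : f (chart_pt s z) - (wpot (transl_coef y) s z - wpot (fun=> 1) s z) =
    f (chart_pt s z') - (wpot (transl_coef y) s z' - wpot (fun=> 1) s z').
  pose b := \sum_j cone_coord s y 0 j.
  have BE : (fun z => pot0 s (chart_transl s y z)) = fun z => wpot (transl_coef y) s z - b.
    by apply/funext => w; exact: pot0_transl.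
  have AE : pot f s = fun z => wpot (fun=> 1) s z + f (chart_pt s z).
    by apply/funext => w; rewrite /pot pot0E.
  have tA k : twice (delta_mx 0 k) (pot f s).
    by rewrite AE; apply: twiceD; [exact: twice_wpot|exact: twice_smooth (sf s)].
  have tB k : twice (delta_mx 0 k) (fun z => pot0 s (chart_transl s y z)).
    by rewrite BE; exact: (twiceB (twice_wpot s _ tc_gt0) (twice_cst _ _)).1.
  have cA : continuous (pot f s).
    rewrite AE => w; apply: (cvgD (continuous_wpot one_gt0 (s := s) (x := w))).
    exact: (smooth_continuous (sf s) (x := w)).
  have cB : continuous (fun z => pot0 s (chart_transl s y z)).
    by rewrite BE => w; exact: cvgB (continuous_wpot tc_gt0 (s := s) (x := w)) (cvg_cst _).
  have := ddbar_liouville (M := K + b) tA tB cA cB (fun z => esym (ddf s z)).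
  rewrite AE; move=> /(_ _ z z'); rewrite !pot0_transl -/b => h.
  have/h : forall w, wpot (fun=> 1) s w + f (chart_pt s w) -
      pot0 s (chart_transl s y w) <= K + b.
    move=> w; rewrite pot0_transl -/b.
    have := @wpot_le (fun=> 1) (transl_coef y) K s w one_gt0 tc_gt0.
    have hK i : 1 <= expR K * transl_coef y i.
      by rewrite /transl_coef -expRD -[leLHS]expR0 ler_expR; have := Ki i; lra.
    by move=> /(_ hK); have := pulled_le0 (chart_pt s w); lra.
  by lra.
pose t0 s := torus_exp s 0 0.
have t0E s (c : Lat P -> R) : (forall i, 0 < c i) -> wpot c s (t0 s) = ln (\sum_i c i).
  move=> c0; congr ln; apply: eq_bigr => i _.
  rewrite wt_torus pairing0r big1 ?subrr ?expR0 ?mulr1//.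
  by move=> j _; rewrite /cone_coord mul0mx mxE.
exists (f (torus_pt P 0 0) - (ln (\sum_(i : Lat P) transl_coef y i) - ln (\sum_(i : Lat P) 1))) => s z.
have := const s z (t0 s); rewrite !t0E// -torus_ptE; lra.
Qed.

(** The normalization [sup f = 0] gives the constant: the supremum is approached
    along the ray of direction [y]. *)
Lemma pulled_potential_torus i0 : (forall i, pairing (p_ i) y <= pairing (p_ i0) y) ->
  forall x th, f (torus_pt P x th) =
    ln ((\sum_i expR (pairing (p_ i) x + (pairing (p_ i) y - pairing (p_ i0) y))) / Zexp p_ x).
Proof.
move=> i0max; set m := pairing (p_ i0) y.
have [C fC] := pulled_potential_chart.
have tE s x th (c : Lat P -> R) : (forall i, 0 < c i) -> wpot c s (torus_exp s x th) =
    ln (\sum_i c i * expR (pairing (p_ i) x)) - \sum_j cone_coord s x 0 j.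
  move=> c0; rewrite /wpot sum_wt_torus lnM ?posrE ?expR_gt0//.
    by rewrite expRK addrC.
  rewrite (bigD1 i0) //=; apply: ltr_pwDl; first by rewrite mulr_gt0 ?expR_gt0.
  by apply: sumr_ge0 => i _; rewrite mulr_ge0 ?expR_ge0 ?ltW.
have Z0 x : 0 < Zexp p_ x by exact: (Zexp_gt0 p_ i0 x).
pose S x := \sum_i transl_coef y i * expR (pairing (p_ i) x).
have S0 x : 0 < S x.
  rewrite /S (bigD1 i0) //=; apply: ltr_pwDl; first by rewrite mulr_gt0 ?expR_gt0.
  by apply: sumr_ge0 => i _; rewrite mulr_ge0 ?expR_ge0.
have fE x th : f (torus_pt P x th) = ln (S x) - ln (Zexp p_ x) + C.
  rewrite (torus_ptE (some_chart P)) fC !tE// -/(S x).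
  have -> : \sum_i 1 * expR (pairing (p_ i) x) = Zexp p_ x.
    by apply: eq_bigr => i _; rewrite mul1r.
  by lra.
have Cm : C = - m.
  apply/eqP; rewrite eq_le; apply/andP; split; last first.
    have : (0 <= (m + C)%:E)%E.
      rewrite -[leLHS]supf; apply: ub_ereal_sup => _ [p _ <-]; rewrite lee_fin.
      have [s [z ->]] := chart_pt_surj p; rewrite fC.
      have := @wpot_le (transl_coef y) (fun=> 1) m s z tc_gt0 one_gt0.
      have hm i : transl_coef y i <= expR m * 1 by rewrite mulr1 ler_expR; exact: i0max.
      by move=> /(_ hm); lra.
    by rewrite lee_fin; lra.
  rewrite leNgt; apply/negP => mC.
  have [i1 i1max [g g0 gP]] := finite_max_gap (fun i => pairing (p_ i) y) i0.
  have i10 : pairing (p_ i1) y = m by apply/eqP; rewrite eq_le i0max i1max.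
  rewrite i10 in gP.
  pose N : R := #|Lat P|%:R.
  have ray t : 0 < t -> expR m <= (1 + N * expR (- (g * t))) * (S (t *: y) / Zexp p_ (t *: y)).
    move=> t0; rewrite mulrA ler_pdivlMr//.
    pose T := \sum_(i | pairing (p_ i) y == m) expR (pairing (p_ i) (t *: y)).
    have T0 : expR (t * m) <= T.
      rewrite /T (bigD1 i0) //= pairingZr -/m lerDl.
      by apply: sumr_ge0 => i _; exact: expR_ge0.
    have ZT : Zexp p_ (t *: y) <= T * (1 + N * expR (- (g * t))).
      rewrite /Zexp (bigID (fun i => pairing (p_ i) y == m)) /= -/T mulrDr mulr1 lerD2l.
      apply: (@le_trans _ _ (\sum_(i : Lat P) expR (t * m) * expR (- (g * t)))).
        rewrite [leLHS]big_mkcond /=; apply: ler_sum => i _; case: ifPn => [im|_]; last first.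
          by rewrite mulr_ge0 ?expR_ge0.
        rewrite -expRD ler_expR pairingZr; have [/eqP|] := gP i; first by rewrite (negPf im).
        by move=> h; nra.
      rewrite sumr_const -mulr_natl -/N mulrCA ler_wpM2r//.
      by rewrite mulr_ge0 ?expR_ge0 ?ler0n.
    have ST : expR m * T <= S (t *: y).
      rewrite /T /S mulr_sumr big_mkcond /=; apply: ler_sum => i _; case: ifPn => [/eqP im|_].
        by rewrite /transl_coef im.
      by rewrite mulr_ge0 ?expR_ge0.
    apply: (@le_trans _ _ (expR m * (T * (1 + N * expR (- (g * t)))))).
      by rewrite ler_wpM2l ?expR_ge0.
    by rewrite mulrA [leRHS]mulrC ler_wpM2r// addr_ge0// mulr_ge0 ?expR_ge0 ?ler0n.
  have N0 : 0 < N by rewrite ltr0n; apply/card_gt0P; exists i0.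
  pose e := m + C; have e0 : 0 < e by rewrite /e; lra.
  (* far enough along the ray for the error term to be at most e / 2 *)
  pose t := Num.max 1 (- ln (e / (2 * N)) / g).
  have t0 : 0 < t by rewrite lt_max ltr01.
  have tN : N * expR (- (g * t)) <= e / 2.
    have h : expR (- (g * t)) <= e / (2 * N).
      rewrite -[leRHS]lnK ?posrE ?divr_gt0 ?mulr_gt0// ler_expR lerNl.
      by rewrite [g * t]mulrC -ler_pdivrMr// /t le_max lexx orbT.
    have -> : e / 2 = N * (e / (2 * N)) by field; rewrite gt_eqF.
    by rewrite ler_wpM2l// ltW.
  have r0 : 0 < S (t *: y) / Zexp p_ (t *: y) by rewrite divr_gt0.
  have u0 : 0 <= N * expR (- (g * t)) by rewrite mulr_ge0 ?expR_ge0 ?ler0n.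
  have u1 : 0 < 1 + N * expR (- (g * t)) by lra.
  have := ray t t0; rewrite -ler_ln ?posrE ?expR_gt0//; last exact: mulr_gt0.
  have -> : ln ((1 + N * expR (- (g * t))) * (S (t *: y) / Zexp p_ (t *: y))) =
      ln (1 + N * expR (- (g * t))) + ln (S (t *: y) / Zexp p_ (t *: y)).
    by apply: lnM; rewrite posrE.
  rewrite expRK.
  have := le_ln1Dx (x := N * expR (- (g * t))) (lt_le_trans (ltrN10 _) u0).
  have := pulled_le0 (torus_pt P (t *: y) 0); rewrite fE -ln_div ?posrE//.
  by rewrite /e in tN *; lra.
move=> x th; rewrite fE Cm ln_div ?posrE//; last first.
  rewrite (bigD1 i0) //=; apply: ltr_pwDl; first exact: expR_gt0.
  by apply: sumr_ge0 => i _; exact: expR_ge0.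
rewrite addrAC; congr (_ - _); rewrite -[X in _ + X = _]expRK -lnM ?posrE ?expR_gt0//.
congr ln; rewrite mulr_suml; apply: eq_bigr => i _.
by rewrite /transl_coef -!expRD; congr expR; rewrite -/m; ring.
Qed.

End PulledPotential.

(** * Measurability on the torus *)

Section TorusMeasurability.
Context {R : realType} {n : nat} {P : fano_polytope R n}.
Notation Cn := 'rV[R]_(n + n).
Implicit Types (s : chart P) (F : toric P -> \bar R).

(** Measurability on the torus, in the coordinates x and th jointly. *)
Definition tmeas F := forall d (T : measurableType d) (g h : 'I_n -> T -> R),
  (forall i, measurable_fun setT (g i)) -> (forall i, measurable_fun setT (h i)) ->
  measurable_fun setT (fun t => F (torus_pt P (\row_i g i t) (\row_i h i t))).

Lemma measurable_linear d (T : measurableType d) (g : 'I_n -> T -> R) (c : 'I_n -> R) :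
  (forall i, measurable_fun setT (g i)) -> measurable_fun setT (fun t => \sum_i g i t * c i).
Proof. by move=> mg; apply: measurable_sum => i; exact: measurable_funM. Qed.

Lemma tmeas_chart s F : cmeas (fun z => F (chart_pt s z)) -> tmeas F.
Proof.
move=> mF d T g h mg mh.
pose C := invmx (intmx (R := R) (frame_mx (@vert R n P) s)).
pose a (u : 'I_n -> T -> R) j t : R := \sum_i u i t * C i j.
have ma u j : (forall i, measurable_fun setT (u i)) -> measurable_fun setT (a u j).
  by move=> mu; exact: measurable_linear.
pose r j t := expR (- a g j t / 2).
have mr j : measurable_fun setT (r j).
  apply: measurableT_comp => //; apply: measurable_funM => //.
  by apply: measurableT_comp => //; exact: ma.
pose G (k : 'I_(n + n)) (t : T) : R := match fintype.split k with
  inl j => r j t * cos (- a h j t) | inr j => r j t * sin (- a h j t) end.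
have mG k : measurable_fun setT (G k).
  rewrite /G; case: fintype.split => j; apply: measurable_funM => //;
  (apply: measurableT_comp; last by apply: measurableT_comp => //; exact: ma);
  apply: continuous_measurable_fun; [exact: continuous_cos|exact: continuous_sin].
have := mF _ _ _ mG; congr (measurable_fun _ _); apply/funext => t.
rewrite (torus_ptE s); congr (F (chart_pt s _)).
rewrite -[LHS]toCK -[RHS]toCK; congr ofC; apply/rowP => j.
have E (u : 'I_n -> T -> R) : cone_coord s (\row_i u i t) 0 j = a u j t.
  by rewrite /cone_coord mxE; apply: eq_bigr => i _; rewrite mxE.
have GE k : (\row_i G i t) 0 k = G k t by rewrite mxE.
rewrite torus_expE [LHS]mxE !GE /G -[lshift n j]/(unsplit (inl j)) -[rshift n j]/(unsplit (inr j)).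
rewrite !unsplitK !E /cE /cis; apply/eqP; rewrite eq_complex.
by rewrite /= !mul0r subr0 addr0 !eqxx.
Qed.

Lemma tmeas_torus F x : tmeas F -> cmeas (fun th => F (torus_pt P x th)).
Proof.
move=> mF d T h mh; have {1}-> : x = \row_i x 0 i by apply/rowP => i; rewrite mxE.
exact: (mF _ _ (fun i => cst (x 0 i)) h (fun i => measurable_cst _) mh).
Qed.

Lemma cmeas_torus_iint (A : set R) F : measurable A -> tmeas F -> (forall p, (0 <= F p)%E) ->
  cmeas (fun x => iint A (fun th => F (torus_pt P x th))).
Proof.
move=> mA mF F0 d T g mg.
apply: (@measurable_iint _ A n _ T (fun t th => F (torus_pt P (\row_i g i t) th))) => //.
move=> d' T' h k mh mk; apply: (mF _ _ (fun i t => g i (h t)) k) => // i.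
exact: measurableT_comp.
Qed.

Lemma tmeas_open (U : set (toric P)) : xopen U -> tmeas (fun p => (\1_U p : R)%:E).
Proof.
move=> oU; apply: (@tmeas_chart (some_chart P)).
exact: cmeas_indic (oU (some_chart P)).
Qed.

Lemma tmeas_smooth (f : toric P -> R) : xsmooth f -> tmeas (fun p => (f p)%:E).
Proof.
move=> sf; apply: (@tmeas_chart (some_chart P)); apply: cmeas_continuous.
exact: smooth_continuous (sf _).
Qed.

(** Plurisubharmonic functions are upper semicontinuous, and the smooth correction
    is continuous. *)
Lemma almost_psh_usc (psi : toric P -> \bar R) s (a : R) : almost_psh psi ->
  open [set z | (psi (chart_pt s z) < a%:E)%E].
Proof.
move=> psh; rewrite openE => z za /=.
have [A [f [oA Az sf [wlt wusc _]]]] := psh s z.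
set w := (fun y => psi (chart_pt s y) - (f y)%:E)%E in wlt wusc.
have psiE y : psi (chart_pt s y) = (w y + (f y)%:E)%E by rewrite /w subeK.
have [b [wb ba]] : exists b, (w z < b%:E)%E /\ b + f z < a.
  move: za (wlt z Az); rewrite /= psiE; case: (w z) => [r| |]//.
    rewrite -EFinD lte_fin => ra _; exists (r + (a - (r + f z)) / 2).
    by rewrite lte_fin; split; lra.
  by move=> _ _; exists (a - f z - 1); rewrite ltNyr; split=> //; lra.
have cf : {for z, continuous f} by have [] := sf [::] z Az.
have fz : \forall y \near z, f y < a - b.
  apply: (cf [set r | r < a - b]); apply: open_nbhs_nbhs; split; first exact: open_lt.
  by rewrite /=; lra.
have wz := wusc z b Az wb.
suff : \forall y \near z, (psi (chart_pt s y) < a%:E)%E by [].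
near=> y; rewrite psiE.
have : (w y < b%:E)%E by near: y.
have : f y < a - b by near: y.
case: (w y) => [r| |]//; last by move=> *; exact: ltNyr.
move=> h1 h2; suff: ((r + f y)%:E < a%:E)%E by [].
by move: h2; rewrite !lte_fin; lra.
Unshelve. all: by end_near. Qed.

Lemma tmeas_almost_psh (psi : toric P -> \bar R) : almost_psh psi -> tmeas psi.
Proof.
by move=> psh; apply: (@tmeas_chart (some_chart P)); apply: cmeas_usc => a; exact: almost_psh_usc.
Qed.

Lemma tmeas_expeR (psi : toric P -> \bar R) (c : R) : tmeas psi ->
  tmeas (fun p => expeR (- (c%:E * psi p)))%E.
Proof.
move=> mp d T g h mg mh; apply: measurable_expeR; apply: measurableT_comp => //.
by apply: emeasurable_funM => //; exact: mp.
Qed.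

Lemma tmeasM F F' : tmeas F -> tmeas F' -> tmeas (fun p => F p * F' p)%E.
Proof. by move=> mF mF' d T g h mg mh; apply: emeasurable_funM; [exact: mF|exact: mF']. Qed.

Lemma tmeas_dist (f : toric P -> R) (psi : toric P -> \bar R) : tmeas (fun p => (f p)%:E) ->
  tmeas psi -> tmeas (fun p => `|(f p)%:E - psi p|)%E.
Proof.
move=> mf mp d T g h mg mh; apply: measurableT_comp => //.
by apply: emeasurable_funB; [exact: mf|exact: mp].
Qed.

End TorusMeasurability.

(** * The volume form on the torus *)

Section Volume.
Context {R : realType} {n : nat} (P : fano_polytope R n).
Notation p_ := (@lptR R n P).
Implicit Types (x y : 'rV[R]_n) (i : Lat P) (f : {ffun 'I_(1 + n) -> Lat P}).

(** The squared volume, up to a constant factor, of the simplex spanned by n + 1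
    lattice points. *)
Definition vol f : R := \det (pick_mx (aff p_) f) ^+ 2.

(** The Hessian of [u0] is the covariance matrix of the lattice points for the
    Gibbs weights; its determinant is, up to the factor [(1 + n)!], the mean of the
    squared volume of a random simplex. *)
Lemma det_hess0E x : \det (hess0 P x) =
  ((1 + n)`!%:R)^-1 * \sum_(f : {ffun 'I_(1 + n) -> Lat P}) (\prod_k wexp p_ x (f k)) * vol f.
Proof.
have [i0 _] := some_lat (P := P).
rewrite hess0E -(det_cov p_ (sum_wexp p_ i0 x)) mulrA mulVf ?mul1r//.
Qed.

Lemma wexp_ge0 x i : 0 <= wexp p_ x i.
Proof. by rewrite ltW// wexp_gt0. Qed.

Lemma wexp_le1 x i : wexp p_ x i <= 1.
Proof.
rewrite -(sum_wexp p_ i x) [leRHS](bigD1 i)//= lerDl.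
by apply: sumr_ge0 => k _; exact: wexp_ge0.
Qed.

Lemma det_hess0_ge0 x : 0 <= \det (hess0 P x).
Proof.
rewrite det_hess0E mulr_ge0 ?invr_ge0 ?ler0n//; apply: sumr_ge0 => f _.
by rewrite mulr_ge0 ?sqr_ge0//; apply: prodr_ge0 => k _; exact: wexp_ge0.
Qed.

Lemma det_hess0_bounded : exists2 C : R, 0 <= C & forall x, \det (hess0 P x) <= C.
Proof.
exists (((1 + n)`!%:R)^-1 * \sum_f vol f).
  by rewrite mulr_ge0 ?invr_ge0 ?ler0n//; apply: sumr_ge0 => f _; exact: sqr_ge0.
move=> x; rewrite det_hess0E ler_wpM2l ?invr_ge0 ?ler0n//; apply: ler_sum => f _.
rewrite ler_piMl ?sqr_ge0//; apply: prodr_ile1 => k _.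
by rewrite wexp_ge0 wexp_le1.
Qed.

Lemma continuous_pairing (y : 'rV[R]_n) : continuous (fun x : 'rV[R]_n => pairing y x).
Proof.
apply: continuous_sumr => j x.
exact: cvgM (cvg_cst (y 0 j)) (@coord_continuous R 1 n 0 j x).
Qed.

Lemma continuous_expR_pairing (y : 'rV[R]_n) :
  continuous (fun x : 'rV[R]_n => expR (pairing y x)).
Proof.
move=> x; apply: (@continuous_comp _ _ _ (fun x : 'rV[R]_n => pairing y x) expR).
  exact: continuous_pairing.
exact: continuous_expR.
Qed.

Lemma continuous_Zexp : continuous (Zexp p_).
Proof. by apply: continuous_sumr => i; exact: continuous_expR_pairing. Qed.

Lemma continuous_wexp i : continuous (fun x => wexp p_ x i).
Proof.
move=> x; have Z0 : Zexp p_ x != 0 by rewrite gt_eqF// Zexp_gt0.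
exact: cvgM (@continuous_expR_pairing (p_ i) x) (cvgV Z0 (continuous_Zexp (x := x))).
Qed.

Lemma continuous_det_hess0 : continuous (fun x => \det (hess0 P x)).
Proof.
pose S x := \sum_(f : {ffun 'I_(1 + n) -> Lat P}) (\prod_k wexp p_ x (f k)) * vol f.
rewrite (_ : (fun x => _) = fun x => ((1 + n)`!%:R)^-1 * S x); last first.
  by apply/funext => x; exact: det_hess0E.
have cS : continuous S.
  apply: continuous_sumr => f x.
  have cp : continuous (fun x => \prod_k wexp p_ x (f k)).
    by apply: continuous_prodr => k; exact: continuous_wexp.
  exact: cvgM (cp x) (cvg_cst _).
by move=> x; exact: cvgM (cvg_cst _) (cS x).
Qed.

End Volume.

(** * The limit of the normalized potentials *)

Section Limit.
Context {R : realType} {n : nat} {P : fano_polytope R n}.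
Notation p_ := (@lptR R n P).
Implicit Types (x y th : 'rV[R]_n) (i : Lat P).

(** The derivative of [s] tends to 1, hence [s] grows linearly. *)
Lemma regularization_cvg (v : chart P -> 'rV[R]_(n + n) -> 'rV[R[i]]_n) (b : 'rV[R]_n)
    (phi : R -> toric P -> R) (xt : R -> 'rV[R]_n) (s : R -> R) :
  tian_zhu v b phi xt s -> s t @[t --> +oo] --> +oo.
Proof.
move=> [[C [_ ds]] ds1 _].
have h : \forall t \near +oo, 1 / 2 < derive1 s t.
  by apply: (cvgr_gt _ ds1); lra.
have [T [Treal hT]] := h.
pose T0 := Num.max T 0 + 1.
have [TT0 T00] : T < T0 /\ 0 < T0.
  have : T <= Num.max T 0 by rewrite le_max lexx.
  have : 0 <= Num.max T 0 by rewrite le_max lexx orbT.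
  by rewrite /T0; split; lra.
have lb t : T0 < t -> s T0 + (t - T0) / 2 <= s t.
  have dr u : T0 <= u -> derivable s u 1 by move=> Tu; apply: (ds u _).1; lra.
  move=> Tt; have [c|c|c] := @MVT R s (derive1 s) T0 t Tt.
  - rewrite in_itv /= => /andP[Tc _]; rewrite derive1E; apply: derivableP.
    by apply: dr; lra.
  - apply: derivable_within_continuous => u; rewrite in_itv /= => /andP[Tu _].
    exact: dr.
  rewrite in_itv /= => /andP[Tc ct] E.
  have : 1 / 2 < derive1 s c by apply: hT; lra.
  by move: E; set r := derive1 s c => E; nra.
apply/cvgryPge => A; near=> t.
have tT : T0 < t by near: t; apply: nbhs_pinfty_gt; exact: num_real.
have tA : T0 + 2 * (A - s T0) < t by near: t; apply: nbhs_pinfty_gt; exact: num_real.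
by have := lb t tT; lra.
Unshelve. all: by end_near. Qed.

Lemma pairing_norm_le (y : 'rV[R]_n) : exists2 D : R, 0 <= D &
  forall x, `|pairing y x| <= D * \sum_j `|x 0 j|.
Proof.
exists (\sum_j `|y 0 j|) => [|x]; first by apply: sumr_ge0.
apply: le_trans (ler_norm_sum _ _ _) _; rewrite mulr_suml; apply: ler_sum => j _.
rewrite normrM ler_wpM2l//.
by rewrite (bigD1 j) //= lerDl; apply: sumr_ge0.
Qed.

Lemma lat_norm_le : exists2 D : R, 0 <= D &
  forall i x, `|pairing (p_ i) x| <= D * \sum_j `|x 0 j|.
Proof.
have /choice [D DP] (i : Lat P) : exists D : R, 0 <= D /\
    forall x, `|pairing (p_ i) x| <= D * \sum_j `|x 0 j|.
  by have [D D0 DP] := pairing_norm_le (p_ i); exists D.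
exists (\sum_i D i) => [|i x]; first by apply: sumr_ge0 => i _; exact: (DP i).1.
apply: le_trans ((DP i).2 x) _; rewrite ler_wpM2r//; first by apply: sumr_ge0.
by rewrite (bigD1 i) //= lerDl; apply: sumr_ge0 => k _; exact: (DP k).1.
Qed.

(** The limit of the normalized potentials, on the torus; [M] selects the lattice
    points that dominate along the soliton ray. *)
Definition Psi (M : pred (Lat P)) x : R := ln ((\sum_(i | M i) expR (pairing (p_ i) x)) / Zexp p_ x).

Lemma Zpart_gt0 (M : pred (Lat P)) i0 x : M i0 -> 0 < \sum_(i | M i) expR (pairing (p_ i) x).
Proof.
move=> Mi; rewrite (bigD1 i0) //=; apply: ltr_pwDl; first exact: expR_gt0.
by apply: sumr_ge0 => i _; exact: expR_ge0.
Qed.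

(** The other lattice points are smaller by the factor [exp (- g t)]. The bound
    deteriorates with [x], but only exponentially. *)
Lemma Psi_close (M : pred (Lat P)) i0 (b : 'rV[R]_n) (g D t : R) x :
  M i0 -> 0 <= t ->
  (forall i, M i -> pairing (p_ i) b = pairing (p_ i0) b) ->
  (forall i, ~~ M i -> pairing (p_ i) b <= pairing (p_ i0) b - g) ->
  (forall i, `|pairing (p_ i) x| <= D * \sum_j `|x 0 j|) ->
  `|ln ((\sum_i expR (pairing (p_ i) x + (pairing (p_ i) (t *: b) - pairing (p_ i0) (t *: b)))) / Zexp p_ x)
    - Psi M x| <=
  #|Lat P|%:R * expR (- (g * t)) * expR (2 * D * \sum_j `|x 0 j|).
Proof.
move=> Mi t0 Meq Mle xD; set T := \sum_j `|x 0 j|.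
have Z0 : 0 < Zexp p_ x by exact: (Zexp_gt0 p_ i0 x).
pose Zm := \sum_(i | M i) expR (pairing (p_ i) x).
have Zm0 : 0 < Zm by exact: Zpart_gt0 Mi.
set S := \sum_i _.
pose E := \sum_(i | ~~ M i) expR (pairing (p_ i) x + (pairing (p_ i) (t *: b) - pairing (p_ i0) (t *: b))).
have SE : S = Zm + E.
  rewrite /S (bigID M) /=; congr (_ + _); apply: eq_bigr => i im.
  by rewrite !pairingZr (Meq _ im) subrr addr0.
have E0 : 0 <= E by apply: sumr_ge0 => i _; exact: expR_ge0.
rewrite SE /Psi -/Zm -ln_div ?posrE ?divr_gt0//; last by lra.
have -> : (Zm + E) / Zexp p_ x / (Zm / Zexp p_ x) = 1 + E / Zm.
  by field; rewrite !gt_eqF.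
have r0 : 0 <= E / Zm by rewrite divr_ge0// ltW.
rewrite ger0_norm; last by rewrite ln_ge0//; lra.
apply: le_trans (le_ln1Dx (lt_le_trans (ltrN10 _) r0)) _.
rewrite ler_pdivrMr//.
have Zlb : expR (- (D * T)) <= Zm.
  apply: (@le_trans _ _ (expR (pairing (p_ i0) x))).
    by rewrite ler_expR; have := xD i0; rewrite ler_norml => /andP[].
  by rewrite /Zm (bigD1 i0) //= lerDl; apply: sumr_ge0 => i _; exact: expR_ge0.
apply: (@le_trans _ _ (\sum_(i : Lat P) expR (- (g * t)) * expR (D * T))).
  rewrite /E big_mkcond /=; apply: ler_sum => i _; case: ifPn => [im|_]; last first.
    by rewrite mulr_ge0 ?expR_ge0.
  rewrite -expRD ler_expR !pairingZr; have := Mle i im; have := xD i.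
  rewrite ler_norml -/T => /andP[_ h1] h2; nra.
rewrite sumr_const -[leLHS]mulr_natl -!mulrA; apply: ler_wpM2l; first exact: ler0n.
apply: ler_wpM2l; first exact: expR_ge0.
have -> : expR (D * T) = expR (2 * D * T) * expR (- (D * T)).
  by rewrite -expRD; congr expR; ring.
rewrite -!mulrA; apply: ler_wpM2l; first exact: expR_ge0.
exact: Zlb.
Qed.

Section LimitIntegral.
Variables (b : 'rV[R]_n) (s : R -> R) (psi : R -> toric P -> R) (psioo : toric P -> \bar R).
Variables (M : pred (Lat P)) (i0 : Lat P) (g : R).
Hypothesis Mi0 : M i0.
Hypothesis g0 : 0 < g.
Hypothesis Meq : forall i, M i -> pairing (p_ i) (- b) = pairing (p_ i0) (- b).
Hypothesis Mlt : forall i, ~~ M i -> pairing (p_ i) (- b) <= pairing (p_ i0) (- b) - g.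
Hypothesis s_oo : s t @[t --> +oo] --> +oo.
Hypothesis pp : pulled_potentials b s psi.
Hypothesis L1 : L1_limit psi psioo.
Hypothesis psh : almost_psh psioo.

Let i0max i : pairing (p_ i) (- b) <= pairing (p_ i0) (- b).
Proof.
have [/Meq -> //|/Mlt] := boolP (M i); have := g0; lra.
Qed.

Lemma psi_close (D t : R) x th : 0 <= t -> 0 <= s t ->
  (forall i, `|pairing (p_ i) x| <= D * \sum_j `|x 0 j|) ->
  `|psi t (torus_pt P x th) - Psi M x| <=
    #|Lat P|%:R * expR (- (g * s t)) * expR (2 * D * \sum_j `|x 0 j|).
Proof.
move=> t0 st0 xD; have [sf ddf supf] := pp t0.
have E : - (s t *: b) = s t *: (- b) by rewrite scalerN.
rewrite (pulled_potential_torus sf ddf supf (i0 := i0)); last first.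
  by move=> i; rewrite E !pairingZr ler_wpM2l.
by rewrite E; exact: Psi_close.
Qed.

Let ths := `[0%R, 2 * pi]%classic : set R.
Let mths : measurable ths. Proof. exact: measurable_itv. Qed.
Let tpi0 : 0 <= 2 * pi :> R. Proof. by rewrite mulr_ge0 ?ler0n ?pi_ge0. Qed.

Lemma cmeas_vol : cmeas (fun x => (\det (hess0 P x))%:E).
Proof. by apply: cmeas_continuous; exact: continuous_det_hess0. Qed.

(** Both [psioo] and [Psi] are close to [psi t], the first one in L^1 and the
    second one pointwise; the weight [exp (- D |x|)] makes the pointwise bound
    integrable, with an integral that tends to 0. *)
Lemma weighted_L1_eq0 : exists D : R,
  iint setT (fun x => iint ths (fun th => `|psioo (torus_pt P x th) - (Psi M x)%:E|)%E *
    ((expR (- D * \sum_j `|x 0 j|))%:E * (\det (hess0 P x))%:E))%E = 0%E.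
Proof.
have [D D0 xD] := lat_norm_le; have [C C0 detC] := det_hess0_bounded P.
exists (2 * D + 1).
set w := fun x : 'rV[R]_n => expR (- (2 * D + 1) * \sum_j `|x 0 j|).
have w0 x : 0 <= w x by exact: expR_ge0.
have w1 x : w x <= 1.
  rewrite -[leRHS]expR0 ler_expR mulNr oppr_le0 mulr_ge0//; first by lra.
  exact: sumr_ge0.
have vol0 x : (0 <= (\det (hess0 P x))%:E)%E by rewrite lee_fin det_hess0_ge0.
set e := fun x : 'rV[R]_n => _.
have e0 x : (0 <= e x)%E.
  by rewrite /e mule_ge0 ?iint_ge0// mule_ge0 ?lee_fin// det_hess0_ge0.
have [J [J0 JE]] : exists J : R, 0 <= J /\
    iint setT (fun v : 'rV[R]_n => (expR (- 1 * \sum_i `|v 0 i|))%:E) = J%:E.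
  have := @iint_expR_lty R 1 n ltr01; set I := iint _ _ => Ioo.
  have I0 : (0 <= I)%E by apply: iint_ge0 => v; rewrite lee_fin expR_ge0.
  exists (fine I); rewrite fine_ge0// fineK// ge0_fin_numE//.
pose K : R := #|Lat P|%:R * (2 * pi) ^+ n * C * J.
have K0 : 0 <= K by rewrite !mulr_ge0 ?ler0n// exprn_ge0.
have bound t : 0 <= t -> 0 <= s t -> (iint setT e <=
    xint (fun p => `|(psi t p)%:E - psioo p|%E) + (K * expR (- (g * s t)))%:E)%E.
  move=> t0 st0; have [sf _ _] := pp t0.
  pose A x := iint ths (fun th => `|(psi t (torus_pt P x th))%:E - psioo (torus_pt P x th)|)%E.
  have A0 x : (0 <= A x)%E by exact: iint_ge0.
  pose kt : R := #|Lat P|%:R * expR (- (g * s t)).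
  have kt0 : 0 <= kt by rewrite mulr_ge0 ?ler0n ?expR_ge0.
  pose B x : R := kt * (2 * pi) ^+ n * C * expR (- 1 * \sum_j `|x 0 j|).
  have B0 x : 0 <= B x by rewrite !mulr_ge0 ?expR_ge0// exprn_ge0.
  have eAB x : (e x <= A x * (\det (hess0 P x))%:E + (B x)%:E)%E.
    pose k x := kt * expR (2 * D * \sum_j `|x 0 j|).
    have k0 : 0 <= k x by rewrite mulr_ge0 ?expR_ge0.
    have h : (iint ths (fun th => `|psioo (torus_pt P x th) - (Psi M x)%:E|) <=
        A x + (k x * (2 * pi) ^+ n)%:E)%E.
      have -> : (k x * (2 * pi) ^+ n)%:E = iint ths (fun _ : 'rV[R]_n => (k x)%:E).
        by rewrite iint_itv_cst// subr0.
      rewrite -iintD//; last first.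
        by apply: (@tmeas_torus _ _ _ (fun p => `|(psi t p)%:E - psioo p|)%E);
          apply: tmeas_dist; [exact: tmeas_smooth|exact: tmeas_almost_psh].
      apply: le_iint => // th; first by rewrite adde_ge0 ?lee_fin.
      move=> _; have := psi_close th t0 st0 (fun i => xD i x).
      rewrite -/kt -/(k x); case: (psioo _) => [r| |] //= hk.
      suff : `|r - Psi M x| <= `|psi t (torus_pt P x th) - r| + k x by rewrite -lee_fin.
      have -> : r - Psi M x = - (psi t (torus_pt P x th) - r) + (psi t (torus_pt P x th) - Psi M x) by ring.
      by apply: le_trans (ler_normD _ _) _; rewrite normrN lerD2l.
    rewrite /e; apply: (@le_trans _ _ ((A x + (k x * (2 * pi) ^+ n)%:E) * ((w x)%:E * (\det (hess0 P x))%:E))%E).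
      by apply: lee_wpmul2r h; apply: mule_ge0 => //; rewrite lee_fin.
    rewrite ge0_muleDl ?lee_fin ?mulr_ge0 ?exprn_ge0//; apply: leeD.
      by apply: lee_wpmul2l => //; rewrite -EFinM lee_fin ler_piMl ?det_hess0_ge0.
    rewrite -!EFinM lee_fin.
    have -> : B x = k x * (2 * pi) ^+ n * (w x * C).
      rewrite /B /k /w; set T := \sum_j _.
      have -> : expR (- 1 * T) = expR (2 * D * T) * expR (- (2 * D + 1) * T).
        by rewrite -expRD; congr expR; ring.
      by ring.
    apply: ler_wpM2l; first by rewrite mulr_ge0// exprn_ge0.
    exact: ler_wpM2l.
  apply: (@le_trans _ _ (iint setT (fun x => A x * (\det (hess0 P x))%:E + (B x)%:E)%E)).
    apply: le_iint => // x; rewrite adde_ge0 ?lee_fin// mule_ge0//.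
  have cB : cmeas (fun x : 'rV[R]_n => (expR (- 1 * \sum_j `|x 0 j|))%:E) by exact: cmeas_expR.
  have BE : (fun x => (B x)%:E) = fun x => ((kt * (2 * pi) ^+ n * C)%:E *
      (expR (- 1 * \sum_j `|x 0 j|))%:E)%E by apply/funext => x; rewrite -EFinM.
  have cA : cmeas (fun x => A x * (\det (hess0 P x))%:E)%E.
    apply: cmeasM; last exact: cmeas_vol.
    apply: (@cmeas_torus_iint _ _ _ _ (fun p => `|(psi t p)%:E - psioo p|)%E) => //.
    by apply: tmeas_dist; [exact: tmeas_smooth|exact: tmeas_almost_psh].
  have cB' : cmeas (fun x => (B x)%:E).
    by rewrite BE; apply: cmeasM => //; exact: cmeas_cst.
  rewrite (iintD _ cA cB')//; last by move=> x; rewrite mule_ge0.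
  rewrite leeD2l// BE (iintZl _ cB)//; last by rewrite !mulr_ge0// exprn_ge0.
  by rewrite JE -EFinM lee_fin /K /kt; lra.
apply/eqP; rewrite eq_le iint_ge0// andbT; apply/lee_addgt0Pr => r r0; rewrite add0e.
near (pinfty_nbhs R) => t.
have t0 : 0 <= t by near: t; apply: nbhs_pinfty_ge; exact: num_real.
have stl : Num.max 0 (K / (r / 2) / g) <= s t by near: t; move/cvgryPge : s_oo; exact.
have [st0 sK] : 0 <= s t /\ K / (r / 2) / g <= s t by move: stl; rewrite ge_max => /andP[].
have X : (xint (fun p => `|(psi t p)%:E - psioo p|) < (r / 2)%:E)%E.
  near: t; have L1' : xint (fun p => `|(psi t p)%:E - psioo p|%E) @[t --> +oo] --> 0%E := L1.
  apply: (L1' [set e | (e < (r / 2)%:E)%E]); apply: open_nbhs_nbhs; split.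
    exact: open_ereal_lt_ereal.
  by rewrite /= lte_fin divr_gt0.
apply: le_trans (bound t t0 st0) _.
have -> : r%:E = ((r / 2)%:E + (r / 2)%:E)%E by rewrite -EFinD -splitr.
apply: leeD; first exact: ltW.
rewrite lee_fin.
have r2 : 0 < r / 2 by rewrite divr_gt0.
have su : K / (r / 2) <= g * s t by rewrite [leRHS]mulrC -ler_pdivrMr.
have := expR_ge1Dx (g * s t).
rewrite expRN ler_pdivrMr ?expR_gt0// => eu; move: su; rewrite ler_pdivrMr// => su.
by apply: (le_trans su); rewrite mulrC; apply: ler_wpM2l; [exact: ltW|lra].
Unshelve. all: by end_near. Qed.

Lemma continuous_Psi : continuous (Psi M).
Proof.
have cs : continuous (fun x => (\sum_(i | M i) expR (pairing (p_ i) x)) / Zexp p_ x).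
  have cn : continuous (fun x => \sum_(i | M i) expR (pairing (p_ i) x)).
    rewrite (_ : (fun x => _) = fun x => \sum_i (if M i then expR (pairing (p_ i) x) else 0)); last first.
      by apply/funext => x; rewrite big_mkcond.
    apply: continuous_sumr => i; case: (M i); first exact: continuous_expR_pairing.
    exact: cst_continuous.
  move=> x; have Z0 : Zexp p_ x != 0 by rewrite gt_eqF// (Zexp_gt0 p_ i0).
  exact: cvgM (cn x) (cvgV Z0 (@continuous_Zexp _ _ P x)).
move=> x; apply: (@continuous_comp _ _ _ (fun x => (\sum_(i | M i) expR (pairing (p_ i) x)) / Zexp p_ x) (@ln R)).
  exact: cs.
by apply: continuous_ln; rewrite divr_gt0 ?(Zexp_gt0 p_ i0)// (Zpart_gt0 _ Mi0).
Qed.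

(** The limit function agrees with [Psi] almost everywhere, so its exponential
    integrals are explicit. *)
Lemma xint_limit (U : set (toric P)) (c : R) : xopen U ->
  xint (fun p => (\1_U p)%:E * expeR (- (c%:E * psioo p)))%E =
  iint setT (fun x => (expR (- (c * Psi M x)))%:E *
    iint ths (fun th => (\1_U (torus_pt P x th))%:E) * (\det (hess0 P x))%:E)%E.
Proof.
move=> oU; have [D De] := weighted_L1_eq0.
have vol0 x : (0 <= (\det (hess0 P x))%:E)%E by rewrite lee_fin det_hess0_ge0.
have ind0 p : (0 <= (\1_U p : R)%:E)%E by rewrite lee_fin indicE ler0n.
have tU : tmeas (fun p => (\1_U p : R)%:E) by exact: tmeas_open.
have tpsi : tmeas psioo by exact: tmeas_almost_psh.
have tF : tmeas (fun p => (\1_U p)%:E * expeR (- (c%:E * psioo p)))%E.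
  by apply: tmeasM => //; exact: tmeas_expeR.
have F0 p : (0 <= (\1_U p)%:E * expeR (- (c%:E * psioo p)))%E.
  by rewrite mule_ge0// expeR_ge0.
have cP : cmeas (fun x => (expR (- (c * Psi M x)))%:E).
  apply: cmeas_continuous => x.
  apply: (@continuous_comp _ _ _ (fun x => - (c * Psi M x)) expR); last exact: continuous_expR.
  exact: cvgN (cvgM (cvg_cst c) (@continuous_Psi x)).
have cD : cmeas (fun x => iint ths (fun th => `|psioo (torus_pt P x th) - (Psi M x)%:E|))%E.
  move=> d T u mu.
  apply: (@measurable_iint _ ths n _ T (fun t th =>
    `|psioo (torus_pt P (\row_i u i t) th) - (Psi M (\row_i u i t))%:E|)%E) => //.
  move=> d' T' h k mh mk; apply: measurableT_comp => //; apply: emeasurable_funB.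
    exact: (tpsi _ _ (fun j t => u j (h t)) k (fun j => measurableT_comp (mu j) mh) mk).
  have cPsi : cmeas (fun x => (Psi M x)%:E) by apply: cmeas_continuous; exact: continuous_Psi.
  exact: (cPsi _ _ (fun j t => u j (h t)) (fun j => measurableT_comp (mu j) mh)).
pose e x := (iint ths (fun th => `|psioo (torus_pt P x th) - (Psi M x)%:E|) *
    ((expR (- D * \sum_j `|x 0 j|))%:E * (\det (hess0 P x))%:E))%E.
apply: (iint_ae_eq (e := e)) De => //.
- apply: cmeasM => //; apply: cmeasM; [exact: cmeas_expR|exact: cmeas_vol].
- by apply: cmeasM; [exact: (cmeas_torus_iint mths tF F0)|exact: cmeas_vol].
- apply: cmeasM; last exact: cmeas_vol.
  by apply: cmeasM => //; exact: (cmeas_torus_iint mths tU ind0).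
- by move=> x; rewrite mule_ge0 ?iint_ge0// mule_ge0// lee_fin expR_ge0.
- by move=> x; rewrite mule_ge0 ?iint_ge0.
- by move=> x; rewrite mule_ge0// mule_ge0 ?iint_ge0// lee_fin expR_ge0.
move=> x /eqP; rewrite /e !mule_eq0 !eqe (gt_eqF (expR_gt0 _)) => /orP[/eqP D0|]; last first.
  by rewrite orFb => /eqP ->; rewrite !mule0.
congr (_ * _)%E; rewrite -iintZl ?expR_ge0//; last exact: (tmeas_torus x tU).
have cd : cmeas (fun th => `|psioo (torus_pt P x th) - (Psi M x)%:E|)%E.
  move=> d T u mu; apply: measurableT_comp => //; apply: emeasurable_funB => //.
  exact: (tmeas_torus x tpsi).
apply: (iint_ae_eq (e := fun th => `|psioo (torus_pt P x th) - (Psi M x)%:E|)%E) D0 => //.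
- exact: (tmeas_torus x tF).
- by apply: cmeasM; [exact: cmeas_cst|exact: (tmeas_torus x tU)].
move=> th /eqP; rewrite abse_eq0 => /eqP h.
have -> : psioo (torus_pt P x th) = (Psi M x)%:E.
  by move: h; case: (psioo _) => [r| |] //= -[] /eqP; rewrite subr_eq0 => /eqP ->.
by rewrite muleC.
Qed.

End LimitIntegral.

End Limit.

(** * Estimates in a chart *)

Section ChartEstimates.
Context {R : realType} {n : nat} {P : fano_polytope R n}.
Variable s : chart P.
Notation p_ := (@lptR R n P).
Notation a x j := (cone_coord s x 0 j).
Notation q j := (realv R (@vert R n P (s j))).
Implicit Types (x y : 'rV[R]_n) (i : Lat P) (j k : 'I_n).
Implicit Types (f : {ffun 'I_(1 + n) -> Lat P}).

Hypothesis adj : forall j, exists i, forall k, kn s i k = (k == j).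

Lemma pairing_kn i x : pairing (p_ i) x = \sum_j a x j - \sum_j (kn s i j)%:R * a x j.
Proof. by rewrite (pairing_kz s); congr (_ - _); apply: eq_bigr => j _; rewrite kn_kz. Qed.

(** The squared modulus of the section attached to [i], on the torus. *)
Definition wt_exp i x : R := expR (- \sum_j (kn s i j)%:R * a x j).

Lemma wt_exp_ge0 i x : 0 <= wt_exp i x. Proof. exact: expR_ge0. Qed.

Lemma kn_pvert : exists i, forall j, kn s i j = 0%N.
Proof. by have [i ip _] := wt_pvert s; exists i => j; rewrite /kn ip kz_pvert. Qed.

Lemma sum_wt_exp_ge1 x : 1 <= \sum_i wt_exp i x.
Proof.
have [i0 k0] := kn_pvert; rewrite (bigD1 i0) //= -[leLHS]addr0; apply: lerD.
  by rewrite /wt_exp big1 ?oppr0 ?expR0// => j _; rewrite k0 mul0r.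
by apply: sumr_ge0 => i _; exact: wt_exp_ge0.
Qed.

Lemma wexpE x i : wexp p_ x i = wt_exp i x / \sum_i wt_exp i x.
Proof.
have ZE : Zexp p_ x = expR (\sum_j a x j) * \sum_i wt_exp i x.
  by rewrite mulr_sumr; apply: eq_bigr => k _; rewrite -expRD -pairing_kn.
rewrite /wexp ZE pairing_kn expRD -/(wt_exp i x); field.
by rewrite !gt_eqF ?expR_gt0//; apply: lt_le_trans (sum_wt_exp_ge1 x).
Qed.

Definition kmax : R := \sum_i \sum_j (kn s i j)%:R.

Lemma kmax_ge0 : 0 <= kmax.
Proof. by apply: sumr_ge0 => i _; apply: sumr_ge0 => j _; exact: ler0n. Qed.

Lemma sum_kn_le i : \sum_j (kn s i j)%:R <= kmax.
Proof.
rewrite /kmax [leRHS](bigD1 i) //= lerDl.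
by apply: sumr_ge0 => k _; apply: sumr_ge0 => j _; exact: ler0n.
Qed.

Lemma kn_le i j : (kn s i j)%:R <= kmax.
Proof.
apply: le_trans (sum_kn_le i); rewrite (bigD1 j) //= lerDl.
by apply: sumr_ge0 => k _; exact: ler0n.
Qed.

Lemma sum_wt_exp_le (B : R) x : 0 <= B -> (forall j, - B <= a x j) ->
  \sum_i wt_exp i x <= #|Lat P|%:R * expR (kmax * B).
Proof.
move=> B0 aB; apply: (@le_trans _ _ (\sum_(i : Lat P) expR (kmax * B))).
  apply: ler_sum => i _; rewrite ler_expR -sumrN.
  apply: (@le_trans _ _ (\sum_j (kn s i j)%:R * B)).
    apply: ler_sum => j _; rewrite -mulrN ler_wpM2l ?ler0n//.
    by have := aB j; lra.
  by rewrite -mulr_suml ler_wpM2r// sum_kn_le.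
by rewrite sumr_const -[leLHS]mulr_natl.
Qed.

Lemma prod_wt_exp f x : \prod_k wt_exp (f k) x = expR (- \sum_j (\sum_k kn s (f k) j)%:R * a x j).
Proof.
rewrite -expR_sum; congr expR; rewrite sumrN exchange_big /=; congr (- _).
by apply: eq_bigr => j _; rewrite natr_sum mulr_suml.
Qed.

Lemma mul_pick_tr (v1 : 'rV[R]_1) (w : 'rV[R]_n) f (k : 'I_(1 + n)) :
  (row_mx v1 w *m (pick_mx (aff p_) f)^T) 0 k = v1 0 0 + pairing (p_ (f k)) w.
Proof.
have E l : (pick_mx (aff p_) f)^T l k = aff p_ (f k) 0 l by rewrite mxE [LHS]mxE.
rewrite mxE big_split_ord big_ord1 !E /aff !row_mxEl mxE eqxx mulr1; congr (_ + _).
by apply: eq_bigr => l _; rewrite E /aff !row_mxEr mulrC.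
Qed.

(** If no point of [f] has a positive exponent along [j], all of them lie on the
    facet dual to the j-th ray, hence are affinely dependent. *)
Lemma vol_neq0 f j : vol f != 0 -> (0 < \sum_k kn s (f k) j)%N.
Proof.
apply: contraNT; rewrite -leqNgt leqn0 sum_nat_eq0 => /forallP k0.
rewrite /vol sqrf_eq0 -det_tr; apply/det0P.
exists (row_mx 1%:M (- q j)) => [|].
  apply/eqP => /(congr1 lsubmx) /rowP /(_ 0) /eqP; rewrite row_mxKl !mxE eqxx.
  by rewrite oner_eq0.
apply/rowP => k; rewrite mul_pick_tr mxE eqxx [RHS]mxE pairingNr.
by have := knE s (f k) j; have /eqP -> := implyP (k0 k) isT => /esym.
Qed.

(** Where the coordinates are bounded below, a product of weights is at most a
    constant times [exp (- sum_j m_j a_j)] with [m_j] the total exponent along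
    [j], and [1 <= m_j] by [vol_neq0]. *)
Lemma det_hess0_upper (B : R) : 0 <= B -> exists2 C : R, 0 <= C &
  forall x, (forall j, - B <= a x j) -> \det (hess0 P x) <= C * expR (- \sum_j a x j).
Proof.
move=> B0; pose E := expR ((1 + n)%:R * kmax * B).
exists (((1 + n)`!%:R)^-1 * \sum_(f : {ffun 'I_(1 + n) -> Lat P}) E * vol f).
  rewrite mulr_ge0 ?invr_ge0 ?ler0n//; apply: sumr_ge0 => f _.
  by rewrite mulr_ge0 ?expR_ge0 ?sqr_ge0.
move=> x aB; rewrite det_hess0E -mulrA; apply: ler_wpM2l; first by rewrite invr_ge0 ler0n.
rewrite mulr_suml; apply: ler_sum => f _.
have [->|vf] := eqVneq (vol f) 0; first by rewrite !mulr0 mul0r.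
rewrite mulrAC; apply: ler_wpM2r; first exact: sqr_ge0.
apply: (@le_trans _ _ (\prod_k wt_exp (f k) x)).
  apply: ler_prod => k _; rewrite wexp_ge0 wexpE /= ler_pdivrMr; last first.
    exact: lt_le_trans (sum_wt_exp_ge1 x).
  by rewrite ler_peMr ?wt_exp_ge0 ?sum_wt_exp_ge1.
rewrite prod_wt_exp -expRD ler_expR.
have m1 j : (1 <= \sum_k kn s (f k) j)%N by exact: vol_neq0.
apply: (@le_trans _ _ (\sum_j ((\sum_k kn s (f k) j)%:R * B - a x j))).
  rewrite -sumrN; apply: ler_sum => j _.
  have : 1 <= (\sum_k kn s (f k) j)%:R :> R by rewrite ler1n.
  have := aB j; set m : R := _%:R => h1 h2; nra.
rewrite big_split /= sumrN lerD2r -mulr_suml; apply: ler_wpM2r => //.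
have -> : \sum_j (\sum_k kn s (f k) j)%:R = \sum_k \sum_j (kn s (f k) j)%:R :> R.
  by rewrite exchange_big /=; apply: eq_bigr => j _; rewrite natr_sum.
apply: (@le_trans _ _ (\sum_(k < 1 + n) kmax)); first by apply: ler_sum => k _; exact: sum_kn_le.
by rewrite sumr_const card_ord -[leLHS]mulr_natl.
Qed.

(** The simplex spanned by the vertex of the chart and its neighbours on the edges
    has nonzero volume and total exponents equal to 1. *)
Lemma det_hess0_lower (B : R) : 0 <= B -> exists2 c : R, 0 < c &
  forall x, (forall j, - B <= a x j) -> c * expR (- \sum_j a x j) <= \det (hess0 P x).
Proof.
move=> B0; have [i0 ki0] := kn_pvert; have /choice [e eP] := adj.
pose f : {ffun 'I_(1 + n) -> Lat P} := [ffun l : 'I_(1 + n) => match fintype.split l with inl _ => i0 | inr j => e j end].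
have fl : f (lshift n 0) = i0 by rewrite ffunE -[lshift n 0]/(unsplit (inl 0)) unsplitK.
have fr j : f (rshift 1 j) = e j by rewrite ffunE -[rshift 1 j]/(unsplit (inr j)) unsplitK.
have kf j : (\sum_l kn s (f l) j = 1)%N.
  rewrite big_split_ord big_ord1 /= fl ki0 add0n (bigD1 j) //= fr eP eqxx big1// => k kj.
  by rewrite fr eP eq_sym (negPf kj).
have vf : 0 < vol f.
  rewrite lt_neqAle sqr_ge0 andbT eq_sym sqrf_eq0 -det_tr; apply/negP => /det0P [v v0].
  rewrite -[v]hsubmxK; set v1 := lsubmx v; set w := rsubmx v => h.
  have hl l : v1 0 0 + pairing (p_ (f l)) w = 0.
    by have := congr1 (fun M : 'rV[R]_(1 + n) => M 0 l) h; rewrite mul_pick_tr [RHS]mxE.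
  have w0 j : a w j = 0.
    have := hl (lshift n 0); have := hl (rshift 1 j); rewrite fl fr !pairing_kn.
    have -> : \sum_k (kn s (e j) k)%:R * a w k = a w j.
      by rewrite (bigD1 j) //= eP eqxx mul1r big1 ?addr0// => k /negPf kj; rewrite eP kj mul0r.
    have -> : \sum_k (kn s i0 k)%:R * a w k = 0 by rewrite big1// => k _; rewrite ki0 mul0r.
    lra.
  have wE : w = 0 by rewrite (cone_coordK s w) big1// => j _; rewrite w0 scale0r.
  have v1E : v1 = 0.
    have h0 : v1 0 0 = 0 by have := hl (lshift n 0); rewrite wE pairing0r addr0.
    by apply/rowP => l; rewrite !ord1 [RHS]mxE.
  by move/negP: v0; apply; rewrite -[v]hsubmxK -/v1 -/w wE v1E row_mx0.
pose S : R := #|Lat P|%:R * expR (kmax * B).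
have S0 : 0 < S.
  rewrite mulr_gt0 ?expR_gt0// ltr0n; apply/card_gt0P; by exists i0.
exists (((1 + n)`!%:R)^-1 * (vol f / S ^+ (1 + n))).
  by rewrite mulr_gt0 ?invr_gt0 ?ltr0n ?fact_gt0// divr_gt0// exprn_gt0.
move=> x aB; rewrite det_hess0E -mulrA; apply: ler_wpM2l; first by rewrite invr_ge0 ler0n.
rewrite (bigD1 f) //= -[leLHS]addr0; apply: lerD; last first.
  apply: sumr_ge0 => f' _; rewrite mulr_ge0 ?sqr_ge0//.
  by apply: prodr_ge0 => l _; exact: wexp_ge0.
rewrite -mulrA [leLHS]mulrC; apply: ler_wpM2r; first exact: sqr_ge0.
have SW : \sum_i wt_exp i x <= S by exact: sum_wt_exp_le.
have W1 := sum_wt_exp_ge1 x.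
rewrite [leRHS](eq_bigr (fun l => wt_exp (f l) x / \sum_i wt_exp i x)); last by move=> l _; exact: wexpE.
rewrite big_split /= prodr_const card_ord prod_wt_exp exprVn.
have -> : \sum_j (\sum_l kn s (f l) j)%:R * a x j = \sum_j a x j.
  by apply: eq_bigr => j _; rewrite kf mul1r.
rewrite [leLHS]mulrC; apply: ler_wpM2l; first exact: expR_ge0.
rewrite lef_pV2 ?posrE ?exprn_gt0//; last exact: lt_le_trans W1.
by rewrite ler_pXn2r// nnegrE; [apply: le_trans W1|apply: ltW].
Qed.

(** The entropy of the weights is at most the logarithm of their number. *)
Lemma gibbs_le x (c : Lat P -> R) : (forall i, 0 <= c i) -> \sum_i c i = 1 ->
  \sum_i c i * pairing (p_ i) x <= pairing (grad0 P x) x + ln #|Lat P|%:R.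
Proof.
move=> c0 c1; have [i0 _] := some_lat (P := P).
have Z0 : 0 < Zexp p_ x by exact: (Zexp_gt0 p_ i0 x).
have N0 : 0 < #|Lat P|%:R :> R by rewrite ltr0n; apply/card_gt0P; exists i0.
apply: (@le_trans _ _ (ln (Zexp p_ x))).
  rewrite -[leRHS]mul1r -c1 mulr_suml; apply: ler_sum => i _; apply: ler_wpM2l => //.
  rewrite -[leLHS]expRK ler_ln ?posrE ?expR_gt0// /Zexp (bigD1 i) //= lerDl.
  by apply: sumr_ge0 => k _; exact: expR_ge0.
have -> : pairing (grad0 P x) x = \sum_i wexp p_ x i * pairing (p_ i) x.
  rewrite /pairing; under eq_bigr do rewrite grad0E mulr_suml.
  rewrite exchange_big /=; apply: eq_bigr => i _; rewrite mulr_sumr.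
  by apply: eq_bigr => j _; rewrite mulrA.
pose u i := ln (Zexp p_ x) - pairing (p_ i) x - ln #|Lat P|%:R.
have uE : \sum_i wexp p_ x i * u i =
    ln (Zexp p_ x) - \sum_i wexp p_ x i * pairing (p_ i) x - ln #|Lat P|%:R.
  rewrite /u; under eq_bigr do rewrite !mulrBr.
  rewrite !sumrB; congr (_ - _ - _); by rewrite -mulr_suml sum_wexp// mul1r.
have N1 : \sum_(i : Lat P) (#|Lat P|%:R^-1 - wexp p_ x i) = 0.
  rewrite sumrB sum_wexp// sumr_const -[X in X - _]mulr_natl mulfV ?subrr//.
  by rewrite gt_eqF.
suff : \sum_i wexp p_ x i * u i <= \sum_(i : Lat P) (#|Lat P|%:R^-1 - wexp p_ x i).
  by rewrite uE N1; lra.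
apply: ler_sum => i _.
have -> : #|Lat P|%:R^-1 = wexp p_ x i *
    expR (ln (Zexp p_ x) - pairing (p_ i) x - ln #|Lat P|%:R).
  rewrite !expRD !expRN !lnK ?posrE// /wexp; field.
  by rewrite !gt_eqF ?expR_gt0.
have := expR_ge1Dx (ln (Zexp p_ x) - pairing (p_ i) x - ln #|Lat P|%:R).
set E := expR _ => hE.
rewrite -[X in _ - X]mulr1 -mulrBr; apply: ler_wpM2l; first exact: wexp_ge0.
by rewrite /u; lra.
Qed.

Section MomentRegion.
Variables (T : pred (Lat P)) (D : pred 'I_n).
Hypothesis TD : forall i j, T i -> D j -> kn s i j = 0%N.
Hypothesis Ts : forall i, (forall j, kn s i j = 0%N) -> T i.
Hypothesis Ta : forall i j, ~~ D j -> (forall k, kn s i k = (k == j)) -> T i.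
Let lam : R := (\sum_(i | T i) 1)^-1.
Let y := lam *: \sum_(i | T i) p_ i.

Lemma lam_gt0 : 0 < lam.
Proof.
have [i0 /Ts Ti0] := kn_pvert; rewrite invr_gt0 (bigD1 i0) //=.
by apply: ltr_pwDl => //; apply: sumr_ge0.
Qed.

Lemma mean_pairing x : pairing y x = \sum_i (T i)%:R * lam * pairing (p_ i) x.
Proof.
rewrite pairingZl pairing_suml mulr_sumr big_mkcond; apply: eq_bigr => i _.
by case: (T i); rewrite ?mul1r ?mul0r.
Qed.

Lemma sum_mean : \sum_i (T i)%:R * lam = 1.
Proof.
transitivity (lam * \sum_(i | T i) 1).
  rewrite mulr_sumr [RHS]big_mkcond; apply: eq_bigr => i _.
  by case: (T i); rewrite ?mul1r ?mul0r ?mulr1.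
have := lam_gt0; rewrite /lam invr_gt0 => h; by rewrite mulVf ?gt_eqF.
Qed.

(** Over a neighbourhood of the mean of the lattice points of a face, the moment
    map controls the logarithmic coordinates: weight can be moved between the
    vertex of the chart and its neighbours so as to realize the value of the
    moment map shifted along one coordinate axis, and the entropy bound then
    reads off that coordinate. *)
Lemma moment_region : exists2 eps : R, 0 < eps & exists2 B : R, 0 <= B &
  forall x, (forall k, `|grad0 P x 0 k - y 0 k| <= eps) ->
    (forall j, - B <= a x j) /\ (forall j, ~~ D j -> a x j <= B).
Proof.
have l0 := lam_gt0.
pose Q : R := \sum_j \sum_k `|q j 0 k|.
have Q0 : 0 <= Q by apply: sumr_ge0 => j _; apply: sumr_ge0.
have [i0 ki0] := kn_pvert; have /choice [e eP] := adj.
have N0 : 0 <= ln #|Lat P|%:R :> R by rewrite ln_ge0// ler1n; apply/card_gt0P; exists i0.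
exists (lam / (2 * (Q + 1))); first by rewrite divr_gt0// mulr_gt0//; lra.
exists (2 * ln #|Lat P|%:R / lam); first by rewrite divr_ge0 ?(ltW l0)// mulr_ge0.
move=> x xy; set g := grad0 P x in xy *.
pose d k := pairing (g - y) (q k).
have sd : \sum_k `|d k| <= lam / 2.
  apply: (@le_trans _ _ (\sum_k \sum_l (lam / (2 * (Q + 1))) * `|q k 0 l|)).
    apply: ler_sum => k _; apply: le_trans (ler_norm_sum _ _ _) _; apply: ler_sum => l _.
    by rewrite normrM ler_wpM2r// mxE [X in _ + X]mxE.
  under eq_bigr do rewrite -mulr_sumr; rewrite -mulr_sumr -/Q.
  have -> : lam / (2 * (Q + 1)) * Q = lam / 2 * (Q / (Q + 1)) by field; rewrite gt_eqF//; lra.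
  rewrite ler_piMr//; first by rewrite divr_ge0// ltW.
  by rewrite ler_pdivrMr; lra.
have dD k : D k -> d k <= 0.
  move=> Dk; rewrite /d pairingDl pairingNl mean_pairing.
  have -> : \sum_i (T i)%:R * lam * pairing (p_ i) (q k) = 1.
    transitivity (\sum_i (T i)%:R * lam); last exact: sum_mean.
    apply: eq_bigr => i _; case: (boolP (T i)) => [Ti|_]; last by rewrite !mul0r.
    have := knE s i k; rewrite (TD Ti Dk) => h; have -> : pairing (p_ i) (q k) = 1 by lra.
    by rewrite mulr1.
  rewrite subr_le0 -[leRHS](sum_wexp p_ i0 x) /pairing /g.
  under eq_bigr do rewrite grad0E mulr_suml.
  rewrite exchange_big /=; apply: ler_sum => i _.
  have -> : \sum_j wexp p_ x i * p_ i 0 j * q k 0 j = wexp p_ x i * pairing (p_ i) (q k).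
    by rewrite mulr_sumr; apply: eq_bigr => j _; rewrite mulrA.
  rewrite ler_piMr ?wexp_ge0//; have := knE s i k; have := ler0n R (kn s i k); lra.
(* [c]: the mean of the lattice points of the face, with weight [t k] moved from
   the vertex [i0] to its neighbour [e k] *)
have shift (t : 'I_n -> R) : (forall k, D k -> 0 <= t k) -> \sum_k `|t k| <= lam ->
    - \sum_k (d k + t k) * a x k <= ln #|Lat P|%:R.
  move=> tD st.
  pose c i := (T i)%:R * lam + \sum_k t k * ((i == e k)%:R - (i == i0)%:R).
  have c0 i : 0 <= c i.
    rewrite /c; have [Ti|nTi] := boolP (T i).
      rewrite mul1r; suff : - \sum_k `|t k| <= \sum_k t k * ((i == e k)%:R - (i == i0)%:R) by lra.
      rewrite -sumrN; apply: ler_sum => k _.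
      have := ler_norm (t k); have := ler_norm (- t k); rewrite normrN; have := normr_ge0 (t k).
      by case: (i == e k); case: (i == i0); rewrite /= ?subrr ?subr0 ?sub0r ?mulr0 ?mulr1 ?mulrN1; lra.
    rewrite mul0r add0r; apply: sumr_ge0 => k _.
    have -> : (i == i0) = false by apply: contraNF nTi => /eqP ->; exact: Ts.
    rewrite subr0; case: eqP => [ie|_]; rewrite ?mulr0// mulr1; apply: tD.
    by apply: contraNT nTi => nDk; rewrite ie; apply: Ta nDk _.
  have cF (F : Lat P -> R) : \sum_i c i * F i =
      \sum_i (T i)%:R * lam * F i + \sum_k t k * (F (e k) - F i0).
    rewrite /c; under eq_bigr do rewrite mulrDl; rewrite big_split /=; congr (_ + _).
    under eq_bigr do rewrite mulr_suml; rewrite exchange_big /=; apply: eq_bigr => k _.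
    under eq_bigr do rewrite -mulrA mulrBl; rewrite -mulr_sumr sumrB; congr (_ * (_ - _)).
      by rewrite (bigD1 (e k)) //= eqxx mul1r big1 ?addr0// => i /negPf ->; rewrite mul0r.
    by rewrite (bigD1 i0) //= eqxx mul1r big1 ?addr0// => i /negPf ->; rewrite mul0r.
  have c1 : \sum_i c i = 1.
    have := cF (fun=> 1); under eq_bigr do rewrite mulr1; move=> ->.
    under eq_bigr do rewrite mulr1; rewrite sum_mean [X in _ + X]big1 ?addr0// => k _.
    by rewrite subrr mulr0.
  have := gibbs_le x c0 c1; rewrite cF -mean_pairing -/g.
  have -> : \sum_k t k * (pairing (p_ (e k)) x - pairing (p_ i0) x) = - \sum_k t k * a x k.
    rewrite -[RHS]sumrN; apply: eq_bigr => k _; rewrite !pairing_kn.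
    have -> : \sum_j (kn s (e k) j)%:R * a x j = a x k.
      by rewrite (bigD1 k) //= eP eqxx mul1r big1 ?addr0// => l /negPf kl; rewrite eP kl mul0r.
    have -> : \sum_j (kn s i0 j)%:R * a x j = 0 by rewrite big1// => l _; rewrite ki0 mul0r.
    by ring.
  have -> : pairing y x = pairing g x - \sum_k d k * a x k.
    have -> : \sum_k d k * a x k = pairing (g - y) x.
      by rewrite (pairing_cone s); apply: eq_bigr => k _; rewrite mulrC.
    by rewrite pairingDl pairingNl; ring.
  have -> : \sum_k (d k + t k) * a x k = \sum_k d k * a x k + \sum_k t k * a x k.
    by rewrite -big_split; apply: eq_bigr => k _; rewrite mulrDl.
  by lra.
(* [- d] turns the mean into the value of the moment map, [tau] shifts it along
   the j-th axis *)
have axis (tau : R) j : `|tau| <= lam / 2 -> (D j -> 0 <= tau) -> - (tau * a x j) <= ln #|Lat P|%:R.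
  move=> tl tD; have := shift (fun k => - d k + tau * (k == j)%:R).
  have -> : \sum_k (d k + (- d k + tau * (k == j)%:R)) * a x k = tau * a x j.
    rewrite (bigD1 j) //= eqxx mulr1 big1; first by ring.
    by move=> k /negPf ->; rewrite mulr0; ring.
  apply=> [k Dk|].
    case: eqP => [kj|_]; have := dD k Dk; last by rewrite mulr0; lra.
    by rewrite mulr1; move: tD; rewrite -kj => /(_ Dk); lra.
  apply: (@le_trans _ _ (\sum_k (`|d k| + `|tau| * (k == j)%:R))).
    apply: ler_sum => k _; apply: le_trans (ler_normD _ _) _.
    by rewrite normrN normrM normr_nat.
  have -> : \sum_k (`|d k| + `|tau| * (k == j)%:R) = \sum_k `|d k| + `|tau|.
    rewrite big_split /=; congr (_ + _).
    by rewrite (bigD1 j) //= eqxx mulr1 big1 ?addr0// => k /negPf ->; rewrite mulr0.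
  lra.
split=> [j|j nDj].
  have := @axis (lam / 2) j; rewrite ger0_norm ?divr_ge0 ?(ltW l0)// => /(_ (lexx _)) h.
  have {}h : - (lam / 2 * a x j) <= ln #|Lat P|%:R by apply: h => _; rewrite ?divr_ge0 ?(ltW l0).
  by rewrite lerNl ler_pdivlMr//; move: h; lra.
have := @axis (- (lam / 2)) j; rewrite normrN ger0_norm ?divr_ge0 ?(ltW l0)// => /(_ (lexx _)) h.
have {}h : - (- (lam / 2) * a x j) <= ln #|Lat P|%:R by apply: h => Dj; rewrite Dj in nDj.
by rewrite ler_pdivlMr//; move: h; lra.
Qed.

End MomentRegion.

End ChartEstimates.

(** * Convergence *)

Section Convergence.
Context {R : realType} {n : nat} {P : fano_polytope R n}.
Variable s : chart P.
Notation p_ := (@lptR R n P).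
Notation a x j := (cone_coord s x 0 j).
Notation q j := (realv R (@vert R n P (s j))).
Implicit Types (x y : 'rV[R]_n) (i : Lat P) (j k : 'I_n).
Variables (M : pred (Lat P)) (i0 : Lat P).
Hypothesis Mi0 : M i0.

(** [Zexp] is comparable to [exp (sum_j a_j)] and the numerator of [Psi] is at
    least each of its terms. *)
Lemma Psi_lower (B : R) : 0 <= B -> exists K : R, forall x, (forall j, - B <= a x j) ->
  forall i, M i -> - Psi M x <= \sum_j a x j - pairing (p_ i) x + K.
Proof.
move=> B0; pose N := #|Lat P|%:R * expR (kmax s * B).
have N0 : 0 < N by rewrite mulr_gt0 ?expR_gt0// ltr0n; apply/card_gt0P; exists i0.
exists (ln N) => x aB i Mi.
have Z0 : 0 < Zexp p_ x by exact: (Zexp_gt0 p_ i0 x).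
have Zm0 := Zpart_gt0 x Mi0.
rewrite /Psi ln_div ?posrE// opprB.
have ZE : Zexp p_ x = expR (\sum_j a x j) * \sum_i wt_exp s i x.
  by rewrite mulr_sumr; apply: eq_bigr => k _; rewrite -expRD -pairing_kn.
have W0 : 0 < \sum_i wt_exp s i x by exact: lt_le_trans (sum_wt_exp_ge1 s x).
have -> : ln (Zexp p_ x) = \sum_j a x j + ln (\sum_i wt_exp s i x).
  by rewrite ZE lnM ?posrE ?expR_gt0// expRK.
have : ln (\sum_i wt_exp s i x) <= ln N by rewrite ler_ln ?posrE//; exact: sum_wt_exp_le.
have : pairing (p_ i) x <= ln (\sum_(i | M i) expR (pairing (p_ i) x)).
  rewrite -[leLHS]expRK ler_ln ?posrE ?expR_gt0// (bigD1 i) //= lerDl.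
  by apply: sumr_ge0 => k _; exact: expR_ge0.
by lra.
Qed.

Variables (D : pred 'I_n) (m0 : R).

(** Only the coordinates along the face can go to infinity, and there the volume
    decays like [exp (- A)] with A their sum, whereas [- Psi] grows at most like
    [(1 - m0) A]. *)
Lemma integrand_decay (c B : R) : 0 <= c -> c * (1 - m0) < 1 -> 0 <= B ->
  (forall b : 'I_n -> R, (forall j, 0 <= b j) -> (forall j, ~~ D j -> b j = 0) ->
     \sum_j b j = 1 -> exists2 i, M i & m0 <= pairing (p_ i) (\sum_j b j *: q j)) ->
  exists2 C : R, 0 <= C & exists2 eps : R, 0 < eps &
    forall x, (forall j, - B <= a x j) -> (forall j, ~~ D j -> a x j <= B) ->
      expR (- (c * Psi M x)) * \det (hess0 P x) <= C * expR (- eps * \sum_k `|x 0 k|).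
Proof.
move=> c0 cm B0 face.
have [K KP] := Psi_lower B0; have [C1 C10 C1P] := det_hess0_upper s B0.
pose kap := 1 - c * (1 - m0); have kap0 : 0 < kap by rewrite /kap; lra.
pose Q : R := 1 + \sum_j \sum_k `|q j 0 k|.
have Q0 : 0 < Q by apply: ltr_pwDl => //; apply: sumr_ge0 => j _; apply: sumr_ge0.
have km0 := kmax_ge0 s.
pose nB := n%:R * B; have nB0 : 0 <= nB by rewrite mulr_ge0 ?ler0n.
pose K2 := nB + c * (nB + nB * (1 + kmax s) + K) + kap * nB.
exists (C1 * expR K2); first by rewrite mulr_ge0 ?expR_ge0.
exists (kap / Q); first by rewrite divr_gt0.
move=> x aB aD; pose b j := if D j then Num.max (a x j) 0 else 0.
have b0 j : 0 <= b j by rewrite /b; case: (D j) => //; rewrite le_max lexx orbT.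
pose A := \sum_j b j; have A0 : 0 <= A by exact: sumr_ge0.
have ab j : `|a x j - b j| <= B.
  have := aB j; have := @aD j; rewrite /b; case: (D j) => /= aD' aB'.
    by case: (leP (a x j) 0) => h; rewrite ?subr0 ?subrr ?normr0// ler0_norm//; lra.
  by rewrite subr0 ler_norml aB' aD'.
have sum_nB (F : 'I_n -> R) (L : R) : (forall j, F j <= L) -> \sum_j F j <= n%:R * L.
  move=> FL; apply: (@le_trans _ _ (\sum_(j < n) L)); first exact: ler_sum.
  by rewrite sumr_const card_ord -[leLHS]mulr_natl.
have sab : \sum_j `|a x j - b j| <= nB by exact: sum_nB.
have SA : `|\sum_j a x j - A| <= nB.
  by rewrite /A -sumrB; apply: le_trans (ler_norm_sum _ _ _) sab.
have SaA : \sum_j `|a x j| <= A + nB.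
  apply: (@le_trans _ _ (\sum_j (b j + `|a x j - b j|))); last by rewrite big_split /= lerD2l.
  apply: ler_sum => j _; rewrite -{1}(subrK (b j) (a x j)) addrC.
  by apply: le_trans (ler_normD _ _) _; rewrite (ger0_norm (b0 j)).
have xA : \sum_k `|x 0 k| <= Q * (A + nB).
  apply: (@le_trans _ _ (Q * \sum_j `|a x j|)); last by rewrite ler_wpM2l// ltW.
  apply: (@le_trans _ _ (\sum_k \sum_j `|a x j| * `|q j 0 k|)).
    apply: ler_sum => k _; rewrite {1}(cone_coordK s x) summxE.
    apply: le_trans (ler_norm_sum _ _ _) _; apply: ler_sum => j _.
    by rewrite mxE normrM.
  rewrite exchange_big /= mulr_sumr; apply: ler_sum => j _; rewrite -mulr_sumr mulrC.
  apply: ler_wpM2r => //; apply: (@le_trans _ _ (\sum_j \sum_k `|q j 0 k|)); last by rewrite /Q lerDr.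
  by rewrite [leRHS](bigD1 j) //= lerDl; apply: sumr_ge0 => k _; apply: sumr_ge0.
have [i Mi ix] : exists2 i, M i & m0 * A - nB * (1 + kmax s) <= pairing (p_ i) x.
  have split_pairing i : pairing (p_ i) x =
      \sum_j b j * pairing (p_ i) (q j) + \sum_j (a x j - b j) * pairing (p_ i) (q j).
    by rewrite (pairing_cone s) -big_split /=; apply: eq_bigr => j _; ring.
  have rest i : - (nB * (1 + kmax s)) <= \sum_j (a x j - b j) * pairing (p_ i) (q j).
    rewrite lerNl -sumrN -mulrA; apply: sum_nB => j.
    apply: le_trans (ler_norm _) _; rewrite normrN normrM; apply: ler_pM => //.
    have := knE s i j; have := kn_le s i j; have := ler0n R (kn s i j).
    by set t : R := _%:R; move=> t0 tk tE; rewrite ler_norml; lra.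
  have [A00|An0] := eqVneq A 0.
    exists i0 => //; rewrite split_pairing A00 mulr0 sub0r big1 ?add0r// => j _.
    have /eqP := A00; rewrite psumr_eq0// => /allP /(_ j); rewrite mem_index_enum => /(_ isT) /eqP ->.
    by rewrite mul0r.
  have Agt0 : 0 < A by rewrite lt_neqAle eq_sym An0.
  have [j|j nDj||i Mi im] := face (fun j => b j / A).
  - by rewrite divr_ge0.
  - by rewrite /b (negPf nDj) mul0r.
  - by rewrite -mulr_suml mulfV.
  exists i => //; rewrite split_pairing.
  have := rest i; suff : m0 * A <= \sum_j b j * pairing (p_ i) (q j) by lra.
  rewrite -ler_pdivlMr//; apply: le_trans im _; rewrite pairing_sumr mulr_suml.
  by apply: ler_sum => j _; rewrite pairingZr mulrAC.
have detx := C1P x aB; have psix := KP x aB i Mi.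
apply: (@le_trans _ _ (expR (- (c * Psi M x)) * (C1 * expR (- \sum_j a x j)))).
  by rewrite ler_wpM2l ?expR_ge0.
rewrite mulrCA -!mulrA; apply: ler_wpM2l => //; rewrite -!expRD ler_expR.
move: SA; rewrite ler_norml => /andP[SA1 SA2].
have h1 : c * (- Psi M x) <= c * (\sum_j a x j - pairing (p_ i) x + K) by exact: ler_wpM2l.
have h2 : c * (\sum_j a x j - pairing (p_ i) x + K) <=
    c * ((A + nB) - (m0 * A - nB * (1 + kmax s)) + K) by apply: ler_wpM2l => //; lra.
have h3 : kap / Q * \sum_k `|x 0 k| <= kap * (A + nB).
  by rewrite -mulrA ler_wpM2l ?(ltW kap0)// mulrC ler_pdivrMr// mulrC.
by move: h1 h2 h3; rewrite /K2 /kap; lra.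
Qed.

Lemma converges (c B : R) (U : set (toric P)) : 0 <= c -> c * (1 - m0) < 1 -> 0 <= B ->
  (forall b : 'I_n -> R, (forall j, 0 <= b j) -> (forall j, ~~ D j -> b j = 0) ->
     \sum_j b j = 1 -> exists2 i, M i & m0 <= pairing (p_ i) (\sum_j b j *: q j)) ->
  (forall x th, U (torus_pt P x th) ->
     (forall j, - B <= a x j) /\ (forall j, ~~ D j -> a x j <= B)) ->
  (iint setT (fun x => (expR (- (c * Psi M x)))%:E *
    iint `[0%R, (2 * pi)%R] (fun th => (\1_U (torus_pt P x th))%:E) * (\det (hess0 P x))%:E) < +oo)%E.
Proof.
move=> c0 cm B0 face reg; have [C C0 [eps eps0 decay]] := integrand_decay c0 cm B0 face.
have pi0 : 0 <= 2 * pi :> R by rewrite mulr_ge0 ?ler0n ?pi_ge0.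
pose L : R := (2 * pi) ^+ n * C.
have L0 : 0 <= L by rewrite mulr_ge0// exprn_ge0.
apply: (@le_lt_trans _ _ (iint setT (fun x : 'rV[R]_n => L%:E * (expR (- eps * \sum_k `|x 0 k|))%:E)%E)).
  apply: le_iint => [x|x|x _].
  - by rewrite !mule_ge0 ?lee_fin ?expR_ge0 ?det_hess0_ge0// iint_ge0// => th; rewrite lee_fin indicE ler0n.
  - by rewrite mule_ge0 ?lee_fin ?expR_ge0.
  have [[th Uth]|nU] := pselect (exists th, U (torus_pt P x th)); last first.
    have -> : iint `[0%R, (2 * pi)%R] (fun th => (\1_U (torus_pt P x th))%:E) = 0%E :> \bar R.
      rewrite (_ : (fun th => _) = fun th : 'rV[R]_n => 0%:E).
        by rewrite iint_itv_cst// mul0r.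
      by apply/funext => th; rewrite indicE memNset// => Uth; apply: nU; exists th.
    by rewrite mule0 mul0e mule_ge0 ?lee_fin ?expR_ge0.
  have [aB aD] := reg _ _ Uth.
  apply: (@le_trans _ _ ((expR (- (c * Psi M x)))%:E * ((2 * pi) ^+ n)%:E * (\det (hess0 P x))%:E)%E).
    apply: lee_wpmul2r; first by rewrite lee_fin det_hess0_ge0.
    apply: lee_wpmul2l; first by rewrite lee_fin expR_ge0.
    have -> : ((2 * pi) ^+ n)%:E = iint `[0%R, (2 * pi)%R] (fun _ : 'rV[R]_n => 1%:E) :> \bar R.
      by rewrite iint_itv_cst// mul1r subr0.
    by apply: le_iint => [y|y|y _]; rewrite lee_fin ?indicE ?ler0n// lern1 leq_b1.
  rewrite -!EFinM lee_fin /L; have := ler_wpM2l (exprn_ge0 n pi0) (decay x aB aD); lra.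
rewrite iintZl ?expR_ge0//; last exact: cmeas_expR.
by rewrite lte_mul_pinfty// iint_expR_lty.
Qed.

End Convergence.

(** * Divergence *)

Section FiniteMin.
Context {R : realType} {I : finType}.

Lemma finite_pos_min (e : I -> R) : (forall i, 0 < e i) ->
  exists2 m : R, 0 < m & forall i, m <= e i.
Proof.
move=> e0; exists ((1 + \sum_i (e i)^-1)^-1) => [|i].
  by rewrite invr_gt0; apply: ltr_pwDl => //; apply: sumr_ge0 => i _; rewrite invr_ge0 ltW.
rewrite -[leRHS]invrK lef_pV2 ?posrE ?invr_gt0//; last first.
  by apply: ltr_pwDl => //; apply: sumr_ge0 => k _; rewrite invr_ge0 ltW.
rewrite (bigD1 i) //= addrCA lerDl; apply: addr_ge0 => //.
by apply: sumr_ge0 => k _; rewrite invr_ge0 ltW.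
Qed.

End FiniteMin.

Section TorusBox.
Context {R : realType} {n : nat} {P : fano_polytope R n}.
Local Open Scope complex_scope.
Variable s : chart P.
Notation Cn := 'rV[R]_(n + n).
Notation a x j := (cone_coord s x 0 j).
Notation q j := (realv R (@vert R n P (s j))).
Implicit Types (x y th v : 'rV[R]_n) (z : Cn) (j k : 'I_n).

Lemma cE_period (b t : R) (k : int) : cE b (t + k%:~R * (2 * pi)) = cE b t.
Proof.
have h : cE 0 (2 * pi : R) = 1.
  rewrite /cE oppr0 mul0r expR0 /cis cosN sinN mulr_natl cos2pi sin2pi oppr0.
  by apply/eqP; rewrite eq_complex /= !mulr0 !mul0r mulr1 subr0 addr0 !eqxx.
have hk : cE 0 (k%:~R * (2 * pi : R)) = 1.
  by rewrite -[X in cE X _](mulr0 (k%:~R)) -cE_exprz h exp1rz.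
by rewrite -[X in cE X _](addr0 b) cED hk mulr1.
Qed.

(** The frame is a basis of the lattice. *)
Lemma cone_coord_realv (p : 'rV[int]_n) j : exists k : int, a (realv R p) j = k%:~R.
Proof.
pose F := frame_mx (@vert R n P) s; exists ((p *m invmx F) 0 j).
have pE : realv R p = realv R (p *m invmx F) *m intmx F.
  by rewrite /realv /intmx -map_mxM mulmxKV// frame_unit.
by rewrite /cone_coord {1}pE mulmxK ?intmx_unit ?frame_unit// mxE.
Qed.

Lemma cE_continuous_box (b t r : R) : 0 < r -> exists2 e : R, 0 < e &
  forall u v : R, `|u| <= e -> `|v| <= e ->
    `|complex.Re (cE (b + u) (t + v)) - complex.Re (cE b t)| < r /\
    `|complex.Im (cE (b + u) (t + v)) - complex.Im (cE b t)| < r.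
Proof.
move=> r0.
pose f1 (w : R * R) : R := expR (- w.1 / 2) * cos (- w.2).
pose f2 (w : R * R) : R := expR (- w.1 / 2) * sin (- w.2).
have ReE b' t' : complex.Re (cE b' t') = f1 (b', t') by rewrite /cE /cis /= mul0r subr0.
have ImE b' t' : complex.Im (cE b' t') = f2 (b', t') by rewrite /cE /cis /= mul0r addr0.
have ce : continuous (fun w : R * R => expR (- w.1 / 2)).
  move=> w; apply: (@continuous_comp _ _ _ (fun w : R * R => - w.1 / 2) expR); last exact: continuous_expR.
  exact: cvgM (cvgN (@cvg_fst _ _ _ _ _)) (cvg_cst _).
have cn : continuous (fun w : R * R => - w.2).
  by move=> w; exact: cvgN (@cvg_snd _ _ _ _ _).
have c1 : continuous f1.
  move=> w; apply: cvgM (ce w) _.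
  apply: (@continuous_comp _ _ _ (fun w : R * R => - w.2) cos); [exact: cn|exact: continuous_cos].
have c2 : continuous f2.
  move=> w; apply: cvgM (ce w) _.
  apply: (@continuous_comp _ _ _ (fun w : R * R => - w.2) sin); [exact: cn|exact: continuous_sin].
have h1 : \forall w \near (b, t), `|f1 (b, t) - f1 w| < r by move/cvgrPdist_lt : (c1 (b, t)); exact.
have h2 : \forall w \near (b, t), `|f2 (b, t) - f2 w| < r by move/cvgrPdist_lt : (c2 (b, t)); exact.
have [e /= e0 eP] := (nbhs_ballP _ _).1 (filterI h1 h2).
exists (e / 2) => [|u v ue ve]; first by rewrite divr_gt0.
have [] := eP (b + u, t + v).
  by split; rewrite /ball /= opprD addrA subrr sub0r normrN; apply: le_lt_trans; eassumption || lra.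
by move=> k1 k2; rewrite distrC -2!ReE in k1; rewrite distrC -2!ImE in k2; split.
Qed.

(** In the chart the coordinates in [D] are small as soon as their logarithmic
    coordinates are large, so a box around a suitable point stays in a
    neighbourhood of [z] when it is translated along the cone spanned by [D].  The
    angles are reduced modulo 2 pi, so that the box lies in the range of
    integration. *)
Lemma torus_box (U : set Cn) z (D : pred 'I_n) : open U -> U z ->
  (forall j, D j -> toC z 0 j = 0) -> (forall j, ~~ D j -> toC z 0 j != 0) ->
  exists w th0, exists2 eta : R, 0 < eta &
    (forall k, 0 <= th0 0 k /\ th0 0 k + eta <= 2 * pi) /\
    forall x0, (forall j, 0 <= a x0 j) -> (forall j, ~~ D j -> a x0 j = 0) ->
    forall tau x th, 0 <= tau ->
      (forall k, (tau *: x0 + w) 0 k <= x 0 k <= (tau *: x0 + w) 0 k + eta) ->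
      (forall k, th0 0 k <= th 0 k <= th0 0 k + eta) ->
      U (torus_exp s x th).
Proof.
move=> oU Uz zD zD'; have /nbhs_ballP [r /= r0 rU] := oU _ Uz.
have reN (c : R[i]) : abs2 c < r ^+ 2 -> `|complex.Re c| < r /\ `|complex.Im c| < r.
  rewrite /abs2; set u := complex.Re c; set v := complex.Im c => h.
  have u2 := sqr_ge0 u; have v2 := sqr_ge0 v.
  by rewrite !ltr_norml; split; apply/andP; split; nra.
have /choice [f fP] j : exists f : R * R * R, 0 < f.2 /\ forall b u v : R,
    0 <= b -> (~~ D j -> b = 0) -> `|u| <= f.2 -> `|v| <= f.2 ->
    `|complex.Re (cE (b + f.1.1 + u) (f.1.2 + v)) - z 0 (lshift n j)| < r /\
    `|complex.Im (cE (b + f.1.1 + u) (f.1.2 + v)) - z 0 (rshift n j)| < r.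
  have zE : z 0 (lshift n j) = complex.Re (toC z 0 j) /\ z 0 (rshift n j) = complex.Im (toC z 0 j).
    by rewrite mxE.
  rewrite zE.1 zE.2; have [Dj|nDj] := boolP (D j).
    exists (1 - ln (r ^+ 2 / 2), 0, 1); split; first exact: ltr01.
    move=> b u v b0 _ u1 _; rewrite zD//.
    have -> : complex.Re (0 : R[i]) = 0 by [].
    have -> : complex.Im (0 : R[i]) = 0 by [].
    rewrite !subr0; apply: reN; rewrite abs2_cE /=; move: u1 => /= u1.
    have r2 : 0 < r ^+ 2 / 2 by rewrite divr_gt0// exprn_gt0.
    apply: (@le_lt_trans _ _ (r ^+ 2 / 2)); last by rewrite ltr_pdivrMr//; have := exprn_gt0 2 r0; lra.
    rewrite -[leRHS]lnK ?posrE// ler_expR; move: u1; rewrite ler_norml; lra.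
  have [b [t ztE]] := cE_surj (zD' j nDj).
  have [e e0 eP] := cE_continuous_box b t r0.
  exists (b, t, e) => /=; split=> // b' u v _ /(_ isT) -> ue ve.
  by rewrite add0r -ztE; exact: eP.
pose C := invmx (intmx (R := R) (frame_mx (@vert R n P) s)).
pose L : R := 1 + \sum_i \sum_j `|C i j|.
have L0 : 0 < L by apply: ltr_pwDl => //; apply: sumr_ge0 => i _; apply: sumr_ge0.
have aL v j e : 0 <= e -> (forall k, 0 <= v 0 k <= e) -> `|a v j| <= L * e.
  move=> e0 ve; rewrite /cone_coord mxE -/C; apply: le_trans (ler_norm_sum _ _ _) _.
  apply: (@le_trans _ _ (\sum_k `|C k j| * e)).
    apply: ler_sum => k _; rewrite normrM mulrC; apply: ler_wpM2l => //.
    by have /andP[v0 v1] := ve k; rewrite ger0_norm.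
  rewrite -mulr_suml; apply: ler_wpM2r => //; apply: (@le_trans _ _ (\sum_i \sum_j `|C i j|)).
    by apply: ler_sum => k _; rewrite (bigD1 j) //= lerDl; apply: sumr_ge0.
  by rewrite /L lerDr.
pose w := \sum_j (f j).1.1 *: q j; pose th1 := \sum_j (f j).1.2 *: q j.
have p20 : 0 < 2 * pi :> R by rewrite mulr_gt0// pi_gt0.
(* [th0]: the angles of [z], reduced modulo 2 pi *)
pose m := \row_k Num.floor (th1 0 k / (2 * pi)).
pose th0 := th1 - (2 * pi) *: realv R m.
have th0E k : th0 0 k = th1 0 k - (2 * pi) * (Num.floor (th1 0 k / (2 * pi)))%:~R.
  by rewrite /th0 mxE [X in _ + X]mxE [X in - X]mxE [X in _ * X]mxE [X in X%:~R]mxE.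
have th0b k : 0 <= th0 0 k < 2 * pi.
  rewrite th0E; have /andP[f1 f2] := floor_itv (th1 0 k / (2 * pi)).
  move: f1 f2; rewrite ler_pdivlMr// ltr_pdivrMr// intrD mulrDl mul1r.
  by set F : R := _%:~R => f1 f2; apply/andP; split; lra.
have [e1 e10 e1P] := finite_pos_min (fun j => (fP j).1).
have [e2 e20 e2P] : exists2 e2 : R, 0 < e2 & forall k, e2 <= 2 * pi - th0 0 k.
  by apply: finite_pos_min => k; rewrite subr_gt0; have /andP[] := th0b k.
have [eta [eta0 etaL eta2]] : exists eta : R, [/\ 0 < eta, L * eta <= e1 & eta <= e2].
  exists (Num.min (e1 / L) e2); rewrite lt_min divr_gt0// e20; split=> //.
    by rewrite mulrC -ler_pdivlMr// ge_min lexx.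
  by rewrite ge_min lexx orbT.
exists w, th0, eta => //; split.
  by move=> k; have /andP[h _] := th0b k; split=> //; have := e2P k; lra.
move=> x0 x00 x0D tau x th tau0 xb thb; apply: rU.
pose u := x - (tau *: x0 + w); pose v := th - th0.
have rowB (y y' : 'rV[R]_n) k : (y - y') 0 k = y 0 k - y' 0 k by rewrite !mxE.
have ub k : 0 <= u 0 k <= eta.
  by have := xb k; rewrite /u (rowB x (tau *: x0 + w)) => /andP[h1 h2]; apply/andP; split; lra.
have vb k : 0 <= v 0 k <= eta.
  by have := thb k; rewrite /v (rowB th th0) => /andP[h1 h2]; apply/andP; split; lra.
have aD y y' j : a (y + y') j = a y j + a y' j by rewrite cone_coordD mxE.
have aZ t y j : a (t *: y) j = t * a y j by rewrite cone_coordZ mxE.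
have aS (b : 'I_n -> R) j : a (\sum_j b j *: q j) j = b j by rewrite cone_coord_sum mxE.
have key j : `|complex.Re (toC (torus_exp s x th) 0 j) - z 0 (lshift n j)| < r /\
             `|complex.Im (toC (torus_exp s x th) 0 j) - z 0 (rshift n j)| < r.
  have xE : a x j = tau * a x0 j + (f j).1.1 + a u j.
    have -> : x = tau *: x0 + w + u by rewrite addrC subrK.
    by rewrite !aD aZ aS.
  have [k kE] := cone_coord_realv m j.
  have thE : a th j = (f j).1.2 + a v j + (- k)%:~R * (2 * pi).
    have -> : th = th1 + (- (2 * pi)) *: realv R m + v by rewrite scaleNr addrC subrK.
    by rewrite !aD aZ aS kE rmorphN /=; ring.
  rewrite torus_expE xE thE cE_period; apply: (fP j).2.
  - by rewrite mulr_ge0.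
  - by move=> nDj; rewrite x0D// mulr0.
  - by apply: le_trans (aL u j eta (ltW eta0) ub) _; apply: le_trans etaL (e1P j).
  - by apply: le_trans (aL v j eta (ltW eta0) vb) _; apply: le_trans etaL (e1P j).
split => // i l; rewrite !ord1 /ball /=.
have := @splitK n n l; case: (fintype.split l) => j /= <-.
  by have [h _] := key j; rewrite distrC; move: h; rewrite [X in complex.Re X]mxE.
by have [_ h] := key j; rewrite distrC; move: h; rewrite [X in complex.Im X]mxE.
Qed.

End TorusBox.

Section Divergence.
Context {R : realType} {n : nat} {P : fano_polytope R n}.
Variable s : chart P.
Notation p_ := (@lptR R n P).
Notation a x j := (cone_coord s x 0 j).
Notation q j := (realv R (@vert R n P (s j))).
Implicit Types (x y : 'rV[R]_n) (i : Lat P) (j k : 'I_n).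
Hypothesis adj : forall j, exists i, forall k, kn s i k = (k == j).
Variables (M : pred (Lat P)) (i0 : Lat P).
Hypothesis Mi0 : M i0.

Lemma Psi_upper (m : R) x : (forall i, M i -> pairing (p_ i) x <= m) ->
  \sum_j a x j - m - ln #|Lat P|%:R <= - Psi M x.
Proof.
move=> xm; have N0 : 0 < #|Lat P|%:R :> R by rewrite ltr0n; apply/card_gt0P; exists i0.
have Z0 : 0 < Zexp p_ x by exact: (Zexp_gt0 p_ i0 x).
have Zm0 := Zpart_gt0 x Mi0.
rewrite /Psi ln_div ?posrE// opprB.
have : \sum_j a x j <= ln (Zexp p_ x).
  have [i1 k1] := kn_pvert s.
  have -> : \sum_j a x j = pairing (p_ i1) x.
    by rewrite (pairing_kn s) [X in _ - X]big1 ?subr0// => j _; rewrite k1 mul0r.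
  rewrite -[leLHS]expRK ler_ln ?posrE ?expR_gt0// /Zexp (bigD1 i1) //= lerDl.
  by apply: sumr_ge0 => k _; exact: expR_ge0.
have : ln (\sum_(i | M i) expR (pairing (p_ i) x)) <= m + ln #|Lat P|%:R.
  rewrite -[X in X + _]expRK -lnM ?posrE ?expR_gt0// ler_ln ?posrE ?mulr_gt0 ?expR_gt0//.
  rewrite mulrC; apply: (@le_trans _ _ (\sum_(i : Lat P) expR m)).
    rewrite big_mkcond; apply: ler_sum => i _; case: (boolP (M i)) => [Mi|_]; last exact: expR_ge0.
    by rewrite ler_expR; exact: xm.
  by rewrite sumr_const -[leLHS]mulr_natl.
by lra.
Qed.

Lemma cmeas_limit_integrand (U : set (toric P)) (c : R) : xopen U ->
  cmeas (fun x => (expR (- (c * Psi M x)))%:E *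
    iint `[0%R, (2 * pi)%R] (fun th => (\1_U (torus_pt P x th))%:E) * (\det (hess0 P x))%:E)%E.
Proof.
move=> oU; apply: cmeasM; last exact: cmeas_vol.
apply: cmeasM.
  apply: cmeas_continuous => x.
  apply: (@continuous_comp _ _ _ (fun x => - (c * Psi M x)) expR); last exact: continuous_expR.
  exact: cvgN (cvgM (cvg_cst c) (continuous_Psi Mi0 (x := x))).
apply: (cmeas_torus_iint (F := fun p => (\1_U p)%:E)); first exact: measurable_itv.
  exact: tmeas_open.
by move=> p; rewrite lee_fin indicE ler0n.
Qed.

(** Along the direction of [x0] the exponential outgrows the decay of the
    volume, so that boxes of a fixed size pushed to infinity carry a mass that
    tends to infinity. *)
Lemma diverges (D : pred 'I_n) (m0 c : R) (U : set (toric P)) (z : 'rV[R]_(n + n)) x0 :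
  xopen U -> U (chart_pt s z) ->
  (forall j, D j -> toC z 0 j = 0) -> (forall j, ~~ D j -> toC z 0 j != 0) ->
  (forall j, 0 <= a x0 j) -> (forall j, ~~ D j -> a x0 j = 0) -> \sum_j a x0 j = 1 ->
  (forall i, M i -> pairing (p_ i) x0 <= m0) -> 0 <= c -> 1 < c * (1 - m0) ->
  iint setT (fun x => (expR (- (c * Psi M x)))%:E *
    iint `[0%R, (2 * pi)%R] (fun th => (\1_U (torus_pt P x th))%:E) * (\det (hess0 P x))%:E)%E = +oo%E.
Proof.
move=> oU Uz zD zD' x00 x0D x01 x0m c0 cm.
have [w [th0 [eta eta0 [thb box]]]] := torus_box s (oU s) Uz zD zD'.
have [G G0 GP] := lat_norm_le (P := P).
pose K1 := G * \sum_k (`|w 0 k| + eta).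
have K10 : 0 <= K1 by rewrite mulr_ge0//; apply: sumr_ge0 => k _; rewrite addr_ge0// ltW.
have nearK (y : 'rV[R]_n) : (forall k, w 0 k <= y 0 k <= w 0 k + eta) ->
    forall i, `|pairing (p_ i) y| <= K1.
  move=> wy i; apply: le_trans (GP i y) _; apply: ler_wpM2l => //; apply: ler_sum => k _.
  have /andP[h1 h2] := wy k; have := ler_norm (w 0 k); have := ler_norm (- w 0 k).
  by rewrite normrN ler_norml => h3 h4; apply/andP; split; lra.
have [i1 k1] := kn_pvert s.
have sumE y : \sum_j a y j = pairing (p_ i1) y.
  by rewrite (pairing_kn s) [X in _ - X]big1 ?subr0// => j _; rewrite k1 mul0r.
have coordK (y : 'rV[R]_n) : (forall k, w 0 k <= y 0 k <= w 0 k + eta) -> forall j, - (2 * K1) <= a y j.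
  move=> wy j; have [i2 k2] := adj j.
  have -> : a y j = pairing (p_ i1) y - pairing (p_ i2) y.
    rewrite -sumE (pairing_kn s) opprB addrC subrK (bigD1 j) //= k2 eqxx mul1r big1 ?addr0//.
    by move=> l /negPf lj; rewrite k2 lj mul0r.
  by have := nearK y wy i1; have := nearK y wy i2; rewrite !ler_norml => /andP[? ?] /andP[? ?]; lra.
have [d d0 dP] := det_hess0_lower adj (mulr_ge0 (ler0n R 2) K10).
pose kap := c * (1 - m0) - 1; have kap0 : 0 < kap by rewrite /kap; lra.
pose K3 := K1 + c * (2 * K1 + ln #|Lat P|%:R).
pose F x := ((expR (- (c * Psi M x)))%:E *
    iint `[0%R, (2 * pi)%R] (fun th => (\1_U (torus_pt P x th))%:E) * (\det (hess0 P x))%:E)%E.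
have F0 x : (0 <= F x)%E.
  rewrite !mule_ge0 ?lee_fin ?expR_ge0 ?det_hess0_ge0//.
  by apply: iint_ge0 => th; rewrite lee_fin indicE ler0n.
pose A := d * eta ^+ n * expR (- K3) * eta ^+ n.
have A0 : 0 < A by rewrite !mulr_gt0 ?exprn_gt0 ?expR_gt0.
have bound tau : 0 <= tau -> ((A * expR (kap * tau))%:E <= iint setT F)%E.
  move=> tau0.
  have -> : A * expR (kap * tau) = d * eta ^+ n * expR (kap * tau - K3) * eta ^+ n.
    by rewrite expRD /A; ring.
  apply: (iint_box (b := tau *: x0 + w)) => //.
  - exact: cmeas_limit_integrand.
  - by rewrite !mulr_ge0 ?expR_ge0 ?exprn_ge0 ?ltW.
  - exact: ltW.
  move=> x xb; pose y := x - tau *: x0.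
  have yb k : w 0 k <= y 0 k <= w 0 k + eta.
    have -> : y 0 k = x 0 k - tau * x0 0 k by rewrite !mxE.
    have := xb k; have -> : (tau *: x0 + w) 0 k = tau * x0 0 k + w 0 k by rewrite !mxE.
    by move=> /andP[h1 h2]; apply/andP; split; lra.
  have xE : x = tau *: x0 + y by rewrite addrC subrK.
  have axE j : a x j = tau * a x0 j + a y j by rewrite xE cone_coordD cone_coordZ !mxE.
  have ax j : - (2 * K1) <= a x j.
    by rewrite axE; have := coordK y yb j; have := mulr_ge0 tau0 (x00 j); lra.
  have sx : \sum_j a x j = tau + \sum_j a y j.
    by under eq_bigr do rewrite axE; rewrite big_split /= -mulr_sumr x01 mulr1.
  have := nearK y yb i1; rewrite ler_norml -sumE => /andP[s1 s2].
  have psi : tau * (1 - m0) - (2 * K1 + ln #|Lat P|%:R) <= - Psi M x.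
    have := @Psi_upper (tau * m0 + K1) x; rewrite sx => h.
    have/h : forall i, M i -> pairing (p_ i) x <= tau * m0 + K1.
      move=> i Mi; rewrite xE pairingDr pairingZr; apply: lerD; first exact: ler_wpM2l (x0m i Mi).
      by have := nearK y yb i; rewrite ler_norml => /andP[].
    by lra.
  have ths : ((eta ^+ n)%:E <= iint `[0%R, (2 * pi)%R] (fun th => (\1_U (torus_pt P x th))%:E))%E.
    rewrite -[X in X%:E]mul1r; apply: (iint_box (b := th0)) => //.
    - exact: (tmeas_torus x (tmeas_open oU)).
    - exact: ltW.
    - move=> k t /=; rewrite !in_itv /= => /andP[h1 h2]; have [h3 h4] := thb k.
      by apply/andP; split; lra.
    move=> th thb'; rewrite lee_fin indicE mem_set// (torus_ptE s).
    exact: (box x0 x00 x0D tau).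
  apply: (@le_trans _ _ ((expR (- (c * Psi M x)))%:E * (eta ^+ n)%:E * (\det (hess0 P x))%:E)%E); last first.
    apply: lee_wpmul2r; first by rewrite lee_fin det_hess0_ge0.
    by apply: lee_wpmul2l => //; rewrite lee_fin expR_ge0.
  rewrite -!EFinM lee_fin.
  have -> : d * eta ^+ n * expR (kap * tau - K3) = eta ^+ n * (expR (kap * tau - K3) * d) by ring.
  rewrite [leRHS]mulrAC [leRHS]mulrC; apply: ler_wpM2l; first by rewrite exprn_ge0// ltW.
  apply: (@le_trans _ _ (expR (- (c * Psi M x)) * (d * expR (- \sum_j a x j)))); last first.
    by apply: ler_wpM2l; [exact: expR_ge0|exact: dP].
  rewrite mulrCA [leLHS]mulrC; apply: ler_wpM2l; first exact: ltW.
  rewrite -expRD ler_expR sx.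
  by have := ler_wpM2l c0 psi; rewrite /kap /K3; lra.
apply/eqP; rewrite -leye_eq leNgt; apply/negP => Ioo.
have I0 : (0 <= iint setT F)%E by exact: iint_ge0.
have [r Ir] : exists r, iint setT F = r%:E.
  by exists (fine (iint setT F)); rewrite fineK// ge0_fin_numE.
have r0 : 0 <= r by rewrite -lee_fin -Ir.
clearbody A kap.
have tr : 0 <= r / (A * kap) by apply: divr_ge0 => //; apply: mulr_ge0; exact: ltW.
have := bound _ tr; rewrite Ir.
rewrite lee_fin; apply/negP; rewrite -ltNge.
apply: (@lt_le_trans _ _ (A * (1 + kap * (r / (A * kap))))); last first.
  by apply: ler_wpM2l; [exact: ltW|exact: expR_ge1Dx].
have -> : A * (1 + kap * (r / (A * kap))) = A + r by field; rewrite !gt_eqF.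
by rewrite ltrDr.
Qed.

End Divergence.

(** * Faces and fibres of the moment map *)

Section Fibres.
Context {R : realType} {n : nat} {P : fano_polytope R n}.
Local Open Scope complex_scope.
Notation p_ := (@lptR R n P).
Notation Cn := 'rV[R]_(n + n).
Implicit Types (x : 'rV[R]_n) (i : Lat P) (j k : 'I_n) (s : chart P) (z : Cn).
Variables (mu : toric P -> 'rV[R]_n) (yd : 'rV[R]_n).
Hypothesis hmu : moment_map mu.
Hypothesis adj : forall s j, exists i, forall k, kn s i k = (k == j).
Hypothesis Py : dual_polytope P yd.
Let delta := [set x | polytope P x /\ pairing yd x = 1].
Let deltas := dual_face P delta.
Let T i := `[< deltas (p_ i) >].
Let lam : R := (\sum_(i | T i) 1)^-1.

Definition sub_chart s := forall l, l \in tight P yd -> exists j, l = s j.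
Let D s j := s j \in tight P yd.

Lemma lattice_meanE : lattice_mean P deltas = lam *: \sum_(i | T i) p_ i.
Proof. by rewrite /lattice_mean !(sum_lattice_cond P (fun p => deltas (realv R p))). Qed.

Lemma dual_face_kn s i : sub_chart s -> T i <-> forall j, D s j -> kn s i j = 0%N.
Proof.
move=> ys; split.
  move=> /asboolP /(dual_faceE Py ys) [_ h] j Dj.
  by have := knE s i j; rewrite h// subrr => /eqP; rewrite pnatr_eq0 => /eqP.
move=> h; apply/asboolP/(dual_faceE Py ys); split; first exact: lpt_lattice.
by move=> j Dj; have := knE s i j; rewrite h// => /esym/eqP; rewrite subr_eq0 => /eqP.
Qed.

Section InChart.
Variable s : chart P.
Hypothesis ys : sub_chart s.

Lemma face_kn0 i j : T i -> D s j -> kn s i j = 0%N.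
Proof. by move=> /(dual_face_kn _ ys); exact. Qed.

Lemma pvert_in_face i : (forall j, kn s i j = 0%N) -> T i.
Proof. by move=> h; apply/(dual_face_kn _ ys) => j _. Qed.

Lemma adjacent_in_face i j : ~~ D s j -> (forall k, kn s i k = (k == j)) -> T i.
Proof.
move=> nDj h; apply/(dual_face_kn _ ys) => k Dk; rewrite h.
by case: eqP => // kj; rewrite kj (negPf nDj) in Dk.
Qed.

(** A point over the mean of the lattice points of the dual face. *)
Definition stratum_pt : Cn := ofC (\row_j (if D s j then 0 else 1)).

Lemma stratum_ptE j : toC stratum_pt 0 j = if D s j then 0 else 1.
Proof. by rewrite ofCK mxE. Qed.

(** At this point the sections of the face have modulus one and the other ones
    vanish. *)
Lemma mu_stratum_pt : mu (chart_pt s stratum_pt) = lattice_mean P deltas.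
Proof.
have wE i : wt s i stratum_pt = (T i)%:R.
  rewrite /wt; case: (boolP (T i)) => Ti.
    rewrite big1// => j _; rewrite stratum_ptE; case: ifP => Dj; first by rewrite face_kn0// expr0.
    by rewrite /abs2 /= expr1n expr0n addr0 expr1n.
  have [j Dj kj] : exists2 j, D s j & kn s i j != 0%N.
    apply: contrapT => h; move/negP: Ti; apply; apply/(dual_face_kn _ ys) => j Dj.
    by apply/eqP/negPn/negP => kj; apply: h; exists j.
  rewrite (bigD1 j) //= stratum_ptE Dj.
  by rewrite [X in X ^+ _](_ : _ = 0) ?expr0n ?(negPf kj) ?mul0r// /abs2 /= expr0n addr0.
apply/rowP => j; rewrite (moment_map_chart hmu) lattice_meanE.
under eq_bigr do rewrite wE; under [X in _ / X]eq_bigr do rewrite wE.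
rewrite mxE summxE mulrC; congr (_^-1 * _).
  by rewrite [RHS]big_mkcond; apply: eq_bigr => i _; case: (T i).
by rewrite [RHS]big_mkcond; apply: eq_bigr => i _; case: (T i); rewrite ?mul1r ?mul0r.
Qed.

Lemma lattice_mean_face : deltas (lattice_mean P deltas).
Proof.
have m1 := sum_mean pvert_in_face; have m0 := lam_gt0 pvert_in_face.
have mE x : pairing (lattice_mean P deltas) x = \sum_i (T i)%:R * lam * pairing (p_ i) x.
  by rewrite lattice_meanE; exact: mean_pairing.
apply/(dual_faceE Py ys); split=> [i|j Dj]; rewrite mE.
  rewrite -[leRHS]m1; apply: ler_sum => k _; rewrite ler_piMr//; first by rewrite mulr_ge0 ?ler0n// ltW.
  exact: lpt_lattice.
transitivity (\sum_i (T i)%:R * lam); last exact: m1.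
apply: eq_bigr => i _; case: (boolP (T i)) => Ti; last by rewrite !mul0r.
have := knE s i j; rewrite face_kn0// => h; have -> : pairing (p_ i) (realv R (@vert R n P (s j))) = 1 by lra.
by rewrite mulr1.
Qed.

End InChart.

(** The value of the moment map is a mean of the lattice points weighted by the
    sections, so over the dual face the sections of the other lattice points
    vanish.  The section of the vertex of the chart does not vanish, hence this
    vertex is on the dual face; the sections of its neighbours off the dual face
    are coordinates. *)
Lemma fibre_chart s z : deltas (mu (chart_pt s z)) ->
  sub_chart s /\ forall j, D s j -> toC z 0 j = 0.
Proof.
move=> dmu.
have Z0 : 0 < \sum_i wt s i z.
  by have := sum_wt_gt0 (c := fun=> 1) s z (fun=> ltr01); under eq_bigr do rewrite mul1r.
have muE x : pairing (mu (chart_pt s z)) x * \sum_i wt s i z = \sum_i wt s i z * pairing (p_ i) x.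
  rewrite /pairing mulr_suml; under [RHS]eq_bigr do rewrite mulr_sumr.
  rewrite [RHS]exchange_big; apply: eq_bigr => j _; rewrite (moment_map_chart hmu) mulrAC divfK ?gt_eqF//.
  by rewrite mulr_suml; apply: eq_bigr => i _; rewrite mulrA.
have wt0 l i : l \in tight P yd -> pairing (p_ i) (realv R (@vert R n P l)) != 1 -> wt s i z = 0.
  move=> lt pi1; have [_ /(_ _ (vert_vertex l))] := dmu.
  have dl : delta (realv R (@vert R n P l)) by split; [exact: polytope_vert|exact/tightP].
  move=> /(_ dl) mul; have := muE (realv R (@vert R n P l)); rewrite mul mul1r => h.
  have : \sum_i wt s i z * (1 - pairing (p_ i) (realv R (@vert R n P l))) = 0.
    by under eq_bigr do rewrite mulrBr mulr1; rewrite sumrB -h subrr.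
  move=> /eqP; rewrite psumr_eq0; last first.
    by move=> k _; rewrite mulr_ge0 ?wt_ge0// subr_ge0; exact: lpt_lattice.
  move=> /allP /(_ i); rewrite mem_index_enum => /(_ isT); rewrite mulf_eq0 => /orP[/eqP //|].
  by rewrite subr_eq0 eq_sym (negPf pi1).
split=> [l lt|j Dj].
  have [i ip wi] := wt_pvert s; apply/(pvert_facet s l).2; rewrite -ip.
  by apply: contrapT => /eqP h; have := wt0 l i lt h; rewrite wi => /eqP; rewrite oner_eq0.
have [i ik] := adj s j; have := wt0 (s j) i Dj.
have := knE s i j; rewrite ik eqxx => h.
have -> : pairing (p_ i) (realv R (@vert R n P (s j))) = 0 by move: h; rewrite /=; lra.
rewrite eq_sym oner_eq0 => /(_ isT); rewrite /wt (bigD1 j) //= ik eqxx big1 ?mulr1.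
  by rewrite expr1 => /eqP; rewrite abs2_eq0 => /eqP.
by move=> k /negPf kj; rewrite ik kj expr0.
Qed.

End Fibres.

Section Perturbation.
Context {R : realType} {n : nat}.
Local Open Scope complex_scope.
Notation Cn := 'rV[R]_(n + n).

Lemma perturb (U : set Cn) (z : Cn) (D : pred 'I_n) : open U -> U z ->
  (forall j, D j -> toC z 0 j = 0) ->
  exists z', [/\ U z', forall j, D j -> toC z' 0 j = 0 & forall j, ~~ D j -> toC z' 0 j != 0].
Proof.
move=> oU Uz zD; have /nbhs_ballP [r /= r0 rU] := oU _ Uz.
pose b : Cn := row_mx (\row_j (~~ D j && (toC z 0 j == 0))%:R) 0.
have bl j : b 0 (lshift n j) = (~~ D j && (toC z 0 j == 0))%:R by rewrite row_mxEl mxE.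
have br j : b 0 (rshift n j) = 0 by rewrite row_mxEr mxE.
pose z' := z + (r / 2) *: b.
have zE m : z' 0 m = z 0 m + r / 2 * b 0 m by rewrite /z' mxE [X in _ + X]mxE.
have zC j : toC z' 0 j = toC z 0 j + (r / 2 * (~~ D j && (toC z 0 j == 0))%:R)%:C.
  apply/eqP; rewrite eq_complex [toC z' 0 j]mxE [X in X + _]mxE /= !zE bl br.
  by rewrite mulr0 !eqxx.
exists z'; split.
- apply: rU; split=> // i m; rewrite ord1 /ball /= zE opprD addrA subrr sub0r normrN.
  rewrite normrM gtr0_norm ?divr_gt0//.
  suff : `|b 0 m| <= 1 by move=> h; have := @ler_wpM2l _ (r / 2) (ltW (divr_gt0 r0 (ltr0n _ 2))) _ _ h; lra.
  have := @splitK n n m; case: (fintype.split m) => j /= <-; rewrite ?bl ?br ?normr0//.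
  by rewrite normr_nat lern1 leq_b1.
- by move=> j Dj; rewrite zC zD// Dj mulr0 addr0.
- move=> j nDj; rewrite zC nDj /=; case: (eqVneq (toC z 0 j) 0) => [->|h]; last by rewrite mulr0 addr0.
  by rewrite add0r mulr1 -abs2_eq0 abs2_real sqrf_eq0 gt_eqF// divr_gt0.
Qed.

End Perturbation.

(** * Singularity exponent and multiplier ideals *)

Section XInt.
Context {R : realType} {n : nat} {P : fano_polytope R n}.

Lemma xint_le_scale (B : R) (F G : toric P -> \bar R) : 0 <= B -> tmeas G ->
  (forall p, (0 <= F p)%E) -> (forall p, (0 <= G p)%E) -> (forall p, (F p <= B%:E * G p)%E) ->
  (xint G < +oo)%E -> (xint F < +oo)%E.
Proof.
move=> B0 mG F0 G0 FG Goo.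
have mths : measurable `[0%R, (2 * pi)%R : R]%classic by exact: measurable_itv.
apply: (@le_lt_trans _ _ (B%:E * xint G)%E); last by rewrite lte_mul_pinfty.
have D0 x : (0 <= (\det (hess0 P x))%:E)%E by rewrite lee_fin det_hess0_ge0.
rewrite /xint -iintZl//; last 2 first.
- by apply: cmeasM; [exact: (cmeas_torus_iint mths mG G0)|exact: cmeas_vol].
- by move=> x; rewrite mule_ge0 ?iint_ge0.
apply: le_iint => [x|x|x _].
- by rewrite mule_ge0 ?iint_ge0.
- by rewrite !mule_ge0 ?lee_fin ?iint_ge0// det_hess0_ge0.
rewrite muleA; apply: lee_wpmul2r => //; rewrite -iintZl//; last exact: (tmeas_torus x mG).
by apply: le_iint => th; rewrite ?mule_ge0 ?lee_fin.
Qed.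

End XInt.

Section Exponent.
Context {R : realType} {n : nat} {P : fano_polytope R n}.
Local Open Scope complex_scope.
Notation p_ := (@lptR R n P).
Notation Cn := 'rV[R]_(n + n).
Implicit Types (x : 'rV[R]_n) (i : Lat P) (j k : 'I_n) (s : chart P) (z : Cn).
Variables (mu : toric P -> 'rV[R]_n) (yd : 'rV[R]_n).
Hypothesis hmu : moment_map mu.
Hypothesis adj : forall s j, exists i, forall k, kn s i k = (k == j).
Hypothesis Py : dual_polytope P yd.
Let delta := [set x | polytope P x /\ pairing yd x = 1].
Let deltas := dual_face P delta.
Let K := mu @^-1` [set lattice_mean P deltas].
Variables (M : pred (Lat P)) (i0 : Lat P) (psioo : toric P -> \bar R).
Hypothesis Mi0 : M i0.
Hypothesis psi_meas : tmeas psioo.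
Hypothesis xl : forall (U : set (toric P)) (c : R), xopen U ->
  xint (fun p => (\1_U p)%:E * expeR (- (c%:E * psioo p)))%E =
  iint setT (fun x => (expR (- (c * Psi M x)))%:E *
    iint `[0%R, (2 * pi)%R] (fun th => (\1_U (torus_pt P x th))%:E) * (\det (hess0 P x))%:E)%E.
Hypothesis sc : exists s, sub_chart yd s.

Lemma Psi_le0 x : Psi M x <= 0.
Proof.
rewrite /Psi; apply: ln_le0.
rewrite ler_pdivrMr ?(Zexp_gt0 p_ i0)// mul1r /Zexp [leRHS](bigID M) /= lerDl.
by apply: sumr_ge0 => i _; exact: expR_ge0.
Qed.

Lemma xopen_preimage (B : set 'rV[R]_n) : open B -> xopen (mu @^-1` B).
Proof. by move=> oB s; have /continuousP := hmu.1 s; apply. Qed.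

(** One neighbourhood serves all the exponents, because it comes from the moment
    map. *)
Lemma integrable_near_fibre (m0 : R) : m0 <= 0 ->
  (forall y, delta y -> exists2 i, M i & m0 <= pairing (p_ i) y) ->
  exists U, [/\ xopen U, K `<=` U & forall c : R, c * (1 - m0) < 1 ->
    integrable_on U (fun p => expeR (- (c%:E * psioo p)))%E].
Proof.
move=> m00 face; have [s ys] := sc.
have [eps eps0 [B B0 reg]] := moment_region (adj s) (face_kn0 Py ys) (pvert_in_face Py ys) (adjacent_in_face Py ys).
rewrite -lattice_meanE in reg.
exists (mu @^-1` ball (lattice_mean P deltas) eps); split.
- by apply: xopen_preimage; exact: ball_open.
- by move=> p /= ->; exact: ballxx.
move=> c cm; rewrite /integrable_on xl; last by apply: xopen_preimage; exact: ball_open.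
have conv (c' : R) : 0 <= c' -> c' * (1 - m0) < 1 ->
  (iint setT (fun x => (expR (- (c' * Psi M x)))%:E *
    iint `[0%R, (2 * pi)%R] (fun th => (\1_(mu @^-1` ball (lattice_mean P deltas) eps) (torus_pt P x th))%:E) *
    (\det (hess0 P x))%:E) < +oo)%E.
  move=> c0 cm'; apply: (converges (s := s) Mi0 (D := fun j => s j \in tight P yd) c0 cm' B0).
    move=> b b0 bD b1; apply: face; apply/(face_coordP Py ys); rewrite cone_coord_sum; split.
    - by move=> j; rewrite mxE.
    - by move=> j Dj; rewrite mxE bD.
    - by rewrite -[RHS]b1; apply: eq_bigr => j _; rewrite mxE.
  move=> x th /= Uth; apply: reg => k; move: Uth; rewrite hmu.2 => -[_ /(_ 0 k)].
  by rewrite /ball /= distrC => /ltW.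
have [c0|c0] := leP 0 c; first exact: conv.
apply: le_lt_trans (conv 0 (lexx 0) _); last by rewrite mul0r.
have ths0 x : (0 <= iint `[0%R, (2 * pi)%R]
    (fun th => (\1_(mu @^-1` ball (lattice_mean P deltas) eps) (torus_pt P x th) : R)%:E))%E.
  by apply: iint_ge0 => th; rewrite lee_fin indicE ler0n.
apply: le_iint => [x|x|x _].
- by rewrite !mule_ge0 ?lee_fin ?expR_ge0 ?det_hess0_ge0.
- by rewrite !mule_ge0 ?lee_fin ?expR_ge0 ?det_hess0_ge0.
apply: lee_wpmul2r; first by rewrite lee_fin det_hess0_ge0.
apply: lee_wpmul2r => //; rewrite lee_fin ler_expR mul0r oppr0 oppr_le0.
by have := Psi_le0 x; nra.
Qed.

Lemma exponent_ge (m0 : R) : m0 <= 0 ->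
  (forall y, delta y -> exists2 i, M i & m0 <= pairing (p_ i) y) ->
  (((1 - m0)^-1)%:E <= sing_exponent K psioo)%E.
Proof.
move=> m00 face; have [U [oU KU Uint]] := integrable_near_fibre m00 face.
have m1 : 0 < 1 - m0 by lra.
have L0 : 0 < (1 - m0)^-1 by rewrite invr_gt0.
have lower (c : R) : 0 <= c -> c < (1 - m0)^-1 -> (c%:E <= sing_exponent K psioo)%E.
  move=> c0 cL; apply: ereal_sup_ubound; exists c => //; split=> //; exists U; split=> //.
  by apply: Uint; rewrite -ltr_pdivlMr// div1r.
rewrite leNgt; apply/negP => Sl.
have := lower 0 (lexx 0) L0; move: Sl lower; case: (sing_exponent K psioo) => [r| |]// Sl lower.
rewrite lee_fin => r0; rewrite lte_fin in Sl.
have := lower ((r + (1 - m0)^-1) / 2); rewrite lee_fin => h.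
have {}h : (r + (1 - m0)^-1) / 2 <= r by apply: h; lra.
by lra.
Qed.

(** At the distinguished point of the fibre, every holomorphic function is locally
    bounded and [exp (- gam psioo)] is locally integrable, so the multiplier ideal
    is trivial there. *)
Lemma fibre_not_in_mis (m0 gam : R) : m0 <= 0 ->
  (forall y, delta y -> exists2 i, M i & m0 <= pairing (p_ i) y) -> gam * (1 - m0) < 1 ->
  ~ (mu @^-1` deltas `<=` mis_support (fun p => gam%:E * psioo p)%E).
Proof.
move=> m00 face gm sub; have [U0 [oU0 KU0 Uint]] := integrable_near_fibre m00 face.
have [s ys] := sc; pose pt := chart_pt s (stratum_pt yd s).
have muE : mu pt = lattice_mean P deltas by exact: mu_stratum_pt.
apply: (sub pt); first by rewrite /= muE; exact: lattice_mean_face ys.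
move=> U f oU Upt hf; pose B := 1 + abs2 (f pt).
have B0 : 0 <= B by rewrite addr_ge0// abs2_ge0.
pose V := U `&` U0 `&` [set p | abs2 (f p) < B].
have VU : V `<=` U by move=> p [[]].
have oV : xopen V.
  move=> s'; rewrite openE => z [[Uz U0z] fz] /=.
  have [[sRe sIm] _] := hf s'.
  have cRe : {for z, continuous (fun z => complex.Re (f (chart_pt s' z)))} by have [] := sRe [::] z Uz.
  have cIm : {for z, continuous (fun z => complex.Im (f (chart_pt s' z)))} by have [] := sIm [::] z Uz.
  have cf : abs2 (f (chart_pt s' w)) @[w --> z] --> abs2 (f (chart_pt s' z)).
    exact: cvgD (cvgM cRe cRe) (cvgM cIm cIm).
  have near1 := open_nbhs_nbhs (conj (oU s') Uz).
  have near2 := open_nbhs_nbhs (conj (oU0 s') U0z).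
  have near3 : \forall w \near z, abs2 (f (chart_pt s' w)) < B.
    by apply: (cf [set r | r < B]); apply: open_nbhs_nbhs; split; [exact: open_lt|exact: fz].
  exact: filterI (filterI near1 near2) near3.
have Vpt : V pt.
  split; last by rewrite /= /B; lra.
  by split=> //; apply: KU0; exact: muE.
exists V; split=> //; split.
  move=> s'; have [[sRe sIm] hol] := hf s'; split.
    by split=> l z Vz; [apply: sRe; exact: VU|apply: sIm; exact: VU].
  by move=> j z Vz; apply: hol; exact: VU.
move=> p Vp; exists V; split=> //.
apply: (xint_le_scale B0) (Uint gam gm) => //.
- by apply: tmeasM; [exact: tmeas_open|exact: tmeas_expeR].
- by move=> q; rewrite !mule_ge0 ?lee_fin ?indicE ?ler0n ?abs2_ge0 ?expeR_ge0.
- by move=> q; rewrite !mule_ge0 ?lee_fin ?indicE ?ler0n ?expeR_ge0.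
move=> q; rewrite !indicE; have [qV|qV] := boolP (q \in V); last first.
  by rewrite mul0e !mule_ge0 ?lee_fin ?ler0n ?expeR_ge0.
have [[_ qU0] /= fq] : V q by exact: set_mem qV.
rewrite (mem_set qU0) !mul1e; apply: lee_wpmul2r; first exact: expeR_ge0.
by rewrite lee_fin ltW.
Qed.

(** A neighbourhood of a point over the face also contains points whose vanishing
    coordinates are exactly those of the face, where the divergence is seen. *)
Lemma not_integrable (m0 gam : R) s z (U : set (toric P)) x0 : sub_chart yd s ->
  (forall j, s j \in tight P yd -> toC z 0 j = 0) -> xopen U -> U (chart_pt s z) ->
  delta x0 -> (forall i, M i -> pairing (p_ i) x0 <= m0) -> 0 <= gam -> 1 < gam * (1 - m0) ->
  ~ integrable_on U (fun p => expeR (- (gam%:E * psioo p)))%E.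
Proof.
move=> ys zD oU Uz dx0 xm g0 gm.
have [z' [Uz' z'D z'D']] := perturb (D := fun j => s j \in tight P yd) (oU s) Uz zD.
have [a0 aD a1] := (face_coordP Py ys x0).1 dx0.
rewrite /integrable_on xl// (diverges (adj s) Mi0 oU Uz' z'D z'D' a0 aD a1 xm g0 gm).
by rewrite ltxx.
Qed.

Lemma exponent_le (m0 : R) x0 : m0 <= 0 -> delta x0 ->
  (forall i, M i -> pairing (p_ i) x0 <= m0) ->
  (sing_exponent K psioo <= ((1 - m0)^-1)%:E)%E.
Proof.
move=> m00 dx0 xm; apply: ub_ereal_sup => _ [c [c0 [U [oU KU Ui]]] <-].
rewrite lee_fin leNgt; apply/negP => cL; have [s ys] := sc.
have m1 : 0 < 1 - m0 by lra.
apply: (not_integrable (m0 := m0) (gam := c) (s := s) (z := stratum_pt yd s) ys _ oU _ dx0 xm c0) Ui.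
- by move=> j Dj; rewrite stratum_ptE Dj.
- by apply: KU; exact: mu_stratum_pt.
- by rewrite -ltr_pdivrMr// div1r.
Qed.

(** It suffices to test the constant function 1. *)
Lemma fibre_in_mis (m0 gam : R) x0 : delta x0 ->
  (forall i, M i -> pairing (p_ i) x0 <= m0) -> 0 <= gam -> 1 < gam * (1 - m0) ->
  mu @^-1` deltas `<=` mis_support (fun p => gam%:E * psioo p)%E.
Proof.
move=> dx0 xm g0 gm p dp reg.
have one_hol : xholomorphic setT (fun _ : toric P => 1 : R[i]).
  have smooth_cst (r : R) : smooth_on [set: Cn] (fun=> r).
    have h l : exists r', pderiv l (fun _ : Cn => r) = fun=> r'.
      elim: l => [|k l [r' h]]; first by exists r.
      exists 0; rewrite /pderiv /= -/(pderiv l (fun=> r)) h.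
      by apply/funext => z; exact: derive_cst.
    move=> l z _; have [r' ->] := h l; split; first exact: cst_continuous.
    by move=> k; exact: derivable_cst.
  move=> s; split; first by split; exact: smooth_cst.
  move=> j z _; rewrite /dzb /cderiv /= !derive_cst.
  by rewrite mulr0 addr0 mul0r.
have [V [oV Vp _ [_ /(_ p Vp) [W [oW Wp _ Wi]]]]] :=
  reg setT (fun=> 1) (fun s => openT) I one_hol.
have [s [z pE]] := chart_pt_surj p.
have dmu : deltas (mu (chart_pt s z)) by rewrite -pE.
have [ys zD] := fibre_chart hmu adj dmu.
apply: (not_integrable ys zD oW _ dx0 xm g0 gm); first by rewrite -pE.
move: Wi; rewrite /integrable_on; congr (xint _ < +oo)%E; apply/funext => q.
by rewrite [abs2 _](_ : _ = 1) ?mul1e// /abs2 /= expr1n expr0n addr0.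
Qed.

End Exponent.

(** * The theorem *)

Section MaximalPoints.
Context {R : realType} {n : nat} (P : fano_polytope R n) (b : 'rV[R]_n).
Notation p_ := (@lptR R n P).

Lemma max_ptsP (i0 : Lat P) : (forall i, pairing (p_ i) (- b) <= pairing (p_ i0) (- b)) ->
  forall i, max_pts P b (lpt i) <-> pairing (p_ i) (- b) = pairing (p_ i0) (- b).
Proof.
move=> i0max i; split=> [[_ h]|h].
  by apply/eqP; rewrite eq_le i0max; apply: h; exact: lpt_lattice.
split; first exact: lpt_lattice.
by move=> p /lptP [k <-]; rewrite [leRHS]h; exact: i0max.
Qed.

End MaximalPoints.

Lemma kr_flow_adjacent (R : realType) n (P : fano_polytope R n) (h : toric P -> R)
    (phi : R -> toric P -> R) : kr_flow h phi ->
  forall (s : chart P) j, exists i, forall k, kn s i k = (k == j).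
Proof.
move=> [phi0 phik _ _] s j; apply: adjacent_lattice_point.
have [_ /(_ s 0)] := phik 0 (lexx 0); rewrite (_ : pot (phi 0) s = pot0 s)//.
by apply/funext => z; rewrite /pot phi0 addr0.
Qed.

Theorem theorem3p1 (R : realType) (n : nat) (P : fano_polytope R n)
    (mu : toric P -> 'rV[R]_n)
    (vKRS : chart P -> 'rV[R]_(n + n) -> 'rV[R[i]]_n) (phiKRS : toric P -> R)
    (beta : 'rV[R]_n)
    (h0 : toric P -> R) (phi : R -> toric P -> R)
    (x : R -> 'rV[R]_n) (s : R -> R)
    (psi : R -> toric P -> R) (psioo : toric P -> \bar R)
    (l : nat) (delta deltas : set 'rV[R]_n) :
  class_W1 P ->
  ~ (exists f : toric P -> R, kaehler_einstein f) ->
  moment_map mu ->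
  kr_soliton vKRS phiKRS ->
  im_generates_in_G vKRS ->
  (forall c z, vKRS c z = vf_of beta c z) ->
  ricci_potential h0 ->
  kr_flow h0 phi ->
  minimal_points beta phi x ->
  tian_zhu vKRS beta phi x s ->
  pulled_potentials beta s psi ->
  L1_limit psi psioo ->
  almost_psh psioo ->
  (l < n)%N ->
  is_face (dual_polytope P) deltas -> has_dim deltas (n - l - 1)%N ->
  is_face (polytope P) delta -> has_dim delta l ->
  deltas = dual_face P delta ->
  let c := sing_exponent (mu @^-1` [set lattice_mean P deltas]) psioo in
  let mis (gamma : R) := mis_support (fun p => gamma%:E * psioo p)%E in
  let star (y : 'rV[R]_n) :=
    forall p, max_pts P beta p -> pairing (realv R p) y < 0 in
  ((forall y, delta y -> exists2 p, max_pts P beta p & 0 <= pairing (realv R p) y) ->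
    (1 <= c)%E /\
    forall gamma : R, gamma < 1 -> ~ (mu @^-1` deltas `<=` mis gamma))
  /\
  ((exists2 y, delta y & star y) ->
    forall (p0 : 'rV[int]_n) (x0 : 'rV[R]_n),
      max_pts P beta p0 -> is_vertex (dual_polytope P) (realv R p0) ->
      delta x0 -> star x0 ->
      (forall p, max_pts P beta p ->
        pairing (realv R p) x0 <= pairing (realv R p0) x0) ->
      (forall y, delta y -> star y -> exists2 p, max_pts P beta p &
        pairing (realv R p0) x0 <= pairing (realv R p) y) ->
      [/\ c = ((1 - pairing (realv R p0) x0)^-1)%:E,
          (c < 1)%E &
          forall gamma : R, (c < gamma%:E)%E -> gamma < 1 ->
            mu @^-1` deltas `<=` mis gamma]).
Proof.
move=> _ _ hmu _ _ _ _ flow _ tz pp L1 psh ln _ _ dface ddim deltasE c mis star.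
have n0 : (0 < n)%N by exact: leq_ltn_trans ln.
have adj := kr_flow_adjacent flow.
have [yd Py deltaE] := face_dual_point ln dface ddim.
have sc := tight_sub_chart n0 Py.
rewrite {}deltasE in c *; rewrite {dface ddim}deltaE in c star *.
have [k0 _] := some_lat (P := P).
have [i0 i0max [g g0 gap]] := finite_max_gap (fun i : Lat P => pairing (lptR i) (- beta)) k0.
pose M : pred (Lat P) := fun i => pairing (lptR i) (- beta) == pairing (lptR i0) (- beta).
have Mi0 : M i0 by exact: eqxx.
have Meq i : M i -> pairing (lptR i) (- beta) = pairing (lptR i0) (- beta) by move/eqP.
have Mlt i : ~~ M i -> pairing (lptR i) (- beta) <= pairing (lptR i0) (- beta) - g.
  by move=> /eqP nM; have [|] := gap i.
have maxM i : M i <-> max_pts P beta (lpt i).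
  by rewrite max_ptsP; [split=> /eqP|exact: i0max].
have soo := regularization_cvg tz.
have pm : tmeas psioo by exact: tmeas_almost_psh.
have xl := xint_limit Mi0 g0 Meq Mlt soo pp L1 psh.
split.
  move=> pos; have face y : [set x0 | polytope P x0 /\ pairing yd x0 = 1] y ->
      exists2 i, M i & 0 <= pairing (lptR i) y.
    move=> /pos [p pmax py]; have [i ip] := lptP pmax.1.
    by exists i; [apply/maxM; rewrite ip|rewrite /lptR ip].
  split.
    by have := exponent_ge hmu adj Py Mi0 xl sc (lexx 0) face; rewrite subr0 invr1.
  by move=> gam g1; apply: (fibre_not_in_mis hmu adj Py Mi0 pm xl sc (lexx 0) face); rewrite subr0 mulr1.
move=> _ p0 x0 p0max _ dx0 x0star x0max x0min.
set m0 := pairing (realv R p0) x0.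
have m00 : m0 < 0 by exact: x0star.
have m00' : m0 <= 0 by exact: ltW.
have m1 : 0 < 1 - m0 by rewrite subr_gt0 (lt_trans m00).
have face y : [set x0 | polytope P x0 /\ pairing yd x0 = 1] y ->
    exists2 i, M i & m0 <= pairing (lptR i) y.
  move=> dy; have [p pmax py] : exists2 p, max_pts P beta p & m0 <= pairing (realv R p) y.
    have [sy|/existsNP [p /not_implyP [pmax /negP]]] := pselect (star y); first exact: x0min.
    by rewrite -leNgt => py; exists p => //; exact: le_trans py.
  have [i ip] := lptP pmax.1.
  by exists i; [apply/maxM; rewrite ip|rewrite /lptR ip].
have xm i : M i -> pairing (lptR i) x0 <= m0 by move=> /maxM; exact: x0max.
have cE : c = ((1 - m0)^-1)%:E.
  apply/eqP; rewrite eq_le; apply/andP; split.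
    exact: (exponent_le hmu adj Py Mi0 xl sc m00' dx0 xm).
  exact: (exponent_ge hmu adj Py Mi0 xl sc m00' face).
split=> //.
  by rewrite cE lte_fin invf_lt1//; lra.
move=> gam; rewrite cE lte_fin => gc _.
apply: (fibre_in_mis hmu adj Py Mi0 xl dx0 xm).
  by apply: ltW; apply: lt_trans gc; rewrite invr_gt0.
by rewrite -ltr_pdivrMr// div1r.
Qed.
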